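(* A bounded set $K$ in $L^2(\mathbb{R}^+)$ is relatively compact in $L^2(\mathbb{R}^+)$ if and only if $$\lim_{\xi\to+\infty}\ \sup_{f\in K}\left(\int_{\mathbb{R}^+\setminus\left[\frac1\xi,\xi\right]}|f(x)|^2\,\frac{dx}{x}+\int_{\mathbb{R}\setminus[-\xi,\xi]}|\mathcal{M}f(\omega)|^2\,d\omega\right)=0.$$
   Context: Functions are complex-valued. $\mathbb{R}^+=(0,+\infty)$ and $L^2(\mathbb{R}^+)=L^2(\mathbb{R}^+,r^{-1}dr)$ is the space of measurable functions on $\mathbb{R}^+$ that are square integrable with respect to the Haar measure $r^{-1}dr$, with $\|f\|^2_{L^2(\mathbb{R}^+)}=\int_0^{+\infty}|f(r)|^2\frac{dr}{r}$. $L^2(\mathbb{R})$ is the usual space with Lebesgue measure. The Mellin transform is $$\mathcal{M}f(\omega)=\int_0^{+\infty}f(r)r^{-2\pi i\omega}\,\frac{dr}{r},\qquad\omega\in\mathbb{R},$$ understood on $L^2(\mathbb{R}^+)$ in the Plancherel sense, i.e. $\mathcal{M}f$ is the ($L^2$, unitary) Fourier transform, with kernel $e^{-2\pi i\omega x}$, of the function $x\mapsto f(e^x)\in L^2(\mathbb{R})$. *)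

(* Defs.v *)
From HB Require Import structures.
From mathcomp Require Import all_boot all_order all_algebra.
From mathcomp Require Import generic_quotient ring_quotient complex.
From mathcomp Require Import all_classical all_reals all_analysis.
From mathcomp Require Import measurable_realfun.

Set Implicit Arguments.
Unset Strict Implicit.
Unset Printing Implicit Defensive.

Import Order.TTheory GRing.Theory Num.Theory.
Import numFieldNormedType.Exports.

Local Open Scope classical_set_scope.
Local Open Scope ring_scope.
Local Open Scope complex_scope.
Local Open Scope quotient_scope.

(* The real-valued modulus; `|z| would be an element of R[i]. *)
Notation modc := (@ComplexField.Normc.normc _).

Lemma modc_ge0 (R : rcfType) (z : R[i]) : 0 <= modc z.
Proof. by case: z => a b; exact: sqrtr_ge0. Qed.

Section L2_functions.
Context d (T : measurableType d) (R : realType).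
Variable mu : {measure set T -> \bar R}.
Implicit Types f g : T -> R[i].

Definition cmeasurable_fun f : Prop :=
  measurable_fun setT (fun x => complex.Re (f x)) /\
  measurable_fun setT (fun x => complex.Im (f x)).

Lemma measurable_modc f :
  cmeasurable_fun f -> measurable_fun setT (modc \o f).
Proof.
move=> [mr mi].
rewrite (_ : _ \o _ = Num.sqrt \o (fun x =>
    complex.Re (f x) ^+ 2 + complex.Im (f x) ^+ 2)); last first.
  by apply/funext => x /=; case: (f x).
apply: (@measurableT_comp _ _ _ _ _ _ (@Num.sqrt R)) => //.
  exact: continuous_measurable_fun (@sqrt_continuous R).
by apply: measurable_funD; exact: measurable_funX.
Qed.

Definition square_integrable : {pred (T -> R[i])} :=
  mem [set f | cmeasurable_fun f /\ finite_norm mu 2%:E (modc \o f)].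

Lemma square_integrableP f :
  reflect (cmeasurable_fun f /\ finite_norm mu 2%:E (modc \o f))
          (f \in square_integrable).
Proof. by apply: (iffP idP); rewrite inE. Qed.

Lemma cmeasurable_funB f g :
  cmeasurable_fun f -> cmeasurable_fun g -> cmeasurable_fun (f - g).
Proof.
move=> [fr fi] [gr gi]; split.
  rewrite (_ : (fun x => _) =
    (fun x => complex.Re (f x)) \- (fun x => complex.Re (g x))).
    exact: measurable_funB.
  by apply/funext => x; rewrite /= !fctE; case: (f x); case: (g x).
rewrite (_ : (fun x => _) =
  (fun x => complex.Im (f x)) \- (fun x => complex.Im (g x))).
  exact: measurable_funB.
by apply/funext => x; rewrite /= !fctE; case: (f x); case: (g x).
Qed.

Lemma le_Lnorm2 (f g : T -> R) : measurable_fun setT f ->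
  measurable_fun setT g -> (forall x, 0 <= f x <= g x) ->
  (Lnorm mu 2%:E (EFin \o f) <= Lnorm mu 2%:E (EFin \o g))%E.
Proof.
move=> mf mg fg; rewrite unlock /Lnorm.
have m2 (h : T -> R) : measurable_fun setT h ->
    measurable_fun setT (fun x => `|(EFin \o h) x| `^ 2)%E.
  move=> mh; apply: (@measurableT_comp _ _ _ _ _ _ (fun x => poweR x 2)) => //.
    exact: measurable_poweR.
  by apply: measurableT_comp => //; exact/measurable_EFinP.
have h0 (h : T -> R) : (0 <= \int[mu]_x `|(EFin \o h) x| `^ 2)%E.
  by apply: integral_ge0 => x _; exact: poweR_ge0.
apply: gt0_ler_poweR; rewrite ?in_itv/= ?leey ?andbT ?h0 ?invr_ge0//.
apply: ge0_le_integral => //; [exact: m2|exact: m2|move=> x _].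
have /andP[f0 fgx] := fg x.
by rewrite lee_fin ge0_ler_powR ?nnegrE// !ger0_norm// (le_trans f0).
Qed.

Lemma Lnorm_modcD f g : cmeasurable_fun f -> cmeasurable_fun g ->
  cmeasurable_fun (f + g) ->
  (Lnorm mu 2%:E (EFin \o (modc \o (f + g)%R)) <=
   Lnorm mu 2%:E (EFin \o (modc \o f)) + Lnorm mu 2%:E (EFin \o (modc \o g)))%E.
Proof.
move=> mf mg mfg.
have mmf := measurable_modc mf; have mmg := measurable_modc mg.
apply: le_trans; last by apply: eminkowski => //; rewrite lee_fin ler1n.
apply: le_Lnorm2; [exact: measurable_modc|exact: measurable_funD|move=> x /=].
by rewrite modc_ge0 le_normcD.
Qed.

Lemma square_integrable_zmod_closed : zmod_closed square_integrable.
Proof.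
split=> [|f g].
  apply/square_integrableP; split.
    by split; exact: measurable_cst.
  rewrite (_ : _ \o _ = cst 0); first by apply: finite_norm_cst0; rewrite lee1n.
  by apply/funext => x /=; exact: ComplexField.Normc.normc0.
move=> /square_integrableP[mf nf] /square_integrableP[mg ng].
have m0 : cmeasurable_fun (0 : T -> R[i]) by split; exact: measurable_cst.
have mN : cmeasurable_fun (- g) by rewrite -sub0r; exact: cmeasurable_funB.
apply/square_integrableP; split; first exact: cmeasurable_funB.
rewrite /finite_norm; apply: le_lt_trans.
  by apply: Lnorm_modcD => //; exact: cmeasurable_funB.
rewrite lte_add_pinfty// (_ : _ \o _ = EFin \o (modc \o g))//.
by apply/funext => x /=; rewrite normcN.
Qed.

HB.instance Definition _ := GRing.isZmodClosed.Build _ square_integrable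
  square_integrable_zmod_closed.

Record L2fun := MkL2fun {
  L2fun_val :> T -> R[i];
  L2fun_valP : L2fun_val \in square_integrable }.

HB.instance Definition _ := [isSub for L2fun_val].
HB.instance Definition _ := [Choice of L2fun by <:].
HB.instance Definition _ := [SubChoice_isSubZmodule of L2fun by <:].

Definition ae_null : {pred L2fun} :=
  mem [set f : L2fun | (f : T -> R[i]) = cst 0 %[ae mu]].

Lemma ae_null_zmod_closed : zmod_closed ae_null.
Proof.
split=> [|f g]; rewrite ?inE /=; first by apply/nearW => x _.
move=> f0 g0.
by apply: filterS2 f0 g0 => x + + xT /= => /(_ xT) f0 /(_ xT) g0;
  rewrite !fctE f0 g0 subr0.
Qed.

HB.instance Definition _ := GRing.isZmodClosed.Build _ ae_null
  ae_null_zmod_closed.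

(* Only the additive group structure is used here: ae_null is a subgroup. *)
Definition L2 : Type := {ideal_quot ae_null}.
HB.instance Definition _ := GRing.Zmodule.on L2.

Definition L2_fun (f : L2) : T -> R[i] := repr f.

(* The class of f; junk value 0 when f is not square integrable. *)
Definition L2_class (f : T -> R[i]) : L2 :=
  \pi_L2 (insubd (0 : L2fun) f).

Lemma L2_eqP (f g : L2fun) :
  (\pi_L2 f = \pi_L2 g) <-> (f : T -> R[i]) = g %[ae mu].
Proof.
split=> [/eqP|fg].
  rewrite -Quotient.idealrBE inE /=; apply: filterS => x /(_ I) + _.
  by rewrite !fctE => /eqP; rewrite subr_eq0 => /eqP.
apply/eqP; rewrite -Quotient.idealrBE inE /=; apply: filterS fg => x + _.
by rewrite !fctE => ->//; rewrite subrr.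
Qed.

Lemma L2_pi (f : L2fun) : L2_fun (\pi_L2 f) = f %[ae mu].
Proof. by apply/(L2_eqP _ _); rewrite /L2_fun reprK. Qed.

Lemma L2_fun_inj (f g : L2) : L2_fun f = L2_fun g %[ae mu] -> f = g.
Proof. by move/(L2_eqP _ _); rewrite !reprK. Qed.

Lemma L2_fun0 : L2_fun 0 = cst 0 %[ae mu].
Proof.
have /(_ 0) := L2_pi; rewrite (_ : (\pi_L2 0) = 0)//.
by rewrite raddf0.
Qed.

Lemma L2_funD (f g : L2) : L2_fun (f + g) = L2_fun f + L2_fun g %[ae mu].
Proof.
have := L2_pi (repr f + repr g); rewrite (_ : (\pi_L2 _) = f + g)//.
by rewrite raddfD /= !reprK.
Qed.

Lemma L2_funN (f : L2) : L2_fun (- f) = - L2_fun f %[ae mu].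
Proof.
have := L2_pi (- repr f); rewrite (_ : (\pi_L2 _) = - f)//.
by rewrite raddfN /= !reprK.
Qed.

Lemma L2_funMn (f : L2) n : L2_fun (f *+ n) = L2_fun f *+ n %[ae mu].
Proof.
elim: n => [|n IHn]; first by rewrite !mulr0n; exact: L2_fun0.
rewrite !mulrS; apply: filterS2 (L2_funD f (f *+ n)) IHn => x + + xT.
by move=> /(_ xT) -> /(_ xT) e; rewrite !fctE e.
Qed.

Lemma L2_fun_cmeasurable (f : L2) : cmeasurable_fun (L2_fun f).
Proof. by have /square_integrableP[] := L2fun_valP (repr f). Qed.

Lemma L2_fun_finite (f : L2) : finite_norm mu 2%:E (modc \o L2_fun f).
Proof. by have /square_integrableP[] := L2fun_valP (repr f). Qed.

Definition L2_norm (f : L2) : R :=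
  fine (Lnorm mu 2%:E (EFin \o (modc \o L2_fun f))).

Lemma L2_normE (f : L2) :
  (L2_norm f)%:E = Lnorm mu 2%:E (EFin \o (modc \o L2_fun f)).
Proof.
rewrite /L2_norm fineK// fin_numElt (lt_le_trans ltNy0) ?Lnorm_ge0//=.
exact: L2_fun_finite.
Qed.

Lemma ae_eq_Lnorm2 (f g : T -> R[i]) :
  cmeasurable_fun f -> cmeasurable_fun g -> f = g %[ae mu] ->
  Lnorm mu 2%:E (EFin \o (modc \o f)) = Lnorm mu 2%:E (EFin \o (modc \o g)).
Proof.
move=> mf mg fg; rewrite unlock /Lnorm; congr (_ `^ _)%E.
have m2 h : cmeasurable_fun h ->
    measurable_fun setT (fun x => `|(EFin \o (modc \o h)) x| `^ 2)%E.
  move=> mh; apply: (@measurableT_comp _ _ _ _ _ _ (fun x => poweR x 2)) => //.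
    exact: measurable_poweR.
  by apply: measurableT_comp => //; exact/measurable_EFinP/measurable_modc.
apply: ae_eq_integral => //; [exact: m2|exact: m2|].
by apply: filterS fg => x /= fgx xT; rewrite fgx.
Qed.

Lemma L2_cmeasurableD (f g : L2) : cmeasurable_fun (L2_fun f + L2_fun g).
Proof.
by have /square_integrableP[] := L2fun_valP (repr f + repr g).
Qed.

Lemma L2_normD (f g : L2) : L2_norm (f + g) <= L2_norm f + L2_norm g.
Proof.
rewrite -lee_fin EFinD !L2_normE (ae_eq_Lnorm2 _ _ (L2_funD f g)).
- by apply: Lnorm_modcD;
    [exact: L2_fun_cmeasurable|exact: L2_fun_cmeasurable|exact: L2_cmeasurableD].
- exact: L2_fun_cmeasurable.
- exact: L2_cmeasurableD.
Qed.

Lemma L2_normN (f : L2) : L2_norm (- f) = L2_norm f.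
Proof.
apply: EFin_inj; rewrite !L2_normE (ae_eq_Lnorm2 _ _ (L2_funN f)).
- rewrite (_ : _ \o (_ \o - _) = EFin \o (modc \o L2_fun f))//.
  by apply/funext => x /=; rewrite normcN.
- exact: L2_fun_cmeasurable.
- by have /square_integrableP[] := L2fun_valP (- repr f).
Qed.

Lemma L2_normMn (f : L2) n : L2_norm (f *+ n) = L2_norm f *+ n.
Proof.
apply: EFin_inj; rewrite -mulr_natl EFinM !L2_normE.
rewrite (ae_eq_Lnorm2 _ _ (L2_funMn f n)).
- have nf : (modc \o L2_fun f) \in Lfun mu 2%:E.
    rewrite inE; apply/andP; split; rewrite inE /=.
      exact/measurable_modc/L2_fun_cmeasurable.
    exact: L2_fun_finite.
  have p1 : (1 <= 2%:E :> \bar R)%E by rewrite lee_fin ler1n.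
  have := LnormZ (Lfun_Sub p1 nf) n%:R; rewrite normr_nat => <-.
  congr Lnorm; apply/funext => x /=; congr EFin.
  rewrite (_ : (L2_fun f *+ n) x = L2_fun f x *+ n); last first.
    by elim: n => // n IHn; rewrite !mulrS -IHn.
  by rewrite (normcMn (L2_fun f x) n) scaler_nat.
- exact: L2_fun_cmeasurable.
- have /square_integrableP[] := L2fun_valP (repr f *+ n).
  rewrite (_ : L2fun_val (repr f *+ n) = L2_fun f *+ n)//.
  by rewrite /L2_fun; elim: n => // n IHn; rewrite !mulrS -IHn.
Qed.

Lemma L2_norm0_eq0 (f : L2) : L2_norm f = 0 -> f = 0.
Proof.
move=> nf0; have := L2_normE f; rewrite nf0 => /esym {}nf0; apply: L2_fun_inj.
have f0 : EFin \o (modc \o L2_fun f) = \0%E %[ae mu].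
  apply: Lnorm_eq0_eq0 nf0; last by rewrite lte_fin.
  exact/measurable_EFinP/measurable_modc/L2_fun_cmeasurable.
apply: filterS2 L2_fun0 f0 => x + + xT => /(_ xT) -> /(_ xT) [].
exact: ComplexField.Normc.eq0_normc.
Qed.

HB.instance Definition _ := Num.Zmodule_isNormed.Build R L2
  L2_normD L2_norm0_eq0 L2_normMn L2_normN.
HB.instance Definition _ := PseudoMetric.copy L2 (pseudoMetric_normed L2).
HB.instance Definition _ := isPointed.Build L2 0.
HB.instance Definition _ := NormedZmod_PseudoMetric_eq.Build R L2 erefl.

End L2_functions.

Coercion L2_fun : L2 >-> Funclass.

Definition absolutely_integrable d (T : measurableType d) (R : realType)
    (mu : {measure set T -> \bar R}) (f : T -> R[i]) : Prop :=
  mu.-integrable setT (fun x => (modc (f x))%:E).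

Definition cintegral d (T : measurableType d) (R : realType)
    (mu : {measure set T -> \bar R}) (f : T -> R[i]) : R[i] :=
  (\int[mu]_x complex.Re (f x)) +i* (\int[mu]_x complex.Im (f x)).

Section Mellin.
Context (R : realType).
Local Notation leb := (@lebesgue_measure R).

Definition expi (t : R) : R[i] := cos t +i* sin t.

Definition fourier_L1 (g : measurableTypeR R -> R[i])
    (w : measurableTypeR R) : R[i] :=
  cintegral leb (fun x => g x * expi (- (2 * pi * w * x))).

(* Plancherel's theorem: exactly one F satisfies both conditions, because
   L^1 `&` L^2 is dense in L^2. *)
Definition fourier : L2 leb -> L2 leb :=
  get [set F : L2 leb -> L2 leb | continuous F /\
    forall g : L2 leb, absolutely_integrable leb g ->
      L2_fun (F g) = fourier_L1 g %[ae leb]].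

(* The measure dr/r on ]0, +oo[, extended by 0 to the Borel sets of R, so that
   L2 haar is L^2(]0, +oo[, dr/r): the values on ]-oo, 0] are irrelevant. *)
Definition haar (A : set (measurableTypeR R)) : \bar R :=
  (\int[leb]_(r in A `&` `]0%R, +oo[) (r^-1)%:E)%E.

Let haar0 : haar set0 = 0%E.
Proof. by rewrite /haar set0I integral_set0. Qed.

Let haar_ge0 A : (0 <= haar A)%E.
Proof.
apply: integral_ge0 => r [_]; rewrite /= in_itv /= andbT => r0.
by rewrite lee_fin invr_ge0 ltW.
Qed.

Let measurable_inv :
  measurable_fun (`]0%R, +oo[ : set (measurableTypeR R))
    (fun r : measurableTypeR R => (r^-1)%:E).
Proof.
apply/measurable_EFinP.
apply: (@open_continuous_measurable_fun R `]0%R, +oo[ GRing.inv).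
  exact: interval_open.
move=> r; rewrite inE /= in_itv /= andbT => r0.
by apply: inv_continuous; rewrite gt_eqF.
Qed.

Let haar_sigma_additive : semi_sigma_additive haar.
Proof.
move=> F mF tF mUF; rewrite /haar setI_bigcupl ge0_integral_bigcup//=.
- by apply: is_cvg_ereal_nneg_natsum_cond => n _ _; exact: haar_ge0.
- by move=> n; apply: measurableI => //; exact: measurable_itv.
- apply: (measurable_funS _ _ measurable_inv); first exact: measurable_itv.
  by move=> r [n _ []].
- move=> r [n _ [_]]; rewrite /= in_itv /= andbT => r0.
  by rewrite lee_fin invr_ge0 ltW.
- exact: trivIset_setIr.
Qed.

HB.instance Definition _ := isMeasure.Build _ _ _ haar
  haar0 haar_ge0 haar_sigma_additive.

(* x |-> f (e^x) is square integrable, by the substitution r = e^x. *)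
Definition mellin (f : L2 haar) : L2 leb :=
  fourier (L2_class leb (fun x => f (expR x))).

(* Supremum in [0, +oo], so that the empty supremum is 0 and not -oo. *)
Definition nnsup (A : set (\bar R)) : \bar R := ereal_sup (0%E |` A).

End Mellin.

(* Main.v *)
Require Import Defs.
From mathcomp Require Import all_boot all_order all_algebra complex.
From mathcomp Require Import all_classical all_reals all_analysis.
From mathcomp Require Import measurable_realfun ring lra.

(** A bounded set K is relatively compact in L2 of the half line, with respect
    to the Haar measure, exactly when the squared norms of f outside of
    [1/xi, xi] and of its Mellin transform outside of [- xi, xi] are uniformly
    small on K for large xi.

    In the logarithmic coordinate the Haar measure becomes Lebesgue measure and
    the Mellin transform becomes the L2 Fourier transform, so both terms of the
    tail of f are squared seminorms bounded by the norm
    ([mellin_isometry]). The tail of a single f tends to 0, and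
    tail f <= 2 tail g + 4 |f - g|^2. Necessity follows by covering the compact
    closure of K by neighborhoods on which one xi works
    ([precompact_uniform_tail]).

    For sufficiency, L2 being complete, it is enough that every ultrafilter on
    the closure of K is Cauchy ([uniform_tail_ultra_cvg]). Let xi be such that
    tails are small, and replace f by its restriction to [1/xi, xi]: the
    Mellin transform moves little in norm, and now it is the Fourier integral of
    an integrable function of bounded support, hence bounded and Lipschitz with
    constants that depend on xi and K only. On the compact set [- xi, xi] such a
    family is uniformly Cauchy along the ultrafilter
    ([ultra_equicontinuous_cauchy]); off this set Mellin transforms are small by
    assumption; and the distance of two Mellin transforms is the distance of the
    functions.

    The isometry is Plancherel's theorem, which also has to supply the
    existence of the L2 Fourier transform ([fourier_exists]), that is of a
    continuous extension of the Fourier integral. It is proved for a real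
    function a as follows. Against the weight exp (- 2 pi e |w|), the integral
    of the squared modulus of the Fourier transform of a is, by Fubini's
    theorem, the double integral of a x * a y against the Poisson kernel
    P_e (x - y). As the kernel has mass 1, this is the squared norm of a minus
    half of the mean square oscillation
      iint (a x - a y)^2 P_e (x - y) dx dy
    ([oscillation_correlation]). The oscillation is at most 4 times the squared
    norm of a and tends to 0 with e when a is continuous on an interval and 0
    outside; as these functions are dense, it tends to 0 for all a
    ([oscillation_cvg0]), while the weight increases to 1. Complex functions
    reduce to real ones by parity ([energy_fourier_L1]). *)

Set Implicit Arguments.
Unset Strict Implicit.
Unset Printing Implicit Defensive.

Import Order.TTheory GRing.Theory Num.Theory.
Import numFieldNormedType.Exports.

Local Open Scope classical_set_scope.
Local Open Scope ring_scope.

(** * Squared moduli and squared L2 norms over a set *)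

Section modulus.
Context {R : rcfType}.
Implicit Types z w : R[i].

Lemma modc_sqrE z : modc z ^+ 2 = complex.Re z ^+ 2 + complex.Im z ^+ 2.
Proof. by case: z => a b /=; rewrite sqr_sqrtr// addr_ge0 ?sqr_ge0. Qed.

Lemma modc_sqrN z : modc (- z) ^+ 2 = modc z ^+ 2.
Proof. by rewrite !modc_sqrE; case: z => a b /=; rewrite !sqrrN. Qed.

Lemma modc_sqrD z w : modc (z + w) ^+ 2 <= 2 * modc z ^+ 2 + 2 * modc w ^+ 2.
Proof.
rewrite !modc_sqrE; case: z w => [a b] [a' b'] /=.
rewrite -subr_ge0 (_ : _ - _ = (a - a') ^+ 2 + (b - b') ^+ 2).
  by rewrite addr_ge0 ?sqr_ge0.
by ring.
Qed.

Lemma le_Re_modc z : `|complex.Re z| <= modc z.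
Proof.
rewrite -(@ler_pXn2r _ 2) ?nnegrE ?modc_ge0// modc_sqrE real_normK ?num_real//.
by rewrite lerDl sqr_ge0.
Qed.

Lemma le_Im_modc z : `|complex.Im z| <= modc z.
Proof.
rewrite -(@ler_pXn2r _ 2) ?nnegrE ?modc_ge0// modc_sqrE real_normK ?num_real//.
by rewrite lerDr sqr_ge0.
Qed.

End modulus.

Section energy.
Context d (T : measurableType d) (R : realType).
Variable mu : {measure set T -> \bar R}.
Implicit Types (f g h : T -> R[i]) (D : set T).

(** Squared norms, with (a + b)^2 <= 2 a^2 + 2 b^2 as triangle inequality, keep
    the argument inside nonnegative integrals with values in the extended
    reals. *)
Definition energy D f : \bar R := (\int[mu]_(x in D) (modc (f x) ^+ 2)%:E)%E.

Lemma energy_ge0 D f : (0 <= energy D f)%E.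
Proof. by apply: integral_ge0 => x _; rewrite lee_fin sqr_ge0. Qed.

Lemma measurable_modc_sqr D f : cmeasurable_fun f ->
  measurable_fun D (fun x => (modc (f x) ^+ 2)%:E).
Proof.
move=> mf; apply/measurable_EFinP/measurable_funTS.
by apply: measurable_funX; exact: measurable_modc.
Qed.

Lemma cmeasurable_fun0 : cmeasurable_fun (0 : T -> R[i]).
Proof. by split; exact: measurable_cst. Qed.

Lemma cmeasurable_funN f : cmeasurable_fun f -> cmeasurable_fun (- f).
Proof.
by move=> mf; rewrite -sub0r; apply: cmeasurable_funB => //; exact: cmeasurable_fun0.
Qed.

Lemma cmeasurable_funD f g :
  cmeasurable_fun f -> cmeasurable_fun g -> cmeasurable_fun (f + g).
Proof.
by move=> mf mg; rewrite -(opprK g); apply: cmeasurable_funB => //; exact: cmeasurable_funN.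
Qed.

Lemma energyN D f : energy D (- f) = energy D f.
Proof. by apply: eq_integral => x _; rewrite modc_sqrN. Qed.

Lemma le_energy D f g : measurable D -> cmeasurable_fun f -> cmeasurable_fun g ->
  (forall x, D x -> modc (f x) ^+ 2 <= modc (g x) ^+ 2) ->
  (energy D f <= energy D g)%E.
Proof.
move=> mD mf mg fg; apply: ge0_le_integral => //.
- by move=> x _; rewrite lee_fin sqr_ge0.
- exact: measurable_modc_sqr.
- exact: measurable_modc_sqr.
Qed.

Lemma le_energy_subset D D' f : measurable D -> measurable D' ->
  cmeasurable_fun f -> D `<=` D' -> (energy D f <= energy D' f)%E.
Proof.
move=> mD mD' mf DD'; apply: ge0_subset_integral => //.
  exact: measurable_modc_sqr.
by move=> x _; rewrite lee_fin sqr_ge0.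
Qed.

Lemma energyD D f g : measurable D -> cmeasurable_fun f -> cmeasurable_fun g ->
  (energy D (f + g)%R <= 2%:E * energy D f + 2%:E * energy D g)%E.
Proof.
move=> mD mf mg; rewrite -!ge0_integralZl//; last 4 first.
- exact: measurable_modc_sqr.
- by move=> x _; rewrite lee_fin sqr_ge0.
- exact: measurable_modc_sqr.
- by move=> x _; rewrite lee_fin sqr_ge0.
rewrite -ge0_integralD//; last 4 first.
- by move=> x _; rewrite -EFinM lee_fin mulr_ge0 ?sqr_ge0.
- by apply: measurable_funeM; exact: measurable_modc_sqr.
- by move=> x _; rewrite -EFinM lee_fin mulr_ge0 ?sqr_ge0.
- by apply: measurable_funeM; exact: measurable_modc_sqr.
apply: ge0_le_integral => //.
- by move=> x _; rewrite lee_fin sqr_ge0.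
- by apply: measurable_modc_sqr; exact: cmeasurable_funD.
- by apply: emeasurable_funD; apply: measurable_funeM; exact: measurable_modc_sqr.
- by move=> x _; rewrite -!EFinM -EFinD lee_fin; exact: modc_sqrD.
Qed.

Lemma energyD_lty D f g : measurable D -> cmeasurable_fun f -> cmeasurable_fun g ->
  (energy D f < +oo)%E -> (energy D g < +oo)%E -> (energy D (f + g)%R < +oo)%E.
Proof.
move=> mD mf mg nf ng; apply: le_lt_trans (energyD mD mf mg) _.
by apply: lte_add_pinfty; apply: lte_mul_pinfty.
Qed.

Lemma energyB D f g : measurable D -> cmeasurable_fun f -> cmeasurable_fun g ->
  (energy D (f - g)%R <= 2%:E * energy D f + 2%:E * energy D g)%E.
Proof.
by move=> mD mf mg; rewrite -(energyN D g); apply: energyD => //; exact: cmeasurable_funN.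
Qed.

Lemma ae_eq_energy D f g : measurable D -> cmeasurable_fun f ->
  cmeasurable_fun g -> f = g %[ae mu] -> energy D f = energy D g.
Proof.
move=> mD mf mg fg; apply: ae_eq_integral => //.
- exact: measurable_modc_sqr.
- exact: measurable_modc_sqr.
- by apply: filterS fg => x /= + _ => ->.
Qed.

Lemma energy_setU D f : measurable D -> cmeasurable_fun f ->
  energy setT f = (energy D f + energy (~` D) f)%E.
Proof.
move=> mD mf; rewrite /energy -ge0_integral_setU ?setUv//.
- exact: measurableC.
- exact: measurable_modc_sqr.
- by move=> x _; rewrite lee_fin sqr_ge0.
- by apply/eqP; rewrite setICr.
Qed.

Lemma square_integrable_energy f : cmeasurable_fun f ->
  (energy setT f < +oo)%E -> f \in square_integrable mu.
Proof.
move=> mf nf; apply/square_integrableP; split => //.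
rewrite /finite_norm unlock /Lnorm.
rewrite (_ : (\int[mu]_x _)%E = energy setT f) ?poweR_lty//.
apply: eq_integral => x _ /=.
by rewrite ger0_norm ?modc_ge0// powR_mulrn ?modc_ge0.
Qed.

Lemma L2_norm_energy (f : L2 mu) : (`|f| ^+ 2)%:E = energy setT f.
Proof.
have := @poweR_Lnorm _ _ _ mu (EFin \o (modc \o f)) 2 (ltac:(by [])).
rewrite -L2_normE poweR_EFin powR_mulrn ?(normr_ge0 f)// => ->.
apply: eq_integral => x _ /=.
by rewrite ger0_norm ?modc_ge0// powR_mulrn ?modc_ge0.
Qed.

Lemma L2_energy_lty (f : L2 mu) : (energy setT f < +oo)%E.
Proof. by rewrite -L2_norm_energy ltry. Qed.

Lemma L2_classE f : cmeasurable_fun f -> (energy setT f < +oo)%E ->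
  L2_fun (L2_class mu f) = f %[ae mu].
Proof.
move=> mf nf; have sf := square_integrable_energy mf nf.
by have := L2_pi (insubd (0 : L2fun mu) f); rewrite (insubdK _ sf).
Qed.

Lemma L2_funB (f g : L2 mu) : L2_fun (f - g) = L2_fun f - L2_fun g %[ae mu].
Proof.
apply: filterS2 (L2_funD f (- g)) (L2_funN g) => x + + xT.
by move=> /(_ xT) -> /(_ xT) e; rewrite !fctE e.
Qed.

Lemma L2_normB_energy (f g : L2 mu) : (`|f - g| ^+ 2)%:E = energy setT (f \- g).
Proof.
rewrite L2_norm_energy; apply: ae_eq_energy => //.
- exact: L2_fun_cmeasurable.
- by apply: cmeasurable_funB; exact: L2_fun_cmeasurable.
- exact: L2_funB.
Qed.

Definition cutoff (A : set T) f (x : T) : R[i] := if x \in A then f x else 0.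

Lemma cmeasurable_cutoff A f : measurable A -> cmeasurable_fun f ->
  cmeasurable_fun (cutoff A f).
Proof.
move=> mA [fr fi]; split.
  rewrite (_ : (fun x => _) = (fun x => complex.Re (f x) * \1_A x)).
    by apply: measurable_funM => //; exact: measurable_indic.
  by apply/funext => x; rewrite /cutoff indicE; case: (x \in A) => /=; rewrite ?mulr1 ?mulr0.
rewrite (_ : (fun x => _) = (fun x => complex.Im (f x) * \1_A x)).
  by apply: measurable_funM => //; exact: measurable_indic.
by apply/funext => x; rewrite /cutoff indicE; case: (x \in A) => /=; rewrite ?mulr1 ?mulr0.
Qed.

Lemma energy_cutoff_le A f : measurable A -> cmeasurable_fun f ->
  (energy setT (cutoff A f) <= energy setT f)%E.
Proof.
move=> mA mf; apply: le_energy => //; first exact: cmeasurable_cutoff.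
move=> x _; rewrite /cutoff; case: (x \in A) => //.
by rewrite ComplexField.Normc.normc0 expr0n sqr_ge0.
Qed.

Lemma energy_cutoffC A f : measurable A -> cmeasurable_fun f ->
  energy setT (f - cutoff A f) = energy (~` A) f.
Proof.
move=> mA mf; rewrite /energy [RHS]integral_mkcond; apply: eq_integral => x _.
rewrite patchE in_setC (_ : (f - cutoff A f) x = f x - cutoff A f x)// /cutoff.
case: (x \in A) => /=.
  by rewrite subrr ComplexField.Normc.normc0 expr0n.
by rewrite subr0.
Qed.

(** Dominated convergence: each point eventually leaves the sets. *)
Lemma energy_tail_cvg0 (D : nat -> set T) f : (forall n, measurable (D n)) ->
  cmeasurable_fun f -> (energy setT f < +oo)%E ->
  (forall x, \forall n \near \oo, ~ D n x) -> energy (D n) f @[n --> \oo] --> 0%E.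
Proof.
move=> mD mf foo Dx; rewrite -(integral0 mu setT).
have mf2 := measurable_modc_sqr (D := setT) mf.
under eq_fun do rewrite /energy integral_mkcond.
apply: (@dominated_cvg _ _ _ mu setT _ _ (cst 0%E) (fun x => (modc (f x) ^+ 2)%:E)) => //.
- by move=> n; apply: (measurable_restrictT _ (mD n)).1; exact: measurable_modc_sqr.
- move=> x _; apply: cvg_near_cst; apply: filterS (Dx x) => n nD.
  by rewrite patchE memNset.
- apply/integrableP; split => //.
  by under eq_integral do rewrite gee0_abs ?lee_fin ?sqr_ge0//.
- move=> n x _; rewrite patchE; case: (x \in D n); rewrite ?abse0 ?lee_fin ?sqr_ge0//=.
  by rewrite ger0_norm ?sqr_ge0.
Qed.

Lemma L2_norm_eq d' (T' : measurableType d') (mu' : {measure set T' -> \bar R})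
    (x : L2 mu) (y : L2 mu') :
  (`|x| ^+ 2)%:E = (`|y| ^+ 2)%:E -> `|x| = `|y|.
Proof. by move=> [] /eqP; rewrite eqrXn2 ?(normr_ge0 x) ?(normr_ge0 y)// => /eqP. Qed.

End energy.

(** * Completeness of L2 *)

Section completeness.
Local Open Scope complex_scope.
Context d (T : measurableType d) (R : realType).
Variable mu : {measure set T -> \bar R}.

Lemma limn_einf_le (u : (\bar R)^nat) (C : \bar R) :
  (\forall n \near \oo, (u n <= C)%E) -> (limn_einf u <= C)%E.
Proof.
move=> uC; rewrite limn_einf_lim; apply: lime_le; first exact: is_cvg_einfs.
apply: filterS uC => n; apply: le_trans.
by apply: ereal_inf_lbound; exists n => /=.
Qed.

(** Fatou's lemma turns a bound on the differences of a Cauchy sequence into a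
    bound on the difference to its pointwise limit; in particular the limit is
    square integrable. *)
Lemma energy_fatou D (f_ : nat -> T -> R[i]) (f : T -> R[i]) (C : \bar R) :
  measurable D -> (forall n, cmeasurable_fun (f_ n)) ->
  (forall x, complex.Re (f_ n x) @[n --> \oo] --> complex.Re (f x)) ->
  (forall x, complex.Im (f_ n x) @[n --> \oo] --> complex.Im (f x)) ->
  (\forall n \near \oo, (energy mu D (f_ n) <= C)%E) ->
  (energy mu D f <= C)%E.
Proof.
move=> mD mf fr fi fC.
have := @fatou _ _ _ mu _ mD (fun n x => (modc (f_ n x) ^+ 2)%:E)
  (fun n => measurable_modc_sqr (D := D) (mf n)).
have f0 n x : D x -> (0 <= (modc (f_ n x) ^+ 2)%:E)%E.
  by move=> _; rewrite lee_fin sqr_ge0.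
move=> /(_ f0) le_fatou.
apply: le_trans (limn_einf_le fC); apply: le_trans le_fatou.
rewrite le_eqVlt; apply/orP; left; apply/eqP.
apply: eq_integral => x _.
have cf : (modc (f_ n x) ^+ 2)%:E @[n --> \oo] --> (modc (f x) ^+ 2)%:E.
  apply: cvg_EFin; first exact: nearW.
  apply: (@cvg_trans _ (complex.Re (f_ n x) ^+ 2 + complex.Im (f_ n x) ^+ 2 @[n --> \oo])).
    by apply: near_eq_cvg; apply: nearW => n /=; rewrite modc_sqrE.
  by rewrite modc_sqrE; apply: cvgD; rewrite !expr2; apply: cvgM.
by have [->] := cvg_limn_einf_sup cf.
Qed.

Lemma fast_cauchy_bound (V : normedZmodType R) (u : nat -> V) :
  (forall n, `|u n.+1 - u n| <= 4^-1 ^+ n) ->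
  forall n k, `|u (n + k)%N - u n| <= 2 * 4^-1 ^+ n.
Proof.
move=> fu n k.
(* The subtracted term makes the bound telescope in k. *)
suff : `|u (n + k)%N - u n| <= 2 * 4^-1 ^+ n - 2 * 4^-1 ^+ (n + k).
  move/le_trans; apply; rewrite gerBl mulr_ge0// exprn_ge0//.
elim: k => [|k IH]; first by rewrite addn0 !subrr normr0.
rewrite addnS -(subrKA (u (n + k)%N)).
apply: le_trans (ler_normD _ _) _.
apply: le_trans (lerD (fu _) IH) _.
rewrite [4^-1 ^+ (n + k).+1]exprS.
have : 0 <= 4^-1 ^+ (n + k) :> R by rewrite exprn_ge0.
set a := 4^-1 ^+ _; set b := 4^-1 ^+ n; move: a b => a b; lra.
Qed.

(** The series of the 4^n |dl n|^2 has finite integral, so it converges almost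
    everywhere, and where it does its terms are bounded: |dl n| decays like
    2^-n there. The rate 16^-n is what makes the factor 4^n affordable. *)
Lemma ae_fast_summable (dl : nat -> T -> R[i]) :
  (forall n, cmeasurable_fun (dl n)) ->
  (forall n, (energy mu setT (dl n) <= (16^-1 ^+ n)%:E)%E) ->
  exists A, [/\ measurable A, {ae mu, forall x, A x} &
    forall x, A x -> exists2 C, 0 <= C & forall n, modc (dl n x) <= C * 2^-1 ^+ n].
Proof.
move=> mdl ndl.
pose g n x := ((4 ^+ n)%:E * (modc (dl n x) ^+ 2)%:E)%E.
have g0 n x : (0 <= g n x)%E by rewrite /g -EFinM lee_fin; apply: mulr_ge0; [exact: exprn_ge0|exact: sqr_ge0].
have mg n : measurable_fun setT (g n).
  by apply: measurable_funeM; exact: measurable_modc_sqr.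
pose G x := (\sum_(0 <= n <oo) g n x)%E.
have mG : measurable_fun setT G by apply: ge0_emeasurable_sum.
have G0 x : (0 <= G x)%E by apply: nneseries_ge0.
have iG : (\int[mu]_x G x < +oo)%E.
  rewrite integral_nneseries//.
  apply: (@le_lt_trans _ _ (\sum_(0 <= n <oo) (geometric 1 4^-1 n)%:E)%E).
    apply: lee_nneseries => n _.
      by move=> _; apply: integral_ge0.
    rewrite ge0_integralZl//; last first.
      by move=> x _; rewrite lee_fin sqr_ge0.
      exact: measurable_modc_sqr.
    apply: (@le_trans _ _ ((4 ^+ n)%:E * (16^-1 ^+ n)%:E)%E).
      by apply: lee_pmul; [rewrite lee_fin exprn_ge0|exact: energy_ge0|exact: lexx|exact: ndl].
    rewrite -EFinM lee_fin /geometric /= mul1r -exprMn.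
    by rewrite (_ : 4 * 16^-1 = 4^-1 :> R)//; lra.
  have cg : cvgn (series (geometric (1 : R) 4^-1)).
    by apply: is_cvg_geometric_series; rewrite ger0_norm//; lra.
  rewrite (_ : (\sum_(0 <= n <oo) _)%E = (limn (series (geometric (1 : R) 4^-1)))%:E) ?ltry//.
  rewrite -EFin_lim//; congr (limn _); apply/funext => n /=.
  by rewrite sumEFin.
exists [set x | (G x < +oo)%E]; split.
- rewrite (_ : [set x | _] = setT `&` G @^-1` [set` `[0%E, (+oo%E)[ ]).
    by apply: mG => //; exact: emeasurable_itv.
  by rewrite setTI; apply/seteqP; split => x /=; rewrite in_itv /= G0.
- have : mu.-integrable setT G.
    apply/integrableP; split => //.
    by under eq_integral do rewrite gee0_abs//.
  move=> /integrable_ae; move=> /(_ measurableT); apply: filterS => x /= /(_ I).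
  by rewrite ge0_fin_numE.
- move=> x /= Gx; exists (Num.sqrt (fine (G x))); first exact: sqrtr_ge0.
  move=> n; rewrite -(@ler_pXn2r _ 2) ?nnegrE ?modc_ge0 ?mulr_ge0 ?sqrtr_ge0 ?exprn_ge0//.
  rewrite exprMn sqr_sqrtr ?fine_ge0// -exprM mulnC exprM.
  have gG : (g n x <= G x)%E.
    apply: le_trans (nneseries_lim_ge n.+1 _); last by move=> k *; exact: g0.
    by rewrite big_nat_recr//= leeDr// sume_ge0.
  have : 4 ^+ n * modc (dl n x) ^+ 2 <= fine (G x).
    by rewrite -lee_fin fineK ?ge0_fin_numE// EFinM; exact: gG.
  rewrite (_ : 2^-1 ^+ 2 = 4^-1 :> R); last by lra.
  by rewrite exprVn ler_pdivlMr ?exprn_gt0// mulrC.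
Qed.

Lemma cvg_fast (v : R^nat) (C : R) : 0 <= C ->
  (forall n, `|v n.+1 - v n| <= C * 2^-1 ^+ n) -> cvgn v.
Proof.
move=> C0 vC.
have cs : cvgn (series (telescope v)).
  apply: normed_cvg; apply: (@series_le_cvg _ _ (geometric C 2^-1)).
  - by move=> n; exact: normr_ge0.
  - by move=> n; rewrite /geometric/= mulr_ge0// exprn_ge0.
  - exact: vC.
  - by apply: is_cvg_geometric_series; rewrite ger0_norm//; lra.
rewrite (_ : v = (fun n => v 0%N + series (telescope v) n)); last first.
  by apply/funext => n; exact: eq_sum_telescope.
by apply: is_cvgD => //; exact: is_cvg_cst.
Qed.

(** The Riesz-Fischer argument. Off a null set the sequence converges
    geometrically; multiplied by the indicator of the good set it converges
    everywhere, so its limit is measurable, and Fatou's lemma gives the rate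
    in norm. *)
Lemma L2_fast_cvg (u : nat -> L2 mu) :
  (forall n, `|u n.+1 - u n| <= 4^-1 ^+ n) ->
  exists l, forall n, `|l - u n| <= 2 * 4^-1 ^+ n.
Proof.
move=> fu.
pose dl n := L2_fun (u n.+1) - L2_fun (u n).
have mdl n : cmeasurable_fun (dl n).
  by apply: cmeasurable_funB; exact: L2_fun_cmeasurable.
have [|A [mA aeA sA]] := ae_fast_summable mdl.
  move=> n; rewrite -L2_normB_energy lee_fin.
  rewrite (_ : 16^-1 = 4^-1 ^+ 2 :> R); last by lra.
  by rewrite -exprM mulnC exprM ler_pXn2r ?nnegrE// exprn_ge0.
pose h n := cutoff A (L2_fun (u n)).
have mh n : cmeasurable_fun (h n).
  by apply: cmeasurable_cutoff => //; exact: L2_fun_cmeasurable.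
have hA n : h n = L2_fun (u n) %[ae mu].
  by apply: filterS aeA => x Ax _; rewrite /h /cutoff mem_set.
have cr x : cvgn (fun n => complex.Re (h n x)).
  rewrite /h /cutoff; case: (boolP (x \in A)) => [|_]; last exact: is_cvg_cst.
  rewrite inE => /sA[C C0 dC]; apply: (cvg_fast C0) => n.
  apply: le_trans (dC n); apply: le_trans (le_Re_modc _).
  by rewrite /dl !fctE; case: (L2_fun (u n.+1) x) (L2_fun (u n) x) => ? ? [].
have ci x : cvgn (fun n => complex.Im (h n x)).
  rewrite /h /cutoff; case: (boolP (x \in A)) => [|_]; last exact: is_cvg_cst.
  rewrite inE => /sA[C C0 dC]; apply: (cvg_fast C0) => n.
  apply: le_trans (dC n); apply: le_trans (le_Im_modc _).
  by rewrite /dl !fctE; case: (L2_fun (u n.+1) x) (L2_fun (u n) x) => ? ? [].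
pose F (x : T) : R[i] := limn (fun n => complex.Re (h n x)) +i* limn (fun n => complex.Im (h n x)).
have mF : cmeasurable_fun F.
  by split => /=; [apply: (measurable_fun_cvg (fun n => (mh n).1))|apply: (measurable_fun_cvg (fun n => (mh n).2))] => x _ /=; [exact: cr|exact: ci].
have eF n : (energy mu setT (F - h n)%R <= ((2 * 4^-1 ^+ n) ^+ 2)%:E)%E.
  apply: (@energy_fatou _ (fun k => h (n + k)%N - h n)) => //.
  - by move=> k; exact: cmeasurable_funB.
  - move=> x; rewrite (_ : complex.Re ((F - h n) x) = complex.Re (F x) - complex.Re (h n x)).
      rewrite (_ : (fun k => _) = (fun k => complex.Re (h (n + k)%N x) - complex.Re (h n x))).
        apply: cvgB; last exact: cvg_cst.
        exact: (cvg_comp _ _ (cvg_addnl n) (cr x)).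
      by apply/funext => k; rewrite !fctE; case: (h (n + k)%N x) (h n x) => ? ? [].
    by rewrite !fctE; case: (F x) (h n x) => ? ? [].
  - move=> x; rewrite (_ : complex.Im ((F - h n) x) = complex.Im (F x) - complex.Im (h n x)).
      rewrite (_ : (fun k => _) = (fun k => complex.Im (h (n + k)%N x) - complex.Im (h n x))).
        apply: cvgB; last exact: cvg_cst.
        exact: (cvg_comp _ _ (cvg_addnl n) (ci x)).
      by apply/funext => k; rewrite !fctE; case: (h (n + k)%N x) (h n x) => ? ? [].
    by rewrite !fctE; case: (F x) (h n x) => ? ? [].
  - apply: nearW => k.
    rewrite (_ : energy mu setT _ = energy mu setT (L2_fun (u (n + k)%N) \- L2_fun (u n))).
      by rewrite -L2_normB_energy lee_fin ler_pXn2r ?nnegrE ?mulr_ge0 ?exprn_ge0// fast_cauchy_bound.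
    apply: ae_eq_energy => //; [exact: cmeasurable_funB| |].
      by apply: cmeasurable_funB; exact: L2_fun_cmeasurable.
    by apply: filterS2 (hA (n + k)%N) (hA n) => x + + xT => /(_ xT) + /(_ xT); rewrite !fctE => -> ->.
have eFoo : (energy mu setT F < +oo)%E.
  rewrite (_ : F = (F - h 0%N) + h 0%N); last by rewrite subrK.
  apply: energyD_lty => //; first exact: cmeasurable_funB.
    by rewrite (le_lt_trans (eF 0%N))// ltry.
  rewrite (ae_eq_energy (mu := mu) _ _ _ (hA 0%N))//; last exact: L2_fun_cmeasurable.
  exact: L2_energy_lty.
exists (L2_class mu F) => n.
rewrite -(@ler_pXn2r _ 2) ?nnegrE ?mulr_ge0 ?exprn_ge0//.
rewrite -lee_fin L2_normB_energy; apply: le_trans (eF n).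
rewrite le_eqVlt; apply/orP; left; apply/eqP; apply: ae_eq_energy => //.
- by apply: cmeasurable_funB; exact: L2_fun_cmeasurable.
- exact: cmeasurable_funB.
- apply: filterS2 (L2_classE mF eFoo) (hA n) => x /(_ I) e1 /(_ I) e2 xT.
  by rewrite !fctE /= e1 e2.
Qed.

(** Filters and not sequences are needed, since compactness is tested on
    ultrafilters. Centers of balls of radius 4^-n / 2 that belong to the
    filter form a fast Cauchy sequence. *)
Lemma L2_cauchy_cvg (F : set_system (L2 mu)) : ProperFilter F ->
  (forall e : R, 0 < e -> exists x : L2 mu, \forall y \near F, `|x - y| < e) ->
  exists l : L2 mu, F --> l.
Proof.
move=> PF cF.
have c4 n : 0 < 4^-1 ^+ n / 2 :> R by rewrite divr_gt0// exprn_gt0.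
pose u n := projT1 (cid (cF _ (c4 n))).
have uF n : \forall y \near F, `|u n - y| < 4^-1 ^+ n / 2.
  exact: projT2 (cid (cF _ (c4 n))).
have [|l ul] := @L2_fast_cvg u.
  move=> n; have [y []] := filter_ex (filterI (uF n) (uF n.+1)).
  move=> y1 y2; rewrite -(subrKA y) (le_trans (ler_normD _ _))//.
  rewrite [X in _ <= X]splitr lerD// ?(ltW)//; last by rewrite distrC.
  rewrite (le_lt_trans (lexx _))// (lt_le_trans y2)// exprS.
  rewrite ler_pM2r ?invr_gt0// ger_pMl ?exprn_gt0//; lra.
exists l; apply/cvgrPdist_lt => e e0.
have : geometric (1 : R) 4^-1 n @[n --> \oo] --> 0.
  by apply: cvg_geometric; rewrite ger0_norm//; lra.
move=> /cvgrPdist_lt /(_ (e / 3)); rewrite divr_gt0// => /(_ isT)[N _ /(_ N)].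
rewrite /= leqnn sub0r normrN mul1r ger0_norm ?exprn_ge0// => /(_ isT) Ne.
near=> y; rewrite -(subrKA (u N)) (le_lt_trans (ler_normD _ _))//.
rewrite (_ : e = 2 * (e / 3) + e / 3); last by lra.
apply: ler_ltD; last first.
  apply: lt_trans (_ : 4^-1 ^+ N / 2 < _); first by near: y; exact: uF.
  by apply: le_lt_trans Ne; rewrite ler_pdivrMr// ler_peMr ?exprn_ge0//; lra.
by apply: le_trans (ul N) _; rewrite ler_pM2l//; exact: ltW.
Unshelve. all: by end_near. Qed.

End completeness.

(** * The Poisson kernel *)

Section lebesgue_change_of_variables.
Context {R : realType}.
Local Notation leb := (@lebesgue_measure R).

Lemma ge0_integral_reflect (D : set (measurableTypeR R)) (f : R -> \bar R) :
  measurable D -> measurable_fun setT (f : measurableTypeR R -> \bar R) ->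
  (forall x, (0 <= f x)%E) ->
  (\int[leb]_(x in D) f x = \int[leb]_(x in -%R @^-1` D) f (- (x : R))%R)%E.
Proof.
move=> mD mf f0.
have mopp : measurable_fun setT (-%R : measurableTypeR R -> measurableTypeR R).
  exact: oppr_measurable.
rewrite -(@ge0_integral_pushforward _ _ _ _ R _ mopp leb _ f) //; last first.
  exact: measurable_funTS.
apply: eq_measure_integral => A mA _.
apply: lebesgue_measure_unique => // _ [[a b] _ <-].
transitivity (leb `[- b, - a[%classic).
  by rewrite !lebesgue_measure_itv /= !lte_fin ltrN2; case: ifP => // _;
     rewrite -!EFinB opprK addrC.
congr (leb _).
by apply/seteqP; split => x /=; rewrite !in_itv /= ltrNr lerNl andbC.
Qed.

Lemma ge0_integral_ray (F f : R -> R) a (l : R) :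
  (forall x : R, is_derive x (1 : R) F (f x)) -> continuous f ->
  (forall x, a <= x -> 0 <= f x) -> F x @[x --> +oo] --> l ->
  (\int[leb]_(x in `[a, +oo[) (f x)%:E)%E = (l - F a)%:E.
Proof.
move=> dF cf f0 Fl; rewrite EFinB; apply: ge0_continuous_FTC2y => //.
- exact: continuous_subspaceT.
- apply: cvg_at_right_filter; apply: differentiable_continuous.
  by apply/derivable1_diffP; have [] := dF a.
- by move=> x _; rewrite derive1E; have [_ ->] := dF x.
Qed.

End lebesgue_change_of_variables.

Section poisson_kernel.
Context {R : realType}.
Local Notation leb := (@lebesgue_measure R).
Implicit Types a b e x y w : R.

(** The Poisson kernel of the half plane at height e. It is the Fourier
    transform of the weight exp (- 2 pi e |w|), see [poisson_abel]. *)
Definition poisson e x := e / (pi * (e ^+ 2 + x ^+ 2)).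

Lemma poisson_den_gt0 e x : 0 < e -> 0 < e ^+ 2 + x ^+ 2.
Proof. by move=> e0; rewrite ltr_wpDr ?sqr_ge0// exprn_gt0. Qed.

Lemma poisson_ge0 e x : 0 < e -> 0 <= poisson e x.
Proof.
move=> e0; rewrite divr_ge0 ?ltW// mulr_gt0 ?pi_gt0//.
exact: poisson_den_gt0.
Qed.

Lemma poissonN e x : poisson e (- x) = poisson e x.
Proof. by rewrite /poisson sqrrN. Qed.

Lemma continuous_poisson e : 0 < e -> continuous (poisson e).
Proof.
move=> e0 x; apply: cvgM; first exact: cvg_cst.
apply: cvgV; first by rewrite mulf_neq0 ?gt_eqF ?pi_gt0 ?poisson_den_gt0.
apply: cvgM; first exact: cvg_cst.
apply: cvgD; first exact: cvg_cst.
by apply: exprn_continuous.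
Qed.

Let continuous_arctan_density : continuous (fun x : R => (pi * (1 + x ^+ 2))^-1).
Proof.
move=> x; apply: cvgV.
  by rewrite mulf_neq0// gt_eqF ?pi_gt0// ltr_wpDr ?sqr_ge0.
apply: cvgM; first exact: cvg_cst.
apply: cvgD; first exact: cvg_cst.
by apply: exprn_continuous.
Qed.

Let arctan_density_ge0 x : 0 <= (pi * (1 + x ^+ 2))^-1.
Proof. by rewrite invr_ge0 mulr_ge0 ?pi_ge0// addr_ge0// sqr_ge0. Qed.

Let integral_arctan_density :
  (\int[leb]_x ((pi * (1 + x ^+ 2))^-1)%:E)%E = 1%:E.
Proof.
have cG := continuous_arctan_density; have G0 := arctan_density_ge0.
rewrite ge0_symfun_integralT//; last by move=> x /=; rewrite sqrrN.
rewrite -set_itvcy.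
have dA (x : R) : is_derive x (1 : R) (fun x => pi^-1 * atan x) ((pi * (1 + x ^+ 2))^-1).
  by rewrite invfM; exact: is_deriveZ.
have lA : (pi^-1 * atan x) @[x --> +oo] --> (pi^-1 * (pi / 2) : R).
  by apply: cvgM; [exact: cvg_cst|exact: cvgy_atan].
rewrite (ge0_integral_ray dA cG (fun x _ => G0 x) lA).
rewrite atan0 mulr0 subr0 -EFinM mulKf ?gt_eqF ?pi_gt0// mulfV//.
Qed.

Lemma integral_poisson e x : 0 < e ->
  (\int[leb]_y (poisson e (x - y))%:E)%E = 1%:E.
Proof.
move=> e0.
have dF y : is_derive y (1 : R) (fun y => e^-1 * (y - x)) (e^-1).
  have d1 : is_derive y (1 : R) (fun y => y - x) (1 - 0).
    by apply: is_deriveB.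
  have := @is_deriveZ _ _ _ (fun y : R => y - x) e^-1 _ _ _ d1.
  by rewrite subr0 [_ *: _]mulr1.
have F' : derive1 (fun y => e^-1 * (y - x)) = cst (e^-1).
  by apply/funext => y; rewrite derive1E; have [_ ->] := dF y.
rewrite -integral_arctan_density.
rewrite [RHS](@increasing_ge0_integration_by_substitutionT _ (fun y => e^-1 * (y - x)));
  rewrite ?F'.
- apply: eq_integral => y _; congr EFin; rewrite /poisson /= fctE /=.
  rewrite -(sqrrN (x - y)) opprB exprMn.
  have := poisson_den_gt0 (y - x) e0; set t := (y - x) ^+ 2 => t0.
  have ? : e != 0 by rewrite gt_eqF.
  have : pi != 0 :> R by rewrite gt_eqF ?pi_gt0.
  have ? : e ^+ 2 + t != 0 by rewrite gt_eqF.
  by move: (@pi R) => p ?; field; apply/and3P; split.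
- by move=> y z yz; rewrite ltr_pM2l ?invr_gt0// ltrD2r.
- by move=> y; exact: cvg_cst.
- exact: is_cvg_cst.
- exact: is_cvg_cst.
- by move=> y; have [] := dF y.
- apply: gt0_cvgMrNy; first by rewrite invr_gt0.
  exact: cvg_addrr_Ny.
- apply: gt0_cvgMry; first by rewrite invr_gt0.
  exact: cvg_addrr.
- exact: continuous_arctan_density.
- exact: arctan_density_ge0.
Qed.

Let is_derive_expRN a w : is_derive w (1 : R) (fun w => expR (- (a * w))) (- a * expR (- (a * w))).
Proof.
have d1 : is_derive w (1 : R) (fun w => - (a * w)) (- (a * 1)).
  by apply: is_deriveN; apply: is_deriveZ.
have := @is_derive1_comp _ expR (fun w => - (a * w)) w _ _ (is_derive_expR _) d1.
by rewrite mulr1 mulrC.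
Qed.

Let is_derive_mul b w : is_derive w (1 : R) (fun w => b * w) b.
Proof.
have := @is_deriveZ _ _ _ (fun w : R => w) b w _ _ (is_derive_id _ _).
by move=> /(_ 1); rewrite [_ *: _]mulr1.
Qed.

(** The summand 1 makes the integrand nonnegative, so that the fundamental
    theorem of calculus applies on a ray; the case b = 0 gives the integral of
    the exponential alone, hence also that of its product with the cosine. *)
Lemma integral_expR_cos a b : 0 < a ->
  (\int[leb]_w (expR (- (a * `|w|)) * (1 + cos (b * w)))%:E)%E =
  (2 * (a^-1 + a / (a ^+ 2 + b ^+ 2)))%:E.
Proof.
move=> a0.
have D0 := poisson_den_gt0 b a0.
have cf : continuous (fun w : R => expR (- (a * w)) * (1 + cos (b * w))).
  move=> w; apply: cvgM.
    apply: continuous_comp; last exact: continuous_expR.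
    by apply: cvgN; apply: cvgM; [exact: cvg_cst|exact: cvg_id].
  apply: cvgD; first exact: cvg_cst.
  apply: continuous_comp; last exact: continuous_cos.
  by apply: cvgM; [exact: cvg_cst|exact: cvg_id].
have c1 (w : R) : 0 <= 1 + cos (b * w).
  by have := cos_geN1 (b * w); lra.
rewrite ge0_symfun_integralT; last 3 first.
- by move=> w; rewrite mulr_ge0 ?expR_ge0.
- move=> w; apply: cvgM.
    apply: continuous_comp; last exact: continuous_expR.
    by apply: cvgN; apply: cvgM; [exact: cvg_cst|exact: norm_continuous].
  apply: cvgD; first exact: cvg_cst.
  apply: continuous_comp; last exact: continuous_cos.
  by apply: cvgM; [exact: cvg_cst|exact: cvg_id].
- by move=> w /=; rewrite normrN mulrN cosN.
rewrite EFinM; congr (_ * _)%E.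
rewrite -set_itvcy.
under eq_integral => w.
  rewrite inE /= in_itv /= andbT => w0; rewrite (ger0_norm w0).
  over.
pose D := a ^+ 2 + b ^+ 2.
(* A primitive of exp (- a w) (1 + cos (b w)) that vanishes at +oo. *)
pose F w := expR (- (a * w)) * ((b * sin (b * w) - a * cos (b * w)) / D - a^-1).
have dF w : is_derive w (1 : R) F (expR (- (a * w)) * (1 + cos (b * w))).
  have ds : is_derive w (1 : R) (fun w => sin (b * w)) (cos (b * w) * b).
    exact: (@is_derive1_comp _ sin (fun w => b * w)).
  have dc : is_derive w (1 : R) (fun w => cos (b * w)) (- sin (b * w) * b).
    exact: (@is_derive1_comp _ cos (fun w => b * w)).
  have d2 : is_derive w (1 : R) (fun w => b * sin (b * w) - a * cos (b * w))
      (b * (cos (b * w) * b) - a * (- sin (b * w) * b)).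
    by apply: is_deriveB; apply: is_deriveZ.
  have d3 : is_derive w (1 : R) (fun w => (b * sin (b * w) - a * cos (b * w)) / D - a^-1)
      (D^-1 * (b * (cos (b * w) * b) - a * (- sin (b * w) * b)) - 0).
    apply: is_deriveB.
    rewrite (_ : (fun w => _) = (fun w => D^-1 * (b * sin (b * w) - a * cos (b * w)))).
      exact: is_deriveZ.
    by apply/funext => z; rewrite mulrC.
  apply: (is_derive_eq (is_deriveM (is_derive_expRN a w) d3)).
  rewrite /GRing.scale /= subr0.
  have ? : D != 0 by rewrite gt_eqF.
  have ? : a != 0 by rewrite gt_eqF.
  rewrite /D in d3 *; field.
  by apply/andP; split.
have lF : F w @[w --> +oo] --> (0 : R).
  apply/norm_cvg0P.
  have : expR (- (a * w)) * ((`|b| + a) / D + a^-1) @[w --> +oo] --> (0 : R).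
    rewrite -(mul0r ((`|b| + a) / D + a^-1)); apply: cvgM; last exact: cvg_cst.
    apply: (cvg_comp _ _ _ (@cvgr_expR R)).
    exact: gt0_cvgMry.
  apply: squeeze_cvgr (cvg_cst 0).
  near=> w; rewrite normr_ge0 /= normrM ger0_norm ?expR_ge0// ler_pM2l ?expR_gt0//.
  apply: le_trans (ler_normB _ _) _.
  have a10 : 0 <= a^-1 by rewrite invr_ge0 ltW.
  have D10 : 0 <= D^-1 by rewrite invr_ge0 ltW.
  rewrite (ger0_norm a10) lerD2r normrM (ger0_norm D10) ler_wpM2r//.
  apply: le_trans (ler_normB _ _) _; apply: lerD.
    by rewrite normrM ler_piMr// ler_norml sin_geN1 sin_le1.
  by rewrite normrM (gtr0_norm a0) ler_piMr ?(ltW a0)// ler_norml cos_geN1 cos_le1.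
rewrite (ge0_integral_ray dF cf _ lF); last first.
  by move=> x _; rewrite mulr_ge0 ?expR_ge0.
rewrite /F !mulr0 sin0 cos0 oppr0 expR0 mulr0 mulr1 sub0r mul1r sub0r; congr EFin.
by rewrite opprB mulNr opprK.
Unshelve. all: by end_near. Qed.

End poisson_kernel.

(** * Mean square oscillation at a given scale *)

Section poisson_oscillation.
Context {R : realType}.
Local Notation leb := (@lebesgue_measure R).
Local Notation RR := (measurableTypeR R).
Implicit Types (f g h : R -> R) (e : R).

Definition sqnorm f : \bar R := (\int[leb]_x (f x ^+ 2)%:E)%E.

(** This is twice the defect of the Plancherel identity regularised at scale
    e, see [oscillation_correlation]; that it is a nonnegative quadratic form
    in f, bounded by the norm and small for nice f, is what makes the defect
    vanish for every square integrable f. *)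
Definition oscillation e f : \bar R :=
  (\int[leb]_x \int[leb]_y ((f x - f y) ^+ 2 * poisson e (x - y))%:E)%E.

Lemma measurable_poissonB e : 0 < e ->
  measurable_fun setT (fun z : RR * RR => poisson e (z.1 - z.2)).
Proof.
move=> e0; apply: (@measurableT_comp _ _ _ _ _ _ (poisson e)).
  exact: (continuous_measurable_fun (continuous_poisson e0)).
by apply: measurable_funB; [exact: measurable_fst|exact: measurable_snd].
Qed.

Lemma measurable_osc e f : 0 < e -> measurable_fun setT (f : RR -> R) ->
  measurable_fun setT (fun z : RR * RR => ((f z.1 - f z.2) ^+ 2 * poisson e (z.1 - z.2))%:E).
Proof.
move=> e0 mf; apply/measurable_EFinP; apply: measurable_funM; last exact: measurable_poissonB.
apply: measurable_funX; apply: measurable_funB.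
  by apply: measurableT_comp => //; exact: measurable_fst.
by apply: measurableT_comp => //; exact: measurable_snd.
Qed.

Lemma measurable_osc1 e f x : 0 < e -> measurable_fun setT (f : RR -> R) ->
  measurable_fun setT (fun y : RR => ((f x - f y) ^+ 2 * poisson e (x - y))%:E).
Proof.
by move=> e0 mf; exact: measurable_fun_pair2 (measurable_osc e0 mf).
Qed.

Lemma osc_ge0 e (c x : R) : 0 < e -> (0 <= (c ^+ 2 * poisson e x)%:E)%E.
Proof. by move=> e0; rewrite lee_fin mulr_ge0 ?sqr_ge0 ?poisson_ge0. Qed.

Lemma integral_poissonl e x (c : R) : 0 < e -> 0 <= c ->
  (\int[leb]_y (c * poisson e (x - y))%:E)%E = c%:E.
Proof.
move=> e0 c0; under eq_integral do rewrite EFinM.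
rewrite ge0_integralZl//.
- by rewrite integral_poisson// mule1.
- apply/measurable_EFinP; exact: measurable_fun_pair2 (measurable_poissonB e0).
- by move=> y _; rewrite lee_fin poisson_ge0.
Qed.

Lemma integral_poissonr e y (c : R) : 0 < e -> 0 <= c ->
  (\int[leb]_x (c * poisson e (x - y))%:E)%E = c%:E.
Proof.
move=> e0 c0; rewrite -[RHS](integral_poissonl y e0 c0).
by apply: eq_integral => x _; rewrite -poissonN opprB.
Qed.

Lemma sqnorm_poissonl e f : 0 < e ->
  (\int[leb]_x \int[leb]_y (f x ^+ 2 * poisson e (x - y))%:E)%E = sqnorm f.
Proof.
by move=> e0; apply: eq_integral => x _; rewrite integral_poissonl// sqr_ge0.
Qed.

Lemma measurable_sqP1 e f : 0 < e -> measurable_fun setT (f : RR -> R) ->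
  measurable_fun setT (fun z : RR * RR => (f z.1 ^+ 2 * poisson e (z.1 - z.2))%:E).
Proof.
move=> e0 mf; apply/measurable_EFinP; apply: measurable_funM; last exact: measurable_poissonB.
by apply: measurable_funX; apply: measurableT_comp => //; exact: measurable_fst.
Qed.

Lemma measurable_sqP2 e f : 0 < e -> measurable_fun setT (f : RR -> R) ->
  measurable_fun setT (fun z : RR * RR => (f z.2 ^+ 2 * poisson e (z.1 - z.2))%:E).
Proof.
move=> e0 mf; apply/measurable_EFinP; apply: measurable_funM; last exact: measurable_poissonB.
by apply: measurable_funX; apply: measurableT_comp => //; exact: measurable_snd.
Qed.

Lemma sqnorm_poissonr e f : 0 < e -> measurable_fun setT (f : RR -> R) ->
  (\int[leb]_x \int[leb]_y (f y ^+ 2 * poisson e (x - y))%:E)%E = sqnorm f.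
Proof.
move=> e0 mf; rewrite (fubini_tonelli (fun z : RR * RR => (f z.2 ^+ 2 * poisson e (z.1 - z.2))%:E)) /=.
- by apply: eq_integral => x _; rewrite integral_poissonr// sqr_ge0.
- exact: measurable_sqP2.
- by move=> z; exact: osc_ge0.
Qed.

Lemma sqnorm_ge0 f : (0 <= sqnorm f)%E.
Proof. by apply: integral_ge0 => x _; rewrite lee_fin sqr_ge0. Qed.

Lemma oscillation_ge0 e f : 0 < e -> (0 <= oscillation e f)%E.
Proof. by move=> e0; apply: integral_ge0 => x _; apply: integral_ge0 => y _; exact: osc_ge0. Qed.

Lemma ge0_integral2D (F G : RR * RR -> \bar R) :
  measurable_fun setT F -> measurable_fun setT G ->
  (forall z, (0 <= F z)%E) -> (forall z, (0 <= G z)%E) ->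
  (\int[leb]_x \int[leb]_y (F (x, y) + G (x, y)) =
   \int[leb]_x \int[leb]_y F (x, y) + \int[leb]_x \int[leb]_y G (x, y))%E.
Proof.
move=> mF mG F0 G0; rewrite -ge0_integralD//.
- apply: eq_integral => x _; rewrite ge0_integralD//.
    exact: measurable_fun_pair2 mF.
  exact: measurable_fun_pair2 mG.
- by move=> x _; exact: integral_ge0.
- exact: measurable_fun_fubini_tonelli_F.
- by move=> x _; exact: integral_ge0.
- exact: measurable_fun_fubini_tonelli_F.
Qed.

Lemma ge0_integral2Zl (F : RR * RR -> \bar R) (c : R) : 0 <= c ->
  measurable_fun setT F -> (forall z, (0 <= F z)%E) ->
  (\int[leb]_x \int[leb]_y (c%:E * F (x, y)) =
   c%:E * \int[leb]_x \int[leb]_y F (x, y))%E.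
Proof.
move=> c0 mF F0; rewrite -ge0_integralZl//.
- apply: eq_integral => x _; rewrite ge0_integralZl//.
  exact: measurable_fun_pair2 mF.
- exact: measurable_fun_fubini_tonelli_F.
- by move=> x _; exact: integral_ge0.
Qed.

Lemma ge0_le_integral2 (F G : RR * RR -> \bar R) :
  measurable_fun setT F -> measurable_fun setT G ->
  (forall z, (0 <= F z)%E) -> (forall z, (F z <= G z)%E) ->
  (\int[leb]_x \int[leb]_y F (x, y) <= \int[leb]_x \int[leb]_y G (x, y))%E.
Proof.
move=> mF mG F0 FG.
have G0 z : (0 <= G z)%E by exact: le_trans (FG z).
apply: ge0_le_integral => //.
- by move=> x _; exact: integral_ge0.
- exact: measurable_fun_fubini_tonelli_F.
- exact: measurable_fun_fubini_tonelli_F.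
- move=> x _; apply: ge0_le_integral => //.
    exact: measurable_fun_pair2 mF.
  exact: measurable_fun_pair2 mG.
Qed.

Lemma oscillationD e f g : 0 < e -> measurable_fun setT (f : RR -> R) ->
  measurable_fun setT (g : RR -> R) ->
  (oscillation e (f \+ g)%R <= 2%:E * oscillation e f + 2%:E * oscillation e g)%E.
Proof.
move=> e0 mf mg.
have mof := measurable_osc e0 mf; have mog := measurable_osc e0 mg.
rewrite -(ge0_integral2Zl (ler0n _ 2) mof (fun z => osc_ge0 _ _ e0)).
rewrite -(ge0_integral2Zl (ler0n _ 2) mog (fun z => osc_ge0 _ _ e0)).
rewrite -(@ge0_integral2D (fun z : RR * RR => 2%:E * ((f z.1 - f z.2) ^+ 2 * poisson e (z.1 - z.2))%:E)%E
  (fun z : RR * RR => 2%:E * ((g z.1 - g z.2) ^+ 2 * poisson e (z.1 - z.2))%:E)%E); last 4 first.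
- exact: measurable_funeM.
- exact: measurable_funeM.
- by move=> z; rewrite mule_ge0// osc_ge0.
- by move=> z; rewrite mule_ge0// osc_ge0.
apply: (@ge0_le_integral2 (fun z : RR * RR => (((f \+ g) z.1 - (f \+ g) z.2) ^+ 2 * poisson e (z.1 - z.2))%:E)
  (fun z : RR * RR => (2%:E * ((f z.1 - f z.2) ^+ 2 * poisson e (z.1 - z.2))%:E +
    2%:E * ((g z.1 - g z.2) ^+ 2 * poisson e (z.1 - z.2))%:E)%E)).
- by apply: measurable_osc => //; exact: measurable_funD.
- by apply: emeasurable_funD; exact: measurable_funeM.
- by move=> z; exact: osc_ge0.
move=> [x y] /=; rewrite -!EFinM -EFinD lee_fin.
have := poisson_ge0 (x - y) e0; move: (poisson e (x - y)) => p p0.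
rewrite -subr_ge0 (_ : _ - _ = ((f x - f y) - (g x - g y)) ^+ 2 * p); last by ring.
by apply: mulr_ge0 => //; exact: sqr_ge0.
Qed.

Lemma oscillation_le e f : 0 < e -> measurable_fun setT (f : RR -> R) ->
  (oscillation e f <= 4%:E * sqnorm f)%E.
Proof.
move=> e0 mf.
have m1 := measurable_sqP1 e0 mf; have m2 := measurable_sqP2 e0 mf.
apply: (@le_trans _ _ (2%:E * sqnorm f + 2%:E * sqnorm f)%E); last first.
  by rewrite -ge0_muleDl ?lee_fin// -EFinD (_ : 2 + 2 = 4)//; ring.
rewrite -{1}(sqnorm_poissonl f e0) -(sqnorm_poissonr e0 mf).
rewrite -(ge0_integral2Zl (ler0n _ 2) m1 (fun z => osc_ge0 _ _ e0)).
rewrite -(ge0_integral2Zl (ler0n _ 2) m2 (fun z => osc_ge0 _ _ e0)).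
rewrite -(@ge0_integral2D (fun z : RR * RR => 2%:E * (f z.1 ^+ 2 * poisson e (z.1 - z.2))%:E)%E
  (fun z : RR * RR => 2%:E * (f z.2 ^+ 2 * poisson e (z.1 - z.2))%:E)%E); last 4 first.
- exact: measurable_funeM.
- exact: measurable_funeM.
- by move=> z; rewrite mule_ge0// osc_ge0.
- by move=> z; rewrite mule_ge0// osc_ge0.
apply: (@ge0_le_integral2 (fun z : RR * RR => ((f z.1 - f z.2) ^+ 2 * poisson e (z.1 - z.2))%:E)
  (fun z : RR * RR => (2%:E * (f z.1 ^+ 2 * poisson e (z.1 - z.2))%:E +
    2%:E * (f z.2 ^+ 2 * poisson e (z.1 - z.2))%:E)%E)).
- exact: measurable_osc.
- by apply: emeasurable_funD; exact: measurable_funeM.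
- by move=> z; exact: osc_ge0.
move=> [x y] /=; rewrite -!EFinM -EFinD lee_fin.
have := poisson_ge0 (x - y) e0; move: (poisson e (x - y)) => p p0.
rewrite -subr_ge0 (_ : _ - _ = (f x + f y) ^+ 2 * p); last by ring.
by apply: mulr_ge0 => //; exact: sqr_ge0.
Qed.

(** A pair (x, y) contributes only if x or y lies in D, and both cases
    contribute the same amount since the kernel is even. *)
Lemma oscillation_localized e f (D : set RR) : 0 < e -> measurable D ->
  measurable_fun setT (f : RR -> R) ->
  (forall x, ~ D x -> f x = 0) ->
  (oscillation e f <= 2%:E * \int[leb]_(x in D) \int[leb]_y
    ((f x - f y) ^+ 2 * poisson e (x - y))%:E)%E.
Proof.
move=> e0 mD mf fD.
have mof := measurable_osc e0 mf.
pose F (z : RR * RR) := ((f z.1 - f z.2) ^+ 2 * poisson e (z.1 - z.2) * \1_D z.1)%:E.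
pose G (z : RR * RR) := ((f z.1 - f z.2) ^+ 2 * poisson e (z.1 - z.2) * \1_D z.2)%:E.
have mF : measurable_fun setT F.
  apply/measurable_EFinP; apply: measurable_funM; first exact/measurable_EFinP.
  by apply: measurableT_comp => //; exact: measurable_fst.
have mG : measurable_fun setT G.
  apply/measurable_EFinP; apply: measurable_funM; first exact/measurable_EFinP.
  by apply: measurableT_comp => //; exact: measurable_snd.
have F0 z : (0 <= F z)%E by rewrite /F EFinM mule_ge0 ?osc_ge0// lee_fin.
have G0 z : (0 <= G z)%E by rewrite /G EFinM mule_ge0 ?osc_ge0// lee_fin.
have FE : (\int[leb]_x \int[leb]_y F (x, y) = \int[leb]_(x in D) \int[leb]_y
    ((f x - f y) ^+ 2 * poisson e (x - y))%:E)%E.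
  rewrite [RHS]integral_mkcond; apply: eq_integral => x _; rewrite patchE /F /= indicE.
  case: ifPn => xD; first by under eq_integral do rewrite mulr1.
  by rewrite integral0_eq// => y _; rewrite mulr0.
have GE : (\int[leb]_x \int[leb]_y G (x, y) = \int[leb]_x \int[leb]_y F (x, y))%E.
  rewrite (fubini_tonelli G mG G0); apply: eq_integral => y _; apply: eq_integral => x _.
  by rewrite /F /G /= -(poissonN e (x - y)) opprB -(sqrrN (f x - f y)) opprB.
have FG z : (((f z.1 - f z.2) ^+ 2 * poisson e (z.1 - z.2))%:E <= F z + G z)%E.
  rewrite /F /G -EFinD lee_fin -mulrDr !indicE.
  have f0 x : x \notin D -> f x = 0 by move=> nx; apply: fD => /mem_set; exact/negP.
  have c00 : z.1 \notin D -> z.2 \notin D -> (f z.1 - f z.2) ^+ 2 * poisson e (z.1 - z.2) = 0.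
    by move=> /f0 -> /f0 ->; rewrite subrr expr0n mul0r.
  have : 0 <= (f z.1 - f z.2) ^+ 2 * poisson e (z.1 - z.2) by rewrite -lee_fin osc_ge0.
  move: (_ * poisson _ _) c00 => c c00 c0; clear mof mF mG F0 G0 FE GE mf f0 fD.
  case: (boolP (z.1 \in D)) => xD; first by rewrite ler_peMr// lerDl.
  case: (boolP (z.2 \in D)) => yD; first by rewrite ler_peMr// lerDr.
  by rewrite c00 ?mul0r.
rewrite -FE; clearbody F G.
rewrite mule_natl mule2n -{2}GE -(ge0_integral2D mF mG F0 G0).
apply: (ge0_le_integral2 mof _ _ FG); first exact: emeasurable_funD.
by move=> z; exact: osc_ge0.
Qed.

(** Away from the origin the kernel at a small scale e is at most a multiple
    of e times the kernel at scale 1, whose mass does not depend on e. *)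
Lemma poisson_tail e (dl x : R) : 0 < e <= 1 -> 0 < dl -> dl <= `|x| ->
  poisson e x <= e * (1 + dl ^- 2) * poisson 1 x.
Proof.
move=> /andP[e0 e1] d0 dx.
have x2 : dl ^+ 2 <= x ^+ 2.
  by rewrite -(real_normK (num_real x)) ler_pXn2r ?nnegrE// ltW.
have x20 : 0 < x ^+ 2 by apply: lt_le_trans x2; rewrite exprn_gt0.
have A0 : 0 < e ^+ 2 + x ^+ 2 by rewrite ltr_wpDl ?sqr_ge0.
have B0 : 0 < 1 + x ^+ 2 by rewrite ltr_wpDl.
have d20 : 0 < dl ^+ 2 by rewrite exprn_gt0.
have p0 := @pi_gt0 R; rewrite /poisson expr1n; move: (@pi R) p0 => p p0.
rewrite ler_pdivrMr ?mulr_gt0//.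
rewrite [leRHS](_ : _ = e * ((1 + dl ^- 2) / (1 + x ^+ 2) * (e ^+ 2 + x ^+ 2))); last first.
  by field; rewrite !gt_eqF.
rewrite ler_peMr ?(ltW e0)// mulrAC ler_pdivlMr// mul1r.
rewrite -subr_ge0 (_ : _ - _ = e ^+ 2 * (1 + dl ^- 2) + (x ^+ 2 / dl ^+ 2 - 1)).
  apply: addr_ge0; last by rewrite subr_ge0 ler_pdivlMr// mul1r.
  by apply: mulr_ge0; [exact: sqr_ge0|rewrite addr_ge0// invr_ge0 ltW].
by field; rewrite gt_eqF.
Qed.

End poisson_oscillation.

(** * Vanishing oscillation of cut off continuous functions *)

Section poisson_approximate_identity.
Context {R : realType}.
Local Notation leb := (@lebesgue_measure R).
Local Notation RR := (measurableTypeR R).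
Implicit Types (f g h : R -> R) (e : R).

Lemma ge0_cvge0P (I : Type) (F : set_system I) (FF : Filter F) (u : I -> \bar R) :
  (forall i, (0 <= u i)%E) ->
  u @ F --> 0%E <-> (forall e : R, 0 < e -> \forall i \near F, (u i <= e%:E)%E).
Proof.
move=> u0; split => [/fine_cvgP[ufin /cvgrPdist_le u_0] e /u_0|ue].
  apply: filterS2 ufin => i ufini; rewrite sub0r normrN ger0_norm ?fine_ge0//.
  by rewrite -lee_fin fineK.
have ufin : \forall i \near F, u i \is a fin_num.
  apply: filterS (ue 1 ltr01) => i ui1.
  by rewrite ge0_fin_numE// (le_lt_trans ui1)// ltry.
apply/fine_cvgP; split => //; apply/cvgrPdist_le => e /ue.
apply: filterS2 ufin => i ufini.
by rewrite sub0r normrN ger0_norm ?fine_ge0// -lee_fin fineK.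
Qed.

(** For |x - y| < dl the integrand is at most eta times a kernel of mass 1, by
    continuity at x; for the other y the bound is [poisson_tail]. *)
Lemma poisson_mean_le h (M x : R) : measurable_fun setT (h : RR -> R) ->
  (forall y, `|h y| <= M) -> {for x, continuous h} ->
  forall eta, 0 < eta -> exists2 C : R, 0 <= C & forall e, 0 < e <= 1 ->
    (\int[leb]_y ((h x - h y) ^+ 2 * poisson e (x - y))%:E <= (eta + C * e)%:E)%E.
Proof.
move=> mh hM ch eta eta0.
have M0 : 0 <= M by apply: le_trans (hM 0).
have : \forall y \near x, `|h x - h y| < Num.sqrt eta.
  by move/cvgrPdist_lt : ch; apply; rewrite sqrtr_gt0.
case/nbhs_ballP => dl /= d0 hd.
exists (4 * M ^+ 2 * (1 + dl ^- 2)).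
  by rewrite !mulr_ge0 ?sqr_ge0// addr_ge0// invr_ge0 sqr_ge0.
move=> e /andP[e0 e1].
have Ce0 : 0 <= 4 * M ^+ 2 * (1 + dl ^- 2) * e.
  by rewrite !mulr_ge0 ?sqr_ge0 ?(ltW e0)// addr_ge0// invr_ge0 sqr_ge0.
have mP (e' c : R) : 0 < e' -> measurable_fun setT (fun y : RR => (c * poisson e' (x - y))%:E).
  move=> e'0; apply/measurable_EFinP; apply: measurable_funM => //.
  exact: measurable_fun_pair2 (measurable_poissonB e'0).
rewrite EFinD -(integral_poissonl x e0 (ltW eta0)) -(integral_poissonl x ltr01 Ce0).
rewrite -ge0_integralD//; last 4 first.
- by move=> y _; rewrite lee_fin mulr_ge0 ?poisson_ge0 ?(ltW eta0).
- exact: mP.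
- by move=> y _; rewrite lee_fin mulr_ge0 ?poisson_ge0.
- exact: mP.
apply: ge0_le_integral => //.
- by move=> y _; exact: osc_ge0.
- exact: measurable_osc1.
- by apply: emeasurable_funD; exact: mP.
move=> y _; rewrite -EFinD lee_fin.
have Pe0 := poisson_ge0 (x - y) e0; have P10 := poisson_ge0 (x - y) (@ltr01 R).
have [xy|xy] := ltP `|x - y| dl.
  apply: (@le_trans _ _ (eta * poisson e (x - y))); last by rewrite lerDl mulr_ge0.
  apply: ler_wpM2r => //.
  have /ltW hxy := hd y xy.
  rewrite -(sqr_sqrtr (ltW eta0)) -(real_normK (num_real (h x - h y))).
  by rewrite ler_pXn2r ?nnegrE ?sqrtr_ge0.
apply: (@le_trans _ _ (4 * M ^+ 2 * (1 + dl ^- 2) * e * poisson 1 (x - y))); last first.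
  by rewrite lerDr mulr_ge0 ?(ltW eta0).
have hh : (h x - h y) ^+ 2 <= 4 * M ^+ 2.
  rewrite (_ : 4 * M ^+ 2 = (M + M) ^+ 2); last by ring.
  rewrite -(real_normK (num_real (h x - h y))) ler_pXn2r ?nnegrE ?addr_ge0//.
  by rewrite (le_trans (ler_normB _ _))// lerD.
apply: le_trans (ler_wpM2r Pe0 hh) _.
rewrite -(mulrA (4 * M ^+ 2)) -(mulrA (4 * M ^+ 2)) ler_wpM2l ?mulr_ge0 ?sqr_ge0//.
rewrite (mulrC (1 + dl ^- 2)); apply: poisson_tail => //.
by rewrite e0 e1.
Qed.

Lemma poisson_mean_bound h (M x e : R) : 0 < e -> measurable_fun setT (h : RR -> R) ->
  (forall y, `|h y| <= M) ->
  (\int[leb]_y ((h x - h y) ^+ 2 * poisson e (x - y))%:E <= (4 * M ^+ 2)%:E)%E.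
Proof.
move=> e0 mh hM; have M0 : 0 <= M by apply: le_trans (hM 0).
have M40 : 0 <= 4 * M ^+ 2 by rewrite mulr_ge0 ?sqr_ge0.
rewrite -(integral_poissonl x e0 M40); apply: ge0_le_integral => //.
- by move=> y _; exact: osc_ge0.
- exact: measurable_osc1.
- apply/measurable_EFinP; apply: measurable_funM => //.
  exact: measurable_fun_pair2 (measurable_poissonB e0).
move=> y _; rewrite lee_fin ler_wpM2r ?poisson_ge0//.
rewrite (_ : 4 * M ^+ 2 = (M + M) ^+ 2); last by ring.
rewrite -(real_normK (num_real (h x - h y))) ler_pXn2r ?nnegrE ?addr_ge0//.
by rewrite (le_trans (ler_normB _ _))// lerD.
Qed.

(** Cutting off to an open interval keeps continuity at every point of the
    interval, so the inner integral tends to 0 there; it is bounded, and by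
    [oscillation_localized] only this interval of finite measure matters. *)
Lemma oscillation_cvg0_cutoff h0 (M L : R) : continuous h0 -> (forall y, `|h0 y| <= M) ->
  oscillation n.+1%:R^-1 (fun x => h0 x * \1_(`]-L, L[%classic) x) @[n --> \oo] --> 0%E.
Proof.
move=> ch hM; pose D : set R := `]-L, L[%classic; rewrite -/D; pose h x := h0 x * \1_D x.
have en n : 0 < n.+1%:R^-1 :> R by rewrite invr_gt0.
have en1 n : 0 < (n.+1%:R^-1 : R) <= 1 by rewrite en invf_le1// ler1n.
have mD : measurable (D : set RR) by exact: measurable_itv.
have Doo : (leb D < +oo)%E.
  have := @lebesgue_measure_itv R `]-L, L[; rewrite /= => ->.
  by case: ifP => // _; rewrite -EFinB ltry.
have mh : measurable_fun setT (h : RR -> R).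
  by apply: measurable_funM; [exact: continuous_measurable_fun|exact: measurable_indic].
have hM' y : `|h y| <= M.
  rewrite /h indicE; case: (y \in D); rewrite ?mulr1// mulr0 normr0.
  by apply: le_trans (hM y).
pose I n x := (\int[leb]_y ((h x - h y) ^+ 2 * poisson n.+1%:R^-1 (x - y))%:E)%E.
have M40 : 0 <= 4 * M ^+ 2 by apply: mulr_ge0 => //; exact: sqr_ge0.
have I0 n x : (0 <= I n x)%E by apply: integral_ge0 => y _; exact: osc_ge0.
have IM n x : (I n x <= (4 * M ^+ 2)%:E)%E by exact: poisson_mean_bound.
have mI n : measurable_fun setT (I n : RR -> _).
  apply: (@measurable_fun_fubini_tonelli_F _ _ _ _ _ _ (fun z : RR * RR => ((h z.1 - h z.2) ^+ 2 * poisson n.+1%:R^-1 (z.1 - z.2))%:E)).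
    exact: measurable_osc.
  by move=> z; exact: osc_ge0.
have cI x : D x -> I n x @[n --> \oo] --> 0%E.
  move=> Dx; apply/ge0_cvge0P => // eta eta0.
  have chx : {for x, continuous h}.
    apply: (@cvg_trans _ (h0 @ x)); last first.
      rewrite /h indicE mem_set// mulr1; exact: ch.
    apply: near_eq_cvg.
    have : \forall y \near x, D y by apply: open_nbhs_nbhs; split => //; exact: interval_open.
    by apply: filterS => y Dy; rewrite /h indicE mem_set// mulr1.
  have [C C0 hC] := poisson_mean_le mh hM' chx (divr_gt0 eta0 (@ltr0n R 2)).
  have : \forall n \near \oo, C * n.+1%:R^-1 <= eta / 2.
    have : C * n.+1%:R^-1 @[n --> \oo] --> (C * 0 : R).
      by apply: cvgM; [exact: cvg_cst|exact: cvg_harmonic].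
    rewrite mulr0 => /cvgrPdist_le /(_ (eta / 2)); rewrite divr_gt0// => /(_ isT).
    apply: filterS => n; rewrite sub0r normrN ger0_norm// mulr_ge0//.
  apply: filterS => n nC; apply: le_trans (hC _ (en1 n)) _.
  by rewrite lee_fin [leRHS]splitr lerD2l.
have := @dominated_cvg _ _ _ leb D mD I (cst 0%E) (cst (4 * M ^+ 2)%:E).
move=> /(_ (fun n => measurable_funTS (mI n)) cI (fun _ _ => isT)) dct.
have {}dct : (\int[leb]_(x in D) I n x)%E @[n --> \oo] --> 0%E.
  rewrite -(integral0 leb D); apply: dct.
    apply/integrableP; split; first exact: measurable_cst.
    rewrite (eq_integral (cst (4 * M ^+ 2)%:E)); last first.
      by move=> x _; rewrite /= (ger0_norm M40).
    rewrite integral_cst// lte_mul_pinfty ?lee_fin//.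
  by move=> n x Dx; rewrite gee0_abs.
apply/ge0_cvge0P => [n|eta eta0]; first exact: oscillation_ge0.
have iI0 n : (0 <= \int[leb]_(x in D) I n x)%E by exact: integral_ge0.
have [N _ IN] := (ge0_cvge0P _ iI0).1 dct _ (divr_gt0 eta0 (@ltr0n R 2)).
exists N => // n /IN In.
have := oscillation_localized (en n) mD mh; move=> /(_ _)/le_trans; apply.
  by move=> x Dx; rewrite /h indicE memNset// mulr0.
have := lee_pmul (_ : (0 <= 2%:E)%E) (iI0 n) (lexx 2%:E) In.
rewrite lee_fin => /(_ (ler0n _ 2)) /le_trans; apply.
by rewrite -EFinM lee_fin mulrC divfK.
Qed.

End poisson_approximate_identity.

(** * Density, and vanishing oscillation of square integrable functions *)

Section square_mean_density.
Context {R : realType}.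
Local Notation leb := (@lebesgue_measure R).
Local Notation RR := (measurableTypeR R).
Implicit Types (f g h : R -> R) (e : R).

Lemma measurable_sqr f : measurable_fun setT (f : RR -> R) ->
  measurable_fun setT (fun x : RR => (f x ^+ 2)%:E).
Proof. by move=> mf; apply/measurable_EFinP; exact: measurable_funX. Qed.

Lemma sqnormD f g : measurable_fun setT (f : RR -> R) ->
  measurable_fun setT (g : RR -> R) ->
  (sqnorm (f \+ g)%R <= 2%:E * sqnorm f + 2%:E * sqnorm g)%E.
Proof.
move=> mf mg; have mf2 := measurable_sqr mf; have mg2 := measurable_sqr mg.
have f0 x : (0 <= (f x ^+ 2)%:E)%E by rewrite lee_fin sqr_ge0.
have g0 x : (0 <= (g x ^+ 2)%:E)%E by rewrite lee_fin sqr_ge0.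
rewrite -!ge0_integralZl// -ge0_integralD//; last 4 first.
- by move=> x _; rewrite mule_ge0.
- exact: measurable_funeM.
- by move=> x _; rewrite mule_ge0.
- exact: measurable_funeM.
apply: ge0_le_integral => //.
- by move=> x _; rewrite lee_fin sqr_ge0.
- by apply: measurable_sqr; exact: measurable_funD.
- by apply: emeasurable_funD; exact: measurable_funeM.
move=> x _; rewrite -!EFinM -EFinD lee_fin.
rewrite -subr_ge0 [leRHS](_ : _ = (f x - g x) ^+ 2) ?sqr_ge0//=.
by ring.
Qed.

Lemma truncation_approx f eta : measurable_fun setT (f : RR -> R) ->
  (sqnorm f < +oo)%E -> 0 < eta ->
  exists2 n : nat, (0 < n)%N & exists g, [/\ measurable_fun setT (g : RR -> R),
    forall x, `|g x| <= n%:R, forall x, ~ `](- n%:R), n%:R[%classic x -> g x = 0 &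
    (sqnorm (f \- g)%R <= eta%:E)%E].
Proof.
move=> mf nf eta0.
pose A n : set RR := `](- n%:R), n%:R[%classic `&` (f @^-1` `](- n%:R), n%:R[%classic).
have mA n : measurable (A n).
  apply: measurableI; first exact: measurable_itv.
  by rewrite -[X in measurable X]setTI; apply: mf => //; exact: measurable_itv.
pose g n x := f x * \1_(A n) x.
have mg n : measurable_fun setT (g n : RR -> R).
  by apply: measurable_funM => //; exact: measurable_indic.
have gE n x : f x - g n x = f x * (1 - \1_(A n) x) by rewrite mulrBr mulr1.
have dct : (\int[leb]_x ((f x - g n x) ^+ 2)%:E)%E @[n --> \oo] --> 0%E.
  rewrite -(integral0 leb setT).
  apply: (@dominated_cvg _ _ _ leb setT _ _ (cst 0%E) (fun x => (f x ^+ 2)%:E)) => //.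
  - move=> n; apply: measurable_sqr; exact: measurable_funB.
  - move=> x _; apply: cvg_near_cst.
    have [N fN] : exists N : nat, `|x| < N%:R /\ `|f x| < N%:R.
      exists (maxn (Num.bound `|x|) (Num.bound `|f x|)).
      by split; apply: lt_le_trans (archi_boundP (normr_ge0 _)) _; rewrite ler_nat ?leq_maxl ?leq_maxr.
    exists N => // n /= Nn; rewrite gE indicE mem_set ?subrr ?mulr0 ?expr0n//.
    have Nn' : N%:R <= n%:R :> R by rewrite ler_nat.
    by split; rewrite /= in_itv /= -ltr_norml (lt_le_trans _ Nn')//; case: fN.
  - apply/integrableP; split; first exact: measurable_sqr.
    by under eq_integral do rewrite gee0_abs ?lee_fin ?sqr_ge0//.
  - move=> n x _; rewrite gee0_abs ?lee_fin ?sqr_ge0// gE indicE.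
    case: (x \in A n); rewrite ?subrr ?mulr0 ?expr0n ?sqr_ge0//.
    by rewrite subr0 mulr1.
have i0 n : (0 <= \int[leb]_x ((f x - g n x) ^+ 2)%:E)%E.
  by apply: integral_ge0 => x _; rewrite lee_fin sqr_ge0.
have [N _ /(_ N.+1)] := (ge0_cvge0P _ i0).1 dct _ eta0.
rewrite /= leqnSn => /(_ isT) Neta.
exists N.+1 => //; exists (g N.+1); split => //.
- move=> x; rewrite /g indicE; case: (boolP (x \in A N.+1)); rewrite ?mulr0 ?normr0// mulr1.
  by rewrite inE => -[_]; rewrite /= in_itv /= -ltr_norml => /ltW.
- by move=> x nx; rewrite /g indicE memNset ?mulr0// => -[].
Qed.

(** A function that is bounded and of bounded support is approximated in L1 by
    continuous functions; clipping these to the same bound n costs nothing and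
    turns L1 closeness into L2 closeness, up to the factor 2 n. *)
Lemma continuous_cutoff_approx f eta : measurable_fun setT (f : RR -> R) ->
  (sqnorm f < +oo)%E -> 0 < eta ->
  exists h0 M L, [/\ continuous h0, forall y, `|h0 y| <= M &
    (sqnorm (f \- (fun x => h0 x * \1_(`]- L, L[%classic) x))%R <= eta%:E)%E].
Proof.
move=> mf nf eta0.
have [n n0 [g [mg gn gD ge]]] := truncation_approx mf nf (divr_gt0 eta0 (ltr0n _ 4)).
have nR0 : 0 < n%:R :> R by rewrite ltr0n.
pose D : set RR := `](- n%:R), n%:R[%classic.
have mD : measurable D by exact: measurable_itv.
have Doo : (leb D < +oo)%E.
  have := @lebesgue_measure_itv R `](- n%:R), n%:R[; rewrite /= => ->.
  by case: ifP => // _; rewrite -EFinB ltry.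
have ig : leb.-integrable D (EFin \o g).
  apply: measurable_bounded_integrable => //; first exact: measurable_funTS.
  by exists n%:R; split; rewrite ?num_real// => x nx y _; exact: le_trans (gn y) (ltW nx).
have [c [cc ic cg]] := approximation_continuous_integrable mD Doo ig.
have i0 k : (0 <= \int[leb]_(z in D) `|(g z - c k z)%:E|)%E by exact: integral_ge0.
have e2 : 0 < eta / (8 * n%:R) by rewrite divr_gt0// mulr_gt0.
have [k _ /(_ k (leqnn k)) kc] := (ge0_cvge0P _ i0).1 cg _ e2.
pose h0 x := Num.max (- n%:R) (Num.min n%:R (c k x)).
have ch0 : continuous h0.
  move=> x; apply: (@continuous_max R R (cst (- n%:R)) (cst n%:R \min c k) x).
    exact: cst_continuous.
  by apply: continuous_min; [exact: cst_continuous|exact: cc].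
have hn y : `|h0 y| <= n%:R.
  by rewrite ler_norml /h0 le_max lexx/= ge_max ge_min lexx /= andbT -subr_ge0 opprK addr_ge0 ?ltW.
exists h0, n%:R, n%:R; split => //.
rewrite -/D; pose h x := h0 x * \1_D x.
have mh : measurable_fun setT (h : RR -> R).
  by apply: measurable_funM; [exact: continuous_measurable_fun|exact: measurable_indic].
have gh : (sqnorm (g \- h)%R <= (eta / 4)%:E)%E.
  apply: (@le_trans _ _ ((2 * n%:R)%:E * \int[leb]_(z in D) `|(g z - c k z)%:E|)%E); last first.
    have := lee_pmul (_ : (0 <= (2 * n%:R)%:E)%E) (i0 k) (lexx (2 * n%:R)%:E) kc.
    rewrite lee_fin => /(_ (mulr_ge0 (ler0n _ 2) (ltW nR0)))/le_trans; apply.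
    rewrite -EFinM lee_fin le_eqVlt; apply/orP; left; apply/eqP.
    by field; rewrite gt_eqF.
  have mgc : measurable_fun D (fun z : RR => `|(g z - c k z)%:E|%E).
    apply: measurableT_comp => //; apply/measurable_EFinP; apply: measurable_funB.
      exact: measurable_funTS.
    by apply: measurable_funTS; exact: continuous_measurable_fun.
  rewrite -ge0_integralZl// ?lee_fin ?mulr_ge0 ?(ltW nR0)//.
  rewrite [leRHS]integral_mkcond.
  apply: ge0_le_integral => //.
  - by move=> x _; rewrite lee_fin sqr_ge0.
  - by apply: measurable_sqr; exact: measurable_funB.
  - by apply: (measurable_restrictT _ mD).1; exact: measurable_funeM.
  move=> x _; rewrite patchE /h /= indicE; case: ifPn => xD; last first.
    rewrite mulr0 subr0 gD ?expr0n//.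
    by move=> /mem_set; apply/negP.
  rewrite mulr1 -EFinM lee_fin -(real_normK (num_real (g x - h0 x))) expr2.
  apply: ler_pM => //.
    by rewrite (le_trans (ler_normB _ _))// (_ : 2 * n%:R = n%:R + n%:R) ?lerD//; ring.
  have := gn x; rewrite ler_norml => /andP[g1 g2].
  rewrite /h0; case: (leP n%:R (c k x)) => cn.
    rewrite (max_r (_ : - n%:R <= n%:R)); last by lra.
    rewrite !ler0_norm; lra.
  case: (leP (- n%:R) (c k x)) => cn'; first by [].
  rewrite !ger0_norm; lra.
rewrite (_ : _ \- _ = ((f \- g) \+ (g \- h))%R); last first.
  by apply/funext => x /=; rewrite /h addrA subrK.
have mfg := measurable_funB mf mg; have mgh := measurable_funB mg mh.
apply: le_trans (sqnormD mfg mgh) _.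
have H2 := ler0n R 2.
rewrite [leRHS](_ : _ = (eta / 2)%:E + (eta / 2)%:E)%E; last by rewrite -EFinD -splitr.
apply: leeD.
  have := lee_pmul (_ : (0 <= 2%:E)%E) (sqnorm_ge0 _) (lexx 2%:E) ge.
  rewrite lee_fin => /(_ H2)/le_trans; apply.
  by rewrite -EFinM lee_fin; lra.
have := lee_pmul (_ : (0 <= 2%:E)%E) (sqnorm_ge0 _) (lexx 2%:E) gh.
rewrite lee_fin => /(_ H2)/le_trans; apply.
by rewrite -EFinM lee_fin; lra.
Qed.

(** The oscillation is a quadratic form bounded by 4 times the squared norm,
    so its vanishing in the limit passes to L2 limits. *)
Lemma oscillation_cvg0 f : measurable_fun setT (f : RR -> R) -> (sqnorm f < +oo)%E ->
  oscillation n.+1%:R^-1 f @[n --> \oo] --> 0%E.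
Proof.
move=> mf nf; have en n : 0 < n.+1%:R^-1 :> R by rewrite invr_gt0.
apply/ge0_cvge0P => [n|eta eta0]; first exact: oscillation_ge0.
have [h0 [M [L [ch hM fh]]]] := continuous_cutoff_approx mf nf (divr_gt0 eta0 (ltr0n _ 16)).
pose h x := h0 x * \1_(`]- L, L[%classic : set RR) x.
have mh : measurable_fun setT (h : RR -> R).
  apply: measurable_funM; first exact: continuous_measurable_fun.
  by apply: measurable_indic; exact: measurable_itv.
have mfh := measurable_funB mf mh.
have o0 n : (0 <= oscillation n.+1%:R^-1 h)%E by exact: oscillation_ge0.
have [N _ HN] := (ge0_cvge0P _ o0).1 (oscillation_cvg0_cutoff L ch hM) _ (divr_gt0 eta0 (ltr0n R 4)).
exists N => // n /HN On.
have H2 := ler0n R 2; have H4 := ler0n R 4.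
rewrite (_ : f = (h \+ (f \- h))%R); last by apply/funext => x /=; rewrite addrCA subrr addr0.
apply: le_trans (oscillationD (en n) mh mfh) _.
rewrite [leRHS](_ : _ = (eta / 2)%:E + (eta / 2)%:E)%E; last by rewrite -EFinD -splitr.
apply: leeD.
  have := lee_pmul (_ : (0 <= 2%:E)%E) (o0 n) (lexx 2%:E) On.
  rewrite lee_fin => /(_ H2)/le_trans; apply.
  by rewrite -EFinM lee_fin; lra.
have o1 := oscillation_ge0 (f \- h) (en n).
have := lee_pmul (_ : (0 <= 4%:E)%E) (sqnorm_ge0 _) (lexx 4%:E) fh.
rewrite lee_fin => /(_ H4)/(le_trans (oscillation_le (en n) mfh)) ofh.
have := lee_pmul (_ : (0 <= 2%:E)%E) o1 (lexx 2%:E) ofh.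
rewrite lee_fin => /(_ H2)/le_trans; apply.
by rewrite -!EFinM lee_fin; lra.
Qed.

End square_mean_density.

(** * Integrals of real functions on the line *)

Section real_integrals.
Context {R : realType}.
Local Notation leb := (@lebesgue_measure R).
Local Notation RR := (measurableTypeR R).
Local Notation intgr f := (leb.-integrable setT (EFin \o f)).
Implicit Types (f g h u v : R -> R).

Lemma intgr_meas f : intgr f -> measurable_fun setT (f : RR -> R).
Proof. by move=> /integrableP[/measurable_EFinP]. Qed.

Lemma intgr_EFin f : intgr f -> (\int[leb]_x (f x)%:E)%E = (\int[leb]_x f x)%:E.
Proof. by move=> fi; rewrite /Rintegral fineK//; exact: integrable_fin_num. Qed.

Lemma intgrZl (k : R) f : intgr f -> intgr (fun x => k * f x).
Proof. by move=> fi; exact: (integrableZl _ k fi). Qed.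

Lemma intgr_norm f : intgr f -> intgr (fun x => `|f x|).
Proof. by move=> fi; exact: (integrable_abse fi). Qed.

Lemma intgr_dom (k : R) f g : measurable_fun setT (f : RR -> R) ->
  (forall x, `|f x| <= k * `|g x|) -> intgr g -> intgr f.
Proof.
move=> mf fg gi; apply: (@le_integrable _ _ _ leb _ _ _ (EFin \o (fun x => k * `|g x|))) => //.
- exact/measurable_EFinP.
- by move=> x _; rewrite /= lee_fin (le_trans (fg x))// ler_norm.
- by apply: intgrZl; exact: intgr_norm.
Qed.

Lemma intgrD f g : intgr f -> intgr g -> intgr (fun x => f x + g x).
Proof. by move=> fi gi; exact: (integrableD measurableT fi gi). Qed.

Lemma intgrB f g : intgr f -> intgr g -> intgr (fun x => f x - g x).
Proof. by move=> fi gi; exact: (integrableB measurableT fi gi). Qed.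

Lemma intgr_mulr_bounded (k : R) f g : intgr f -> measurable_fun setT (g : RR -> R) ->
  (forall x, `|g x| <= k) -> intgr (fun x => f x * g x).
Proof.
move=> fi mg gk; apply: (intgr_dom (k := k) _ _ fi).
  by apply: measurable_funM => //; exact: intgr_meas.
by move=> x; rewrite normrM mulrC ler_wpM2r.
Qed.

Lemma intgr_ge0 f : measurable_fun setT (f : RR -> R) -> (forall x, 0 <= f x) ->
  (\int[leb]_x (f x)%:E < +oo)%E -> intgr f.
Proof.
move=> mf f0 fi; apply/integrableP; split; first exact/measurable_EFinP.
by under eq_integral do rewrite /= (ger0_norm (f0 _)).
Qed.

Section product_domination.
Variables (F : RR * RR -> R) (u v : R -> R).
Hypotheses (mF : measurable_fun setT F) (ui : intgr u) (vi : intgr v).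
Hypothesis Fuv : forall z, `|F z| <= `|u z.1| * `|v z.2|.

Let F1 x : intgr (fun y => F (x, y)).
Proof.
apply: (intgr_dom (k := `|u x|) _ _ vi); first exact: measurable_fun_pair2 mF.
by move=> y; exact: (Fuv (x, y)).
Qed.

Let F2 y : intgr (fun x => F (x, y)).
Proof.
apply: (intgr_dom (k := `|v y|) _ _ ui); first exact: measurable_fun_pair1 mF.
by move=> x; rewrite mulrC; exact: (Fuv (x, y)).
Qed.

Let Fi : (leb \x leb)%E.-integrable setT (EFin \o F).
Proof.
have ui' := intgr_norm ui; have vi' := intgr_norm vi.
have ii : intgr (fun x => `|u x| * \int[leb]_y `|v y|).
  exact: (intgr_mulr_bounded (k := `|\int[leb]_y `|v y| |) ui').
apply/integrable12ltyP; first exact/measurable_EFinP.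
apply: (@le_lt_trans _ _ (\int[leb]_x (`|u x| * \int[leb]_y `|v y|)%:E)%E); last first.
  by rewrite intgr_EFin ?ltry.
apply: ge0_le_integral => //.
- by move=> x _; exact: integral_ge0.
- apply: (@measurable_fun_fubini_tonelli_F _ _ _ _ _ _ (fun z => (`|F z|)%:E)).
    by apply/measurable_EFinP; exact: measurableT_comp.
  by move=> z; rewrite lee_fin.
- exact: (measurable_int _ ii).
move=> x _; rewrite EFinM -intgr_EFin// -ge0_integralZl//; last first.
  exact: (measurable_int _ vi').
apply: ge0_le_integral => //.
- apply/measurable_EFinP; apply: measurableT_comp => //; exact: measurable_fun_pair2 mF.
- by apply: measurable_funeM; exact: (measurable_int _ vi').
- by move=> y _ /=; rewrite lee_fin; exact: (Fuv (x, y)).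
Qed.

(** A product domination makes every section of F integrable, not only almost
    every one, so that the identity holds between real-valued iterated
    integrals. *)
Lemma Rfubini : \int[leb]_x (\int[leb]_y F (x, y)) = \int[leb]_y (\int[leb]_x F (x, y)).
Proof.
have := Fubini Fi.
under eq_integral do rewrite (intgr_EFin (F1 _)).
under [in RHS]eq_integral do rewrite (intgr_EFin (F2 _)).
by rewrite /Rintegral => ->.
Qed.

Lemma intgr_Rfubini : intgr (fun x => \int[leb]_y F (x, y)).
Proof.
have := integrable_fubini_F Fi; rewrite /fubini_F.
by under eq_fun do rewrite (intgr_EFin (F1 _)).
Qed.

End product_domination.

Lemma continuous_intgr_param f (c : R -> R -> R) : intgr f ->
  (forall w, measurable_fun setT (c w : RR -> R)) -> (forall w x, `|c w x| <= 1) ->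
  (forall x, continuous (c ^~ x)) ->
  continuous (fun w => \int[leb]_x (f x * c w x)).
Proof.
move=> fi mc c1 cc w0.
have H := @continuity_under_integral _ _ _ leb (fun w x => f x * c w x) setT measurableT (w0 - 1) (w0 + 1).
apply: (H _ _ (fun x => `|f x|)).
- by move=> w _; apply: (intgr_mulr_bounded (k := 1)).
- apply: aeW => x _ w _; apply: cvgM; [exact: cvg_cst|exact: cc].
- exact: intgr_norm.
- by move=> w _; apply: aeW => x _; rewrite normrM ler_piMr.
- by rewrite inE /= in_itv /=; lra.
Qed.

End real_integrals.

(** * The power spectrum against an Abel weight *)

Section real_plancherel.
Context {R : realType}.
Local Notation leb := (@lebesgue_measure R).
Local Notation RR := (measurableTypeR R).
Local Notation intgr f := (leb.-integrable setT (EFin \o f)).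
Implicit Types (a f : R -> R) (e k b w x y : R).

(** Multiplying the power spectrum by this weight makes all integrals
    absolutely convergent. *)
Definition abel k w := expR (- (k * `|w|)).

Lemma abel_ge0 k w : 0 <= abel k w. Proof. exact: expR_ge0. Qed.

Lemma continuous_abel k : continuous (abel k).
Proof.
move=> w; apply: continuous_comp; last exact: continuous_expR.
by apply: cvgN; apply: cvgM; [exact: cvg_cst|exact: norm_continuous].
Qed.

Lemma measurable_abel k : measurable_fun setT (abel k : RR -> R).
Proof. exact: (continuous_measurable_fun (@continuous_abel k)). Qed.

Lemma continuous_cosM b : continuous (fun x => cos (b * x)).
Proof.
move=> x; apply: continuous_comp; last exact: continuous_cos.
by apply: cvgM; [exact: cvg_cst|exact: cvg_id].
Qed.

Lemma continuous_sinM b : continuous (fun x => sin (b * x)).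
Proof.
move=> x; apply: continuous_comp; last exact: continuous_sin.
by apply: cvgM; [exact: cvg_cst|exact: cvg_id].
Qed.

Lemma cos_norm_le1 x : `|cos x| <= 1.
Proof. by rewrite ler_norml cos_geN1 cos_le1. Qed.

Lemma sin_norm_le1 x : `|sin x| <= 1.
Proof. by rewrite ler_norml sin_geN1 sin_le1. Qed.

Let intgr_abel_cos1 k b : 0 < k -> intgr (fun w => abel k w * (1 + cos (b * w))).
Proof.
move=> k0; apply: intgr_ge0.
- apply: measurable_funM; first exact: measurable_abel.
  apply: measurable_funD. exact: measurable_cst.
  exact: (continuous_measurable_fun (@continuous_cosM b)).
- by move=> w; rewrite mulr_ge0 ?abel_ge0//; have := cos_geN1 (b * w); lra.
- by rewrite integral_expR_cos// ltry.
Qed.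

Lemma intgr_abel k : 0 < k -> intgr (abel k).
Proof.
move=> k0; apply: (intgr_dom (k := 1) _ _ (intgr_abel_cos1 0 k0)).
  exact: measurable_abel.
move=> w; rewrite mul1r mul0r cos0 normrM ler_peMr// ger0_norm; lra.
Qed.

Lemma Rintegral_abel_cos k b : 0 < k ->
  \int[leb]_w (abel k w * cos (b * w)) = 2 * k / (k ^+ 2 + b ^+ 2).
Proof.
move=> k0.
have H b' : \int[leb]_w (abel k w * (1 + cos (b' * w))) = 2 * (k^-1 + k / (k ^+ 2 + b' ^+ 2)).
  by rewrite /Rintegral integral_expR_cos.
have E0 : \int[leb]_w abel k w = 2 / k.
  have := H 0; under eq_Rintegral do rewrite mul0r cos0.
  rewrite RintegralZr//; last exact: intgr_abel.
  rewrite expr0n addr0 => E.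
  apply: (@mulIf _ (1 + 1)); first by rewrite gt_eqF.
  by rewrite E; field; rewrite gt_eqF.
have := H b.
under eq_Rintegral do rewrite mulrDr mulr1.
rewrite RintegralD//; first last.
- apply: (intgr_mulr_bounded (k := 1) (intgr_abel k0)).
    exact: (continuous_measurable_fun (@continuous_cosM b)).
  by move=> w; exact: cos_norm_le1.
- exact: intgr_abel.
rewrite E0 => /(canRL (addKr _)) ->.
by field; rewrite !gt_eqF ?poisson_den_gt0.
Qed.

Lemma poisson_abel e x : 0 < e ->
  \int[leb]_w (abel (2 * pi * e) w * cos (2 * pi * w * x)) = poisson e x.
Proof.
move=> e0; have p0 := @pi_gt0 R.
under eq_Rintegral do rewrite (mulrAC _ _ x).
rewrite Rintegral_abel_cos ?mulr_gt0// /poisson.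
have := poisson_den_gt0 x e0; move: (@pi R) p0 => p p0 d0.
rewrite (_ : (2 * p * e) ^+ 2 + (2 * p * x) ^+ 2 = (2 * p) ^+ 2 * (e ^+ 2 + x ^+ 2)); last by ring.
move: (e ^+ 2 + x ^+ 2) d0 => D D0; field.
by rewrite !gt_eqF.
Qed.

Definition cos_transform a w := \int[leb]_x (a x * cos (2 * pi * w * x)).
Definition sin_transform a w := \int[leb]_x (a x * sin (2 * pi * w * x)).

Section transform.
Variable a : R -> R.
Hypothesis ai : intgr a.

Lemma intgr_cosM b : intgr (fun x => a x * cos (b * x)).
Proof.
apply: (intgr_mulr_bounded (k := 1)) => //.
  exact: (continuous_measurable_fun (@continuous_cosM b)).
by move=> w; exact: cos_norm_le1.
Qed.

Lemma intgr_sinM b : intgr (fun x => a x * sin (b * x)).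
Proof.
apply: (intgr_mulr_bounded (k := 1)) => //.
  exact: (continuous_measurable_fun (@continuous_sinM b)).
by move=> w; exact: sin_norm_le1.
Qed.

Lemma continuous_cos_transform : continuous (cos_transform a).
Proof.
apply: (@continuous_intgr_param _ a (fun w x => cos (2 * pi * w * x))) => //.
- by move=> w; exact: (continuous_measurable_fun (@continuous_cosM _)).
- by move=> w x; exact: cos_norm_le1.
- move=> x w; apply: continuous_comp; last exact: continuous_cos.
  by apply: cvgM; [apply: cvgM; [exact: cvg_cst|exact: cvg_id]|exact: cvg_cst].
Qed.

Lemma continuous_sin_transform : continuous (sin_transform a).
Proof.
apply: (@continuous_intgr_param _ a (fun w x => sin (2 * pi * w * x))) => //.
- by move=> w; exact: (continuous_measurable_fun (@continuous_sinM _)).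
- by move=> w x; exact: sin_norm_le1.
- move=> x w; apply: continuous_comp; last exact: continuous_sin.
  by apply: cvgM; [apply: cvgM; [exact: cvg_cst|exact: cvg_id]|exact: cvg_cst].
Qed.

Let H w x := cos (2 * pi * w * x) * cos_transform a w + sin (2 * pi * w * x) * sin_transform a w.

Let HE w x : H w x = \int[leb]_y (a y * cos (2 * pi * w * (x - y))).
Proof.
transitivity (\int[leb]_y (cos (2 * pi * w * x) * (a y * cos (2 * pi * w * y)) +
                          sin (2 * pi * w * x) * (a y * sin (2 * pi * w * y)))).
  rewrite RintegralD//; [|by apply: intgrZl; exact: intgr_cosM|by apply: intgrZl; exact: intgr_sinM].
  by rewrite !RintegralZl//; [exact: intgr_sinM|exact: intgr_cosM].
by apply: eq_Rintegral => y _; rewrite mulrBr cosB; ring.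
Qed.

Let H_le w x : `|H w x| <= \int[leb]_y `|a y|.
Proof.
have i1 : intgr (fun y => a y * cos (2 * pi * w * (x - y))).
  apply: (intgr_mulr_bounded (k := 1)) => //.
    apply: continuous_measurable_fun => y.
    apply: continuous_comp; last exact: continuous_cos.
    by apply: cvgM; [exact: cvg_cst|apply: cvgB; [exact: cvg_cst|exact: cvg_id]].
  by move=> y; exact: cos_norm_le1.
rewrite HE (le_trans (le_normr_Rintegral _ i1))//.
apply: le_Rintegral => //; [exact: intgr_norm i1|exact: intgr_norm ai|].
by move=> y _; rewrite normrM ler_piMr ?cos_norm_le1.
Qed.

Let measurable_phase (f : R -> R) : continuous f ->
  measurable_fun setT (fun z : RR * RR => f (2 * pi * z.1 * z.2)).
Proof.
move=> cf; apply: (@measurableT_comp _ _ _ _ _ _ f) => //.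
  exact: (continuous_measurable_fun cf).
apply: measurable_funM; last exact: measurable_snd.
by apply: measurable_funM => //; exact: measurable_fst.
Qed.

Let mH : measurable_fun setT (fun z : RR * RR => H z.1 z.2).
Proof.
apply: measurable_funD; apply: measurable_funM.
- by apply: measurable_phase; exact: continuous_cos.
- apply: (@measurableT_comp _ _ _ _ _ _ (cos_transform a)); last exact: measurable_fst.
  exact: (continuous_measurable_fun continuous_cos_transform).
- by apply: measurable_phase; exact: continuous_sin.
- apply: (@measurableT_comp _ _ _ _ _ _ (sin_transform a)); last exact: measurable_fst.
  exact: (continuous_measurable_fun continuous_sin_transform).
Qed.

Let power_spectrumE w : cos_transform a w ^+ 2 + sin_transform a w ^+ 2 = \int[leb]_x (a x * H w x).
Proof.
transitivity (\int[leb]_x (cos_transform a w * (a x * cos (2 * pi * w * x)) +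
                          sin_transform a w * (a x * sin (2 * pi * w * x)))).
  rewrite RintegralD//; [|by apply: intgrZl; exact: intgr_cosM|by apply: intgrZl; exact: intgr_sinM].
  rewrite !RintegralZl//; [exact: intgr_sinM|exact: intgr_cosM].
by apply: eq_Rintegral => y _; rewrite /H; ring.
Qed.

(** Written out, the squared modulus of the Fourier transform at w is the
    double integral of a x * a y * cos (2 pi w (x - y)). Integrating it in w
    against the weight replaces the cosine by the Poisson kernel. *)
Lemma abel_power_spectrum e : 0 < e ->
  intgr (fun w => abel (2 * pi * e) w * (cos_transform a w ^+ 2 + sin_transform a w ^+ 2)) /\
  \int[leb]_w (abel (2 * pi * e) w * (cos_transform a w ^+ 2 + sin_transform a w ^+ 2)) =
  \int[leb]_x (a x * \int[leb]_y (a y * poisson e (x - y))).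
Proof.
move=> e0; set k := 2 * pi * e.
have k0 : 0 < k by rewrite !mulr_gt0// pi_gt0.
have ei := intgr_abel k0.
have me1 : measurable_fun setT (fun z : RR * RR => abel k z.1).
  by apply: (@measurableT_comp _ _ _ _ _ _ (abel k)); [exact: measurable_abel|exact: measurable_fst].
have ma2 : measurable_fun setT (fun z : RR * RR => a z.2).
  by apply: (@measurableT_comp _ _ _ _ _ _ a); [exact: intgr_meas|exact: measurable_snd].
pose F (z : RR * RR) := abel k z.1 * (a z.2 * H z.1 z.2).
have mF : measurable_fun setT F.
  by apply: measurable_funM => //; exact: measurable_funM.
pose I := \int[leb]_y `|a y|.
have vi : intgr (fun x => I * a x) by exact: intgrZl.
have FE z : `|F z| <= `|abel k z.1| * `|I * a z.2|.
  rewrite /F normrM ler_wpM2l// !normrM mulrC ler_wpM2r//.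
  by rewrite (le_trans (H_le _ _))// ler_norm.
have inner w : \int[leb]_x F (w, x) = abel k w * (cos_transform a w ^+ 2 + sin_transform a w ^+ 2).
  rewrite /F /= RintegralZl//; first by rewrite power_spectrumE.
  apply: (intgr_mulr_bounded (k := I)) => //.
  exact: (measurable_fun_pair2 w mH).
split.
  have := intgr_Rfubini mF ei vi FE.
  by under eq_fun do rewrite inner.
under eq_Rintegral do rewrite -inner.
rewrite (Rfubini mF ei vi FE); apply: eq_Rintegral => x _.
rewrite /F /=; under eq_Rintegral do rewrite mulrCA.
rewrite RintegralZl//; last first.
  apply: (intgr_mulr_bounded (k := I)) => //.
  exact: (measurable_fun_pair1 x mH).
congr (_ * _).
under eq_Rintegral do rewrite HE.
pose G (z : RR * RR) := abel k z.1 * (a z.2 * cos (2 * pi * z.1 * (x - z.2))).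
have mG : measurable_fun setT G.
  apply: measurable_funM => //; apply: measurable_funM => //.
  apply: (@measurableT_comp _ _ _ _ _ _ (@cos R)).
    exact: (continuous_measurable_fun (@continuous_cos R)).
  apply: measurable_funM; first by apply: measurable_funM => //; exact: measurable_fst.
  by apply: measurable_funB => //; exact: measurable_snd.
have GE z : `|G z| <= `|abel k z.1| * `|a z.2|.
  by rewrite /G normrM ler_wpM2l// normrM ler_piMr// cos_norm_le1.
transitivity (\int[leb]_w \int[leb]_y G (w, y)).
  apply: eq_Rintegral => w _; rewrite /G /= RintegralZl//.
  apply: (intgr_mulr_bounded (k := 1)) => //.
    apply: continuous_measurable_fun => y.
    apply: continuous_comp; last exact: continuous_cos.
    by apply: cvgM; [exact: cvg_cst|apply: cvgB; [exact: cvg_cst|exact: cvg_id]].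
  by move=> y; exact: cos_norm_le1.
rewrite (Rfubini mG ei ai GE); apply: eq_Rintegral => y _.
rewrite /G /=; under eq_Rintegral do rewrite mulrCA.
rewrite RintegralZl ?poisson_abel//.
apply: (intgr_mulr_bounded (k := 1)) => //; last by move=> w; exact: cos_norm_le1.
apply: continuous_measurable_fun => w.
apply: continuous_comp; last exact: continuous_cos.
by apply: cvgM; [apply: cvgM; [exact: cvg_cst|exact: cvg_id]|exact: cvg_cst].
Qed.

End transform.
End real_plancherel.

(** * The Plancherel identity for real functions *)

Section plancherel_identity.
Context {R : realType}.
Local Notation leb := (@lebesgue_measure R).
Local Notation RR := (measurableTypeR R).
Local Notation intgr f := (leb.-integrable setT (EFin \o f)).
Variable a : R -> R.
Hypotheses (ai : intgr a) (a2 : (sqnorm a < +oo)%E).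
Implicit Types (e : R).

Let ma := intgr_meas ai.

Let a2i : intgr (fun x => a x ^+ 2).
Proof. by apply: intgr_ge0 => // [|x]; [exact: measurable_funX|exact: sqr_ge0]. Qed.

Let mP e x : 0 < e -> measurable_fun setT (fun y : RR => poisson e (x - y)).
Proof. by move=> e0; exact: (measurable_fun_pair2 x (measurable_poissonB e0)). Qed.

Let poisson_le e x : 0 < e -> `|poisson e x| <= e / (pi * e ^+ 2).
Proof.
move=> e0; rewrite ger0_norm ?poisson_ge0// /poisson ler_wpM2l ?(ltW e0)//.
have p0 := @pi_gt0 R.
rewrite lef_pV2 ?posrE ?mulr_gt0 ?poisson_den_gt0 ?exprn_gt0//.
by rewrite ler_pM2l// lerDl sqr_ge0.
Qed.

Let intgrP e x f : 0 < e -> intgr f -> intgr (fun y => f y * poisson e (x - y)).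
Proof.
by move=> e0 fi; apply: (intgr_mulr_bounded fi); [exact: mP|move=> y; exact: poisson_le].
Qed.

Let intgr_poisson e x : 0 < e -> intgr (fun y => poisson e (x - y)).
Proof.
move=> e0; apply: intgr_ge0; [exact: mP|by move=> y; exact: poisson_ge0|].
by rewrite integral_poisson// ltry.
Qed.

(** Expand (a x - a y)^2: by unit mass of the kernel in either variable, both
    squares integrate to the squared norm of a. *)
Lemma oscillation_correlation e : 0 < e ->
  oscillation e a = (2 * (\int[leb]_x a x ^+ 2 -
    \int[leb]_x (a x * \int[leb]_y (a y * poisson e (x - y)))))%:E.
Proof.
move=> e0; set Q := fun x => \int[leb]_y (a y * poisson e (x - y)).
pose q x := \int[leb]_y (a y ^+ 2 * poisson e (x - y)).
have qE x : (\int[leb]_y (a y ^+ 2 * poisson e (x - y))%:E)%E = (q x)%:E.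
  by apply: intgr_EFin; exact: intgrP.
have q0 x : 0 <= q x.
  by apply: Rintegral_ge0 => y _; rewrite mulr_ge0 ?sqr_ge0 ?poisson_ge0.
have qq : (\int[leb]_x (q x)%:E)%E = sqnorm a.
  by rewrite -(sqnorm_poissonr e0 ma); apply: eq_integral => x _; rewrite qE.
have mq : measurable_fun setT (q : RR -> R).
  apply/measurable_EFinP.
  have := @measurable_fun_fubini_tonelli_F _ _ _ _ _ leb _ (measurable_sqP2 e0 ma).
  rewrite /fubini_F /=; under eq_fun do rewrite qE.
  by apply => z; exact: osc_ge0.
have qi : intgr q by apply: intgr_ge0 => //; rewrite qq.
have Qi : intgr (fun x => a x * Q x).
  have mF : measurable_fun setT (fun z : RR * RR => a z.1 * (a z.2 * poisson e (z.1 - z.2))).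
    apply: measurable_funM; first by apply: measurableT_comp => //; exact: measurable_fst.
    apply: measurable_funM; last exact: measurable_poissonB.
    by apply: measurableT_comp => //; exact: measurable_snd.
  have vi : intgr (fun y => e / (pi * e ^+ 2) * a y) by exact: intgrZl.
  have FE z : `|a z.1 * (a z.2 * poisson e (z.1 - z.2))| <=
      `|a z.1| * `|e / (pi * e ^+ 2) * a z.2|.
    rewrite normrM ler_wpM2l// [X in X <= _]normrM [X in _ <= X]normrM mulrC ler_wpM2r//.
    by rewrite (le_trans (poisson_le _ e0))// ler_norm.
  have := intgr_Rfubini mF ai vi FE.
  rewrite (_ : (fun x => _) = (fun x => a x * Q x))//.
  by apply/funext => x; rewrite /= RintegralZl//; exact: intgrP.
have oE x : (\int[leb]_y ((a x - a y) ^+ 2 * poisson e (x - y))%:E)%E =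
    (a x ^+ 2 - 2 * (a x * Q x) + q x)%:E.
  rewrite intgr_EFin.
    congr EFin.
    transitivity (\int[leb]_y (a x ^+ 2 * poisson e (x - y) -
      2 * a x * (a y * poisson e (x - y)) + a y ^+ 2 * poisson e (x - y))).
      by apply: eq_Rintegral => y _; ring.
    rewrite RintegralD//; first last.
    - exact: intgrP.
    - by apply: intgrB; apply: intgrZl; [exact: intgr_poisson|exact: intgrP].
    rewrite RintegralB//; first last.
    - by apply: intgrZl; exact: intgrP.
    - by apply: intgrZl; exact: intgr_poisson.
    rewrite (RintegralZl (a x ^+ 2) measurableT (intgr_poisson x e0)).
    rewrite (RintegralZl (2 * a x) measurableT (intgrP x e0 ai)).
    by rewrite {1}/Rintegral integral_poisson// mulr1 -mulrA.
  apply: (@eq_integrable _ _ _ leb setT measurableT (EFin \o (fun y => a x ^+ 2 * poisson e (x - y) -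
      2 * a x * (a y * poisson e (x - y)) + a y ^+ 2 * poisson e (x - y)))).
    by move=> y _ /=; congr EFin; ring.
  apply: intgrD; last exact: intgrP.
  by apply: intgrB; apply: intgrZl; [exact: intgr_poisson|exact: intgrP].
rewrite /oscillation; under eq_integral do rewrite oE.
have i2 : intgr (fun x => 2 * (a x * Q x)) by exact: intgrZl.
rewrite intgr_EFin; last by apply: intgrD => //; exact: intgrB.
congr EFin; rewrite RintegralD//; last exact: intgrB.
rewrite RintegralB// RintegralZl//.
have -> : \int[leb]_x q x = \int[leb]_x a x ^+ 2 by rewrite /Rintegral qq.
by ring.
Qed.

(** By [abel_power_spectrum] and [oscillation_correlation] the weighted
    integral of the power spectrum is the squared norm of a minus half the
    oscillation. As the scale tends to 0 the weight increases to 1 and the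
    oscillation vanishes. *)
Lemma plancherel_real :
  (\int[leb]_w (cos_transform a w ^+ 2 + sin_transform a w ^+ 2)%:E)%E = sqnorm a.
Proof.
have en n : 0 < n.+1%:R^-1 :> R by rewrite invr_gt0.
pose S w := cos_transform a w ^+ 2 + sin_transform a w ^+ 2.
have S0 w : 0 <= S w by rewrite addr_ge0 ?sqr_ge0.
have mS : measurable_fun setT (S : RR -> R).
  apply: measurable_funD; apply: measurable_funX.
    exact: (continuous_measurable_fun (continuous_cos_transform ai)).
  exact: (continuous_measurable_fun (continuous_sin_transform ai)).
pose g n w := (abel (2 * pi * n.+1%:R^-1) w * S w)%:E.
have gE n : (\int[leb]_w g n w)%E = (\int[leb]_x a x ^+ 2 - fine (oscillation n.+1%:R^-1 a) / 2)%:E.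
  have [gi gE] := abel_power_spectrum ai (en n).
  rewrite /g intgr_EFin// gE oscillation_correlation//=; congr EFin.
  by field.
have lim1 : (\int[leb]_w g n w)%E @[n --> \oo] --> (\int[leb]_x a x ^+ 2)%:E.
  under eq_fun do rewrite gE.
  apply: cvg_EFin; first exact: nearW.
  rewrite -[X in _ --> X]subr0; apply: cvgB; first exact: cvg_cst.
  rewrite -[X in _ --> X](mul0r 2^-1); apply: cvgM; last exact: cvg_cst.
  by have /fine_cvgP[_] := oscillation_cvg0 ma a2.
have lim2 : (\int[leb]_w g n w)%E @[n --> \oo] --> (\int[leb]_w (S w)%:E)%E.
  have -> : (\int[leb]_w (S w)%:E = \int[leb]_w limn (g ^~ w))%E.
    apply: eq_integral => w _; apply/esym/cvg_lim => //.
    rewrite /g; apply: cvg_EFin; first exact: nearW.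
    rewrite -[X in _ --> X]mul1r; apply: cvgM; last exact: cvg_cst.
    rewrite -[X in _ --> X](@expR0 R); apply: continuous_cvg; first exact: continuous_expR.
    rewrite -oppr0; apply: cvgN; rewrite -(mul0r `|w|); apply: cvgM; last exact: cvg_cst.
    rewrite -(mulr0 (2 * pi)); apply: cvgM; first exact: cvg_cst.
    exact: cvg_harmonic.
  apply: cvg_monotone_convergence => //.
  - move=> n; apply/measurable_EFinP; apply: measurable_funM => //; exact: measurable_abel.
  - by move=> n w _; rewrite lee_fin mulr_ge0 ?abel_ge0.
  - move=> w _ n m nm; rewrite lee_fin ler_wpM2r// ler_expR lerN2 ler_wpM2r//.
    rewrite ler_wpM2l ?mulr_ge0 ?pi_ge0// lef_pV2 ?posrE// ler_nat.
    exact: nm.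
by rewrite (cvg_unique _ lim2 lim1)// -intgr_EFin.
Qed.

End plancherel_identity.

(** * The Plancherel identity for complex functions *)

Section complex_plancherel.
Context {R : realType}.
Local Open Scope complex_scope.
Local Notation leb := (@lebesgue_measure R).
Local Notation RR := (measurableTypeR R).
Local Notation intgr f := (leb.-integrable setT (EFin \o f)).
Implicit Types (f g h : RR -> R[i]).

Lemma absolutely_integrable_Re f : cmeasurable_fun f -> absolutely_integrable leb f ->
  intgr (fun x => complex.Re (f x)).
Proof.
move=> [mr mi] fi; apply: (intgr_dom (k := 1) _ _ fi) => // x.
by rewrite mul1r [leRHS]ger0_norm ?modc_ge0// le_Re_modc.
Qed.

Lemma absolutely_integrable_Im f : cmeasurable_fun f -> absolutely_integrable leb f ->
  intgr (fun x => complex.Im (f x)).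
Proof.
move=> [mr mi] fi; apply: (intgr_dom (k := 1) _ _ fi) => // x.
by rewrite mul1r [leRHS]ger0_norm ?modc_ge0// le_Im_modc.
Qed.

Lemma adde_self_inj (X Y : \bar R) : (0 <= X)%E -> (0 <= Y)%E -> (Y < +oo)%E ->
  (X + X = 2%:E * Y)%E -> X = Y.
Proof.
move=> X0 Y0 Yoo sum.
have Yfin : Y \is a fin_num by rewrite ge0_fin_numE.
have Xfin : X \is a fin_num.
  rewrite ge0_fin_numE//; apply: (@le_lt_trans _ _ (2%:E * Y)%E).
    by rewrite -sum leeDl.
  by rewrite lte_mul_pinfty ?lee_fin.
move: sum; rewrite -(fineK Xfin) -(fineK Yfin) -EFinD -EFinM => -[] H; congr EFin.
by move: H; move: (fine _) (fine _) => x y; lra.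
Qed.

Section transform.
Variable f : RR -> R[i].
Hypotheses (mf : cmeasurable_fun f) (fi : absolutely_integrable leb f).
Let a x := complex.Re (f x).
Let b x := complex.Im (f x).
Let ai : intgr a := absolutely_integrable_Re mf fi.
Let bi : intgr b := absolutely_integrable_Im mf fi.

Lemma Re_fourier_L1 w : complex.Re (fourier_L1 f w) = cos_transform a w + sin_transform b w.
Proof.
rewrite /cos_transform /sin_transform -RintegralD//; [|exact: intgr_cosM|exact: intgr_sinM].
apply: eq_Rintegral => x _; rewrite /a /b.
by case: (f x) => u v; rewrite /expi /= cosN sinN; ring.
Qed.

Lemma Im_fourier_L1 w : complex.Im (fourier_L1 f w) = cos_transform b w - sin_transform a w.
Proof.
rewrite /cos_transform /sin_transform -RintegralB//; [|exact: intgr_cosM|exact: intgr_sinM].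
apply: eq_Rintegral => x _; rewrite /a /b.
by case: (f x) => u v; rewrite /expi /= cosN sinN; ring.
Qed.

Lemma cmeasurable_fourier_L1 : cmeasurable_fun (fourier_L1 f).
Proof.
split.
  under eq_fun do rewrite Re_fourier_L1.
  by apply: measurable_funD; apply: continuous_measurable_fun;
    [exact: continuous_cos_transform|exact: continuous_sin_transform].
under eq_fun do rewrite Im_fourier_L1.
by apply: measurable_funB; apply: continuous_measurable_fun;
  [exact: continuous_cos_transform|exact: continuous_sin_transform].
Qed.

Lemma energy_Re_Im : energy leb setT f = (sqnorm a + sqnorm b)%E.
Proof.
rewrite /sqnorm -ge0_integralD//.
- by apply: eq_integral => x _; rewrite modc_sqrE EFinD.
- by move=> x _; rewrite lee_fin sqr_ge0.
- by apply: measurable_sqr; exact: intgr_meas.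
- by move=> x _; rewrite lee_fin sqr_ge0.
- by apply: measurable_sqr; exact: intgr_meas.
Qed.

Let cos_transformN (c : R -> R) w : cos_transform c (- w) = cos_transform c w.
Proof. by apply: eq_Rintegral => x _; rewrite mulrN mulNr cosN. Qed.

Let sin_transformN (c : R -> R) w : intgr c -> sin_transform c (- w) = - sin_transform c w.
Proof.
move=> ci; rewrite /sin_transform -[RHS]mulN1r -RintegralZl//; last exact: intgr_sinM.
by apply: eq_Rintegral => x _; rewrite mulrN mulNr sinN mulN1r mulrN.
Qed.

(** For f = a + i b with real a and b, the mixed terms of |f^(w)|^2 are odd in
    w: the values at w and - w add up to twice the sum of the power spectra of
    a and b. So the real case is enough. *)
Lemma energy_fourier_L1 : (energy leb setT f < +oo)%E ->
  energy leb setT (fourier_L1 f) = energy leb setT f.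
Proof.
move=> Yoo; have foo : (sqnorm a + sqnorm b < +oo)%E by rewrite -energy_Re_Im.
have aoo : (sqnorm a < +oo)%E.
  by apply: le_lt_trans foo; rewrite leeDl// sqnorm_ge0.
have boo : (sqnorm b < +oo)%E.
  by apply: le_lt_trans foo; rewrite leeDr// sqnorm_ge0.
have mE : measurable_fun setT (fun w : RR => (modc (fourier_L1 f w) ^+ 2)%:E).
  by apply: measurable_modc_sqr; exact: cmeasurable_fourier_L1.
have mEN : measurable_fun setT (fun w : RR => (modc (fourier_L1 f (- w)) ^+ 2)%:E).
  by exact: (measurableT_comp mE (@oppr_measurable R setT)).
have EN : energy leb setT (fourier_L1 f) = (\int[leb]_w (modc (fourier_L1 f (- w)) ^+ 2)%:E)%E.
  rewrite /energy (ge0_integral_reflect (D := setT))//.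
  by move=> x; rewrite lee_fin sqr_ge0.
have mSp (c : R -> R) : intgr c -> measurable_fun setT (fun w : RR => (cos_transform c w ^+ 2 + sin_transform c w ^+ 2)%:E).
  move=> ci; apply/measurable_EFinP; apply: measurable_funD; apply: measurable_funX;
    apply: continuous_measurable_fun; [exact: continuous_cos_transform|exact: continuous_sin_transform].
have S0 (c : R -> R) w : (0 <= (cos_transform c w ^+ 2 + sin_transform c w ^+ 2)%:E)%E.
  by rewrite lee_fin addr_ge0 ?sqr_ge0.
have sum : (energy leb setT (fourier_L1 f) + energy leb setT (fourier_L1 f) =
    2%:E * energy leb setT f)%E.
  have e0 w : (0 <= (modc (fourier_L1 f w) ^+ 2)%:E)%E by rewrite lee_fin sqr_ge0.
  have eN0 w : (0 <= (modc (fourier_L1 f (- w)) ^+ 2)%:E)%E by rewrite lee_fin sqr_ge0.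
  have aS := plancherel_real ai aoo; have bS := plancherel_real bi boo.
  pose S (c : R -> R) (w : R) : \bar R := (cos_transform c w ^+ 2 + sin_transform c w ^+ 2)%:E.
  have sumS : (sqnorm a + sqnorm b = \int[leb]_w (S a w + S b w))%E.
    rewrite -aS -bS; apply/esym.
    exact: (ge0_integralD leb measurableT (fun w _ => S0 a w) (mSp a ai) (fun w _ => S0 b w) (mSp b bi)).
  have mS : measurable_fun setT (fun w : RR => (S a w + S b w)%E).
    exact: (emeasurable_funD (mSp a ai) (mSp b bi)).
  have S20 w : (0 <= S a w + S b w)%E := adde_ge0 (S0 a w) (S0 b w).
  have two0 : (0 <= 2%:E :> \bar R)%E by rewrite lee_fin.
  have sum2S := ge0_integralZl leb measurableT mS (fun w _ => S20 w) two0.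
  have sumE := ge0_integralD leb measurableT (fun w _ => e0 w) mE (fun w _ => eN0 w) mEN.
  rewrite {2}EN energy_Re_Im sumS -sum2S -sumE; apply: eq_integral => w _.
  rewrite /S -!EFinD -EFinM; congr EFin.
  rewrite !modc_sqrE !Re_fourier_L1 !Im_fourier_L1 cos_transformN cos_transformN (sin_transformN w ai) (sin_transformN w bi).
  by ring.
have X0 : (0 <= energy leb setT (fourier_L1 f))%E := energy_ge0 _ _ _.
have Y0 : (0 <= energy leb setT f)%E := energy_ge0 _ _ _.
exact: (adde_self_inj X0 Y0 Yoo sum).
Qed.

End transform.

End complex_plancherel.

(** * The Fourier transform on L2 as an isometry *)

Section fourier_existence.
Context {R : realType}.
Local Open Scope complex_scope.
Local Notation leb := (@lebesgue_measure R).
Local Notation RR := (measurableTypeR R).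
Local Notation intgr f := (leb.-integrable setT (EFin \o f)).
Implicit Types (f g : RR -> R[i]) (u v : L2 leb).

Lemma eq_complex_val (z w : R[i]) :
  complex.Re z = complex.Re w -> complex.Im z = complex.Im w -> z = w.
Proof. by case: z w => [a b] [c d] /= -> ->. Qed.

Lemma ReB (z w : R[i]) : complex.Re (z - w) = complex.Re z - complex.Re w.
Proof. by case: z w => [a b] [c d]. Qed.

Lemma ImB (z w : R[i]) : complex.Im (z - w) = complex.Im z - complex.Im w.
Proof. by case: z w => [a b] [c d]. Qed.

Lemma cos_transformB (a b : R -> R) w : intgr a -> intgr b ->
  cos_transform (fun x => a x - b x) w = cos_transform a w - cos_transform b w.
Proof.
move=> ai bi; rewrite /cos_transform -RintegralB//; [|exact: intgr_cosM|exact: intgr_cosM].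
by apply: eq_Rintegral => x _; rewrite mulrBl.
Qed.

Lemma sin_transformB (a b : R -> R) w : intgr a -> intgr b ->
  sin_transform (fun x => a x - b x) w = sin_transform a w - sin_transform b w.
Proof.
move=> ai bi; rewrite /sin_transform -RintegralB//; [|exact: intgr_sinM|exact: intgr_sinM].
by apply: eq_Rintegral => x _; rewrite mulrBl.
Qed.

Lemma absolutely_integrable_ae f g : cmeasurable_fun f -> cmeasurable_fun g ->
  f = g %[ae leb] -> absolutely_integrable leb f -> absolutely_integrable leb g.
Proof.
move=> mf mg fg /integrableP[_ fi]; apply/integrableP; split.
  exact/measurable_EFinP/measurable_modc.
rewrite (le_lt_trans _ fi)// le_eqVlt; apply/orP; left; apply/eqP.
apply: ae_eq_integral => //.
- by apply: measurableT_comp => //; exact/measurable_EFinP/measurable_modc.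
- by apply: measurableT_comp => //; exact/measurable_EFinP/measurable_modc.
- by apply: filterS fg => x /= + _ => ->.
Qed.

Lemma absolutely_integrableB f g : cmeasurable_fun f -> cmeasurable_fun g ->
  absolutely_integrable leb f -> absolutely_integrable leb g ->
  absolutely_integrable leb (f - g).
Proof.
move=> mf mg fi gi.
apply: (intgr_dom (k := 1) (g := fun x => modc (f x) + modc (g x))).
- by apply: measurable_modc; exact: cmeasurable_funB.
- move=> x; rewrite mul1r !ger0_norm ?modc_ge0 ?addr_ge0 ?modc_ge0//.
  rewrite -(normcN (g x)); exact: le_normcD.
- exact: intgrD.
Qed.

Lemma fourier_L1B f g : cmeasurable_fun f -> cmeasurable_fun g ->
  absolutely_integrable leb f -> absolutely_integrable leb g ->
  fourier_L1 (f - g) = fourier_L1 f - fourier_L1 g.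
Proof.
move=> mf mg fi gi; apply/funext => w.
have mfg := cmeasurable_funB mf mg; have fgi := absolutely_integrableB mf mg fi gi.
have fr := absolutely_integrable_Re mf fi; have fim := absolutely_integrable_Im mf fi.
have gr := absolutely_integrable_Re mg gi; have gim := absolutely_integrable_Im mg gi.
have rE : (fun x => complex.Re ((f - g) x)) = (fun x => complex.Re (f x) - complex.Re (g x)).
  by apply/funext => x; exact: ReB.
have iE : (fun x => complex.Im ((f - g) x)) = (fun x => complex.Im (f x) - complex.Im (g x)).
  by apply/funext => x; exact: ImB.
rewrite (_ : (fourier_L1 f - fourier_L1 g) w = fourier_L1 f w - fourier_L1 g w)//.
apply: eq_complex_val.
  rewrite ReB !Re_fourier_L1// rE iE cos_transformB// sin_transformB//; ring.
by rewrite ImB !Im_fourier_L1// rE iE cos_transformB// sin_transformB//; ring.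
Qed.

Lemma eq_fourier_L1 f g : cmeasurable_fun f -> cmeasurable_fun g ->
  f = g %[ae leb] -> absolutely_integrable leb f -> fourier_L1 f = fourier_L1 g.
Proof.
move=> mf mg fg fi; apply/funext => w.
have gi := absolutely_integrable_ae mf mg fg fi.
have eq_part (a b : R -> R) (c : R -> R) : continuous c -> intgr a -> intgr b ->
    (a : RR -> R) = b %[ae leb] ->
    \int[leb]_x (a x * c x) = \int[leb]_x (b x * c x).
  move=> cc ai bi ab; congr fine; apply: ae_eq_integral => //.
  - apply/measurable_EFinP; apply: measurable_funM; first exact: intgr_meas.
    exact: (continuous_measurable_fun cc).
  - apply/measurable_EFinP; apply: measurable_funM; first exact: intgr_meas.
    exact: (continuous_measurable_fun cc).
  - by apply: filterS ab => x /= /[apply] ->.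
have fgr : ((fun x => complex.Re (f x)) : RR -> R) = (fun x => complex.Re (g x)) %[ae leb].
  by apply: filterS fg => x /(_ I) -> _.
have fgi : ((fun x => complex.Im (f x)) : RR -> R) = (fun x => complex.Im (g x)) %[ae leb].
  by apply: filterS fg => x /(_ I) -> _.
have fr := absolutely_integrable_Re mf fi; have fim := absolutely_integrable_Im mf fi.
have gr := absolutely_integrable_Re mg gi; have gim := absolutely_integrable_Im mg gi.
have cE := eq_part _ _ (fun x => cos (2 * pi * w * x)) (@continuous_cosM _ _).
have sE := eq_part _ _ (fun x => sin (2 * pi * w * x)) (@continuous_sinM _ _).
apply: eq_complex_val.
  by rewrite !Re_fourier_L1// /cos_transform /sin_transform (cE _ _ fr gr fgr) (sE _ _ fim gim fgi).
by rewrite !Im_fourier_L1// /cos_transform /sin_transform (cE _ _ fim gim fgi) (sE _ _ fr gr fgr).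
Qed.

Definition fourier_L12 u : L2 leb := L2_class leb (fourier_L1 u).

Lemma fourier_L12E u : absolutely_integrable leb u ->
  L2_fun (fourier_L12 u) = fourier_L1 u %[ae leb].
Proof.
move=> ui; have mu := L2_fun_cmeasurable u; apply: L2_classE.
  exact: cmeasurable_fourier_L1.
by rewrite energy_fourier_L1// L2_energy_lty.
Qed.

Lemma fourier_L12_isometry u v : absolutely_integrable leb u -> absolutely_integrable leb v ->
  `|fourier_L12 u - fourier_L12 v| = `|u - v|.
Proof.
move=> ui vi; have mu := L2_fun_cmeasurable u; have mv := L2_fun_cmeasurable v.
have uvi := absolutely_integrableB mu mv ui vi; have muv := cmeasurable_funB mu mv.
have mfu := cmeasurable_fourier_L1 mu ui; have mfv := cmeasurable_fourier_L1 mv vi.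
have uvoo : (energy leb setT (L2_fun u \- L2_fun v)%R < +oo)%E.
  by rewrite -(L2_normB_energy u v) ltry.
apply: L2_norm_eq; rewrite !L2_normB_energy.
rewrite -(energy_fourier_L1 muv uvi uvoo) fourier_L1B//.
apply: ae_eq_energy => //.
- by apply: cmeasurable_funB; exact: L2_fun_cmeasurable.
- exact: cmeasurable_funB.
- apply: filterS2 (fourier_L12E ui) (fourier_L12E vi) => x /(_ I) e1 /(_ I) e2 _.
  by rewrite !fctE /= e1 e2.
Qed.

(** On A, |f| <= 1 + |f|^2, and the right-hand side is integrable there. *)
Lemma absolutely_integrable_cutoff (A : set RR) f : measurable A -> (leb A < +oo)%E ->
  cmeasurable_fun f -> (energy leb setT f < +oo)%E ->
  absolutely_integrable leb (cutoff A f).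
Proof.
move=> mA Aoo mf foo.
have ei : intgr (fun x => modc (f x) ^+ 2).
  apply: intgr_ge0 => //; last by move=> x; exact: sqr_ge0.
  by apply: measurable_funX; exact: measurable_modc.
have ai : intgr (\1_A : RR -> R).
  apply: intgr_ge0; [exact: measurable_indic|by move=> x; rewrite indicE|].
  by rewrite integral_indic// setIT.
apply: (intgr_dom (k := 1) (g := fun x => \1_A x + modc (f x) ^+ 2)).
- by apply: measurable_modc; exact: cmeasurable_cutoff.
- move=> x; rewrite mul1r !ger0_norm ?modc_ge0 ?addr_ge0 ?sqr_ge0//.
  rewrite /cutoff indicE; case: (x \in A); last first.
    by rewrite ComplexField.Normc.normc0 mulr0n add0r sqr_ge0.
  rewrite mulr1n.
  have := modc_ge0 (f x); move: (modc (f x)) => m m0.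
  rewrite -subr_ge0; have := sqr_ge0 (m - 1/2); lra.
- exact: intgrD.
Qed.

Definition window n : set RR := `[(- n%:R)%R, n%:R%R]%classic.

Lemma measurable_window n : measurable (window n).
Proof. exact: measurable_itv. Qed.

Lemma window_lty n : (leb (window n) < +oo)%E.
Proof.
have := @lebesgue_measure_itv R `[(- n%:R), n%:R]; rewrite /= => ->.
by case: ifP => // _; rewrite -EFinB ltry.
Qed.

Lemma notin_windowC x : \forall n \near \oo, ~ (~` window n) x.
Proof.
exists (Num.bound `|x|) => // n /= xn; apply.
rewrite /window /= in_itv /= -ler_norml ltW//.
by rewrite (lt_le_trans (archi_boundP (normr_ge0 _)))// ler_nat.
Qed.

Definition truncate n u : L2 leb := L2_class leb (cutoff (window n) u).

Let trunc_lty n u : (energy leb setT (cutoff (window n) u) < +oo)%E.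
Proof.
apply: le_lt_trans (L2_energy_lty u); apply: energy_cutoff_le.
  exact: measurable_window.
exact: L2_fun_cmeasurable.
Qed.

Lemma truncateE n u : L2_fun (truncate n u) = cutoff (window n) u %[ae leb].
Proof.
apply: L2_classE => //; apply: cmeasurable_cutoff; first exact: measurable_window.
exact: L2_fun_cmeasurable.
Qed.

Lemma absolutely_integrable_truncate n u : absolutely_integrable leb (truncate n u).
Proof.
have mw := measurable_window n.
apply: (@absolutely_integrable_ae (cutoff (window n) u)).
- by apply: cmeasurable_cutoff => //; exact: L2_fun_cmeasurable.
- exact: L2_fun_cmeasurable.
- by apply: filterS (truncateE n u) => x /[apply].
- apply: absolutely_integrable_cutoff => //; first exact: window_lty.
    exact: L2_fun_cmeasurable.
  exact: L2_energy_lty.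
Qed.

Lemma L2_cvg_energy (v_ : nat -> L2 leb) v :
  energy leb setT (v \- v_ n) @[n --> \oo] --> 0%E -> v_ @ \oo --> v.
Proof.
move=> /ge0_cvge0P vv; apply/cvgrPdist_le => e e0.
have := vv (fun n => energy_ge0 _ _ _) _ (exprn_gt0 2 e0).
apply: filterS => n; rewrite -L2_normB_energy lee_fin.
by rewrite ler_pXn2r// ?nnegrE ?(normr_ge0 (v - v_ n)) ?ltW.
Qed.

Lemma truncate_cvg u : truncate ^~ u @ \oo --> u.
Proof.
apply: L2_cvg_energy.
rewrite (_ : (fun n => _) = (fun n => energy leb (~` window n) u)); last first.
  apply/funext => n; have mw := measurable_window n.
  have mu := L2_fun_cmeasurable u.
  rewrite -energy_cutoffC//; apply: ae_eq_energy => //.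
  - by apply: cmeasurable_funB => //; exact: L2_fun_cmeasurable.
  - by apply: cmeasurable_funB => //; exact: cmeasurable_cutoff.
  - by apply: filterS (truncateE n u) => x /(_ I) e1 _; rewrite !fctE /= e1.
apply: energy_tail_cvg0.
- by move=> n; apply: measurableC; exact: measurable_window.
- exact: L2_fun_cmeasurable.
- exact: L2_energy_lty.
- exact: notin_windowC.
Qed.

(** Truncations are absolutely integrable and converge in norm, so the
    isometry on them passes to the limit. *)
Lemma isometry_of_truncate (F : L2 leb -> L2 leb) :
  (forall u, fourier_L12 (truncate n u) @[n --> \oo] --> F u) ->
  forall u v, `|F u - F v| = `|u - v|.
Proof.
move=> cF u v.
have c1 : `|fourier_L12 (truncate n u) - fourier_L12 (truncate n v)| @[n --> \oo] --> `|F u - F v|.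
  by apply: cvg_norm; apply: cvgB; exact: cF.
have c2 : `|truncate n u - truncate n v| @[n --> \oo] --> `|u - v|.
  by apply: cvg_norm; apply: cvgB; exact: truncate_cvg.
apply: (cvg_unique _ c1) => //.
apply: cvg_trans c2; apply: near_eq_cvg; apply: nearW => n.
by rewrite fourier_L12_isometry//; exact: absolutely_integrable_truncate.
Qed.

(** Plancherel's theorem: the Fourier integrals of the truncations form a
    Cauchy sequence because of the isometry, and their limit is the value of
    the extension. *)
Lemma fourier_exists : exists F : L2 leb -> L2 leb, continuous F /\
  forall g : L2 leb, absolutely_integrable leb g ->
      L2_fun (F g) = fourier_L1 g %[ae leb].
Proof.
have lim u : exists l : L2 leb, fourier_L12 (truncate n u) @[n --> \oo] --> l.
  apply: (@L2_cauchy_cvg _ _ _ leb (fourier_L12 (truncate n u) @[n --> \oo])) => e e0.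
  have e20 : 0 < e / 2 by rewrite divr_gt0.
  have /cvgrPdist_lt /(_ _ e20) [N _ HN] := @truncate_cvg u.
  exists (fourier_L12 (truncate N u)); exists N => // n /= Nn.
  rewrite fourier_L12_isometry; try exact: absolutely_integrable_truncate.
  rewrite -(subrKA u) (le_lt_trans (ler_normD _ _))// [ltRHS]splitr ltrD//.
    by rewrite distrC; exact: (HN N (leqnn N)).
  exact: (HN n Nn).
pose F u := projT1 (cid (lim u)).
have cF u : fourier_L12 (truncate n u) @[n --> \oo] --> F u := projT2 (cid (lim u)).
exists F; split.
  move=> u; apply/(@cvgrPdist_lt _ _ _ (nbhs u) (nbhs_filter u)) => e e0.
  apply/nbhs_ballP; exists e => //= v; rewrite -ball_normE /=.
  by rewrite (isometry_of_truncate cF).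
move=> g gi.
have FE : F g = fourier_L12 g.
  apply: (cvg_unique _ (cF g)) => //.
  apply/cvgrPdist_lt => e e0.
  have /cvgrPdist_lt /(_ _ e0) := @truncate_cvg g.
  apply: filterS => n; rewrite fourier_L12_isometry//.
  exact: absolutely_integrable_truncate.
by rewrite FE; exact: fourier_L12E.
Qed.

Lemma fourier_spec : continuous (@fourier R) /\
  forall g : L2 leb, absolutely_integrable leb g ->
      L2_fun (fourier g) = fourier_L1 g %[ae leb].
Proof.
have [F FP] := fourier_exists.
exact: (@getPex _ [set F : L2 leb -> L2 leb | continuous F /\
  forall g : L2 leb, absolutely_integrable leb g ->
    L2_fun (F g) = fourier_L1 g %[ae leb]] (ex_intro _ F FP)).
Qed.

(** Continuity forces any map with the defining property to be the limit along
    truncations. *)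
Lemma fourier_isometry u v : `|fourier u - fourier v| = `|u - v|.
Proof.
have [cF FE] := fourier_spec.
apply: isometry_of_truncate => {}u.
have -> : (fun n => fourier_L12 (truncate n u)) = (fun n => fourier (truncate n u)).
  apply/funext => n; apply: L2_fun_inj.
  have ti := absolutely_integrable_truncate n u.
  apply: filterS2 (fourier_L12E ti) (FE _ ti) => x /(_ I) e1 /(_ I) e2 _.
  by rewrite e1 e2.
exact: (cvg_comp _ _ (@truncate_cvg u) (cF u)).
Qed.

End fourier_existence.

(** * The Mellin transform as an isometry *)

Section haar_measure.
Context {R : realType}.
Local Notation leb := (@lebesgue_measure R).
Local Notation RR := (measurableTypeR R).

Lemma haar_itv (a b : R) : a < b ->
  haar (`]expR a, expR b]%classic : set RR) = (b - a)%:E.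
Proof.
move=> ab.
rewrite /haar (_ : _ `&` _ = `]expR a, expR b]%classic); last first.
  apply/seteqP; split => x /=; first by case.
  rewrite !in_itv /= andbT => /andP[ax xb]; rewrite ax xb; split => //.
  by apply: lt_trans ax; exact: expR_gt0.
have cinv : {within `[expR a, expR b], continuous (fun r : R => r^-1)}.
  apply: continuous_in_subspaceT => x; rewrite inE /= in_itv /= => /andP[ax _].
  by apply: inv_continuous; rewrite gt_eqF// (lt_le_trans _ ax)// expR_gt0.
rewrite integral_itv_obnd_cbnd; last first.
  apply/measurable_EFinP; apply: measurable_funS (subspace_continuous_measurable_fun _ cinv) => //.
  exact: subset_itv_oc_cc.
rewrite (@continuous_FTC2 _ _ (@ln R)) ?ltr_expR//.
- by rewrite !expRK EFinB.
- split.
  + move=> x; rewrite in_itv /= => /andP[ax _].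
    by have [] := is_derive1_ln (lt_trans (expR_gt0 a) ax).
  + by apply: cvg_at_right_filter; apply: continuous_ln; exact: expR_gt0.
  + by apply: cvg_at_left_filter; apply: continuous_ln; exact: expR_gt0.
- move=> x; rewrite in_itv /= => /andP[ax _].
  by rewrite derive1E; have [_ ->] := is_derive1_ln (lt_trans (expR_gt0 a) ax).
Qed.

Lemma haar_nonpos : haar (`]-oo, 0%R]%classic : set RR) = 0%E.
Proof.
rewrite /haar (_ : _ `&` _ = set0) ?integral_set0//.
by apply/seteqP; split => x //= []; rewrite !in_itv /= andbT => x0 /(le_lt_trans x0); rewrite ltxx.
Qed.

Let measurable_lnT : measurable_fun setT (@ln R : RR -> RR).
Proof. exact: measurable_ln. Qed.

Lemma haar_pos (A : set RR) : haar (A `&` `]0%R, +oo[%classic) = haar A.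
Proof. by rewrite /haar -setIA setIid. Qed.

(** The comparison is made on the line because uniqueness of measures is
    tested on bounded intervals: their images under the exponential have
    finite Haar measure, while bounded intervals of the half line may not. *)
Lemma pushforward_haar_ln (A : set RR) : measurable A ->
  leb A = pushforward (@haar R) (@ln R : RR -> RR) A.
Proof.
move=> mA; apply: lebesgue_measure_unique => // _ [[a b] _ <-] /=.
rewrite lebesgue_measure_itv /= lte_fin /pushforward -haar_pos.
case: ltP => [ab|ba].
  rewrite -EFinB -(haar_itv ab); congr (haar _).
  apply/seteqP; split => x /=; rewrite !in_itv /= ?andbT.
    move=> /andP[ax xb]; have x0 := lt_trans (expR_gt0 a) ax.
    split; last exact: x0.
    by rewrite -ltr_expR -[ln x <= b]ler_expR lnK ?posrE// ax xb.
  by move=> [/andP[ax xb] x0]; rewrite -(lnK x0) ltr_expR ler_expR ax xb.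
rewrite (_ : _ `&` _ = set0) ?measure0//.
apply/seteqP; split => x //= []; rewrite in_itv /= => /andP[ax xb].
by have := le_lt_trans ba (lt_le_trans ax xb); rewrite ltxx.
Qed.

(** Transport along the logarithm, which inverts the exponential off a Haar
    null set. *)
Lemma ge0_integral_haar (phi : RR -> \bar R) : measurable_fun setT phi ->
  (forall r, (0 <= phi r)%E) ->
  (\int[@haar R]_r phi r = \int[leb]_x phi (expR x))%E.
Proof.
move=> mphi phi0.
have mexp : measurable_fun setT (@expR R : RR -> RR).
  by apply: continuous_measurable_fun; exact: continuous_expR.
have mpe : measurable_fun setT (fun x : RR => phi (expR x)).
  exact: (measurableT_comp mphi mexp).
transitivity (\int[@haar R]_r phi (expR (ln r)))%E.
  apply: ae_eq_integral => //.
    exact: (measurableT_comp mpe measurable_lnT).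
  exists `]-oo, 0%R]%classic; split; [exact: measurable_itv|exact: haar_nonpos|].
  move=> x /= nx; rewrite in_itv /=; case: (leP x 0) => // x0.
  by exfalso; apply: nx => _; rewrite lnK.
transitivity (\int[pushforward (@haar R) (@ln R : RR -> RR)]_x phi (expR x))%E.
  by rewrite ge0_integral_pushforward.
apply: eq_measure_integral => A mA _; exact: (esym (pushforward_haar_ln mA)).
Qed.

Definition expR_pull (f : RR -> R[i]) (x : RR) : R[i] := f (expR x).

Lemma cmeasurable_expR_pull f : cmeasurable_fun f -> cmeasurable_fun (expR_pull f).
Proof.
have mexp : measurable_fun setT (@expR R : RR -> RR).
  by apply: continuous_measurable_fun; exact: continuous_expR.
by move=> [mr mi]; split; [exact: (measurableT_comp mr mexp)|exact: (measurableT_comp mi mexp)].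
Qed.

Lemma energy_haar (D : set RR) f : measurable D -> cmeasurable_fun f ->
  energy (@haar R) D f = energy leb (expR @^-1` D) (expR_pull f).
Proof.
move=> mD mf; rewrite /energy integral_mkcond [RHS]integral_mkcond.
rewrite ge0_integral_haar.
- by apply: eq_integral => x _; rewrite !patchE.
- by apply: (measurable_restrictT _ mD).1; exact: measurable_modc_sqr.
- by move=> r; rewrite patchE; case: (r \in D); rewrite ?lee_fin ?sqr_ge0.
Qed.

Lemma mellin_isometry (f g : L2 (@haar R)) : `|mellin f - mellin g| = `|f - g|.
Proof.
have mf := L2_fun_cmeasurable f; have mg := L2_fun_cmeasurable g.
have cf := cmeasurable_expR_pull mf; have cg := cmeasurable_expR_pull mg.
have foo : (energy leb setT (expR_pull f) < +oo)%E.
  by rewrite -[setT](preimage_setT expR) -energy_haar// L2_energy_lty.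
have goo : (energy leb setT (expR_pull g) < +oo)%E.
  by rewrite -[setT](preimage_setT expR) -energy_haar// L2_energy_lty.
rewrite /mellin fourier_isometry; apply: L2_norm_eq; rewrite !L2_normB_energy.
rewrite energy_haar//; last exact: cmeasurable_funB.
rewrite preimage_setT; apply: ae_eq_energy => //.
- by apply: cmeasurable_funB; exact: L2_fun_cmeasurable.
- by apply: cmeasurable_expR_pull; exact: cmeasurable_funB.
- apply: filterS2 (L2_classE cf foo) (L2_classE cg goo) => x /(_ I) e1 /(_ I) e2 _.
  by rewrite /= e1 e2.
Qed.

End haar_measure.

(** * Fourier transforms of functions of bounded support *)

Section fourier_of_bounded_support.
Context {R : realType}.
Local Open Scope complex_scope.
Local Notation leb := (@lebesgue_measure R).
Local Notation RR := (measurableTypeR R).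
Local Notation intgr f := (leb.-integrable setT (EFin \o f)).

Lemma cos_lipschitz (s t : R) : `|cos s - cos t| <= `|s - t|.
Proof.
wlog st : s t / t <= s => [H|].
  have [ts|/ltW ts] := leP t s; first exact: H.
  by rewrite distrC [leRHS]distrC; exact: H.
have [|c _ ->] := @MVT_segment R cos (fun x => - sin x) t s st (fun x _ => is_derive_cos x).
  by apply: continuous_subspaceT; exact: continuous_cos.
by rewrite normrM normrN ler_piMl// sin_norm_le1.
Qed.

Lemma sin_lipschitz (s t : R) : `|sin s - sin t| <= `|s - t|.
Proof.
wlog st : s t / t <= s => [H|].
  have [ts|/ltW ts] := leP t s; first exact: H.
  by rewrite distrC [leRHS]distrC; exact: H.
have [|c _ ->] := @MVT_segment R sin cos t s st (fun x _ => is_derive_sin x).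
  by apply: continuous_subspaceT; exact: continuous_sin.
by rewrite normrM ler_piMl// cos_norm_le1.
Qed.

Section real_transform.
Variables (a c : R -> R) (L B : R).
Hypotheses (ai : intgr a) (aL : forall x, L < `|x| -> a x = 0).
Hypothesis aB : \int[leb]_x `|a x| <= B.
Hypotheses (cc : continuous c) (c1 : forall x, `|c x| <= 1).
Hypothesis clip : forall s t, `|c s - c t| <= `|s - t|.

Let tri w : intgr (fun x => a x * c (2 * pi * w * x)).
Proof.
apply: (intgr_mulr_bounded (k := 1) ai); last by move=> x; exact: c1.
apply: continuous_measurable_fun => x; apply: continuous_comp; last exact: cc.
by apply: cvgM; [exact: cvg_cst|exact: cvg_id].
Qed.

Lemma transform_bound w : `|\int[leb]_x (a x * c (2 * pi * w * x))| <= B.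
Proof.
apply: le_trans aB; apply: le_trans (le_normr_Rintegral measurableT (tri w)) _.
apply: (le_Rintegral measurableT (intgr_norm (tri w)) (intgr_norm ai)) => x _.
by rewrite normrM ler_piMr.
Qed.

(** On the support of a the phase 2 pi w x varies with w at a rate of at most
    2 pi L. *)
Lemma transform_lipschitz w w' : 0 <= L ->
  `|\int[leb]_x (a x * c (2 * pi * w * x)) - \int[leb]_x (a x * c (2 * pi * w' * x))|
  <= 2 * pi * L * B * `|w - w'|.
Proof.
move=> L0; rewrite -(RintegralB measurableT (tri w) (tri w')).
have di := intgrB (tri w) (tri w').
apply: le_trans (le_normr_Rintegral measurableT di) _.
pose k := 2 * pi * L * `|w - w'|.
have k0 : 0 <= k by rewrite /k !mulr_ge0// pi_ge0.
apply: (@le_trans _ _ (\int[leb]_x (k * `|a x|))).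
  apply: (le_Rintegral measurableT (intgr_norm di) (intgrZl _ (intgr_norm ai))) => x _.
  rewrite -mulrBr normrM mulrC.
  have [xL|xL] := leP `|x| L; last by rewrite aL// normr0 !mulr0.
  rewrite ler_wpM2r//; apply: le_trans (clip _ _) _.
  rewrite -mulrBl -mulrBr !normrM (ger0_norm (pi_ge0 R)) ger0_norm//.
  by rewrite /k -mulrA -[leRHS]mulrA ler_wpM2l ?mulr_ge0 ?pi_ge0// mulrC ler_wpM2r.
rewrite (RintegralZl _ measurableT (intgr_norm ai)) /k.
rewrite (_ : 2 * pi * L * B * `|w - w'| = 2 * pi * L * `|w - w'| * B); last by ring.
by rewrite ler_wpM2l.
Qed.

End real_transform.

Section complex_transform.
Variables (f : RR -> R[i]) (L B : R).
Hypotheses (mf : cmeasurable_fun f) (fi : absolutely_integrable leb f).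
Hypotheses (fL : forall x, L < `|x| -> f x = 0) (L0 : 0 <= L).
Hypothesis fB : \int[leb]_x modc (f x) <= B.

Let ar := absolutely_integrable_Re mf fi.
Let ai := absolutely_integrable_Im mf fi.

Let rL x : L < `|x| -> complex.Re (f x) = 0. Proof. by move=> /fL ->. Qed.
Let iL x : L < `|x| -> complex.Im (f x) = 0. Proof. by move=> /fL ->. Qed.

Let rB : \int[leb]_x `|complex.Re (f x)| <= B.
Proof.
apply: le_trans fB; apply: (le_Rintegral measurableT (intgr_norm ar) fi) => x _.
exact: le_Re_modc.
Qed.

Let iB : \int[leb]_x `|complex.Im (f x)| <= B.
Proof.
apply: le_trans fB; apply: (le_Rintegral measurableT (intgr_norm ai) fi) => x _.
exact: le_Im_modc.
Qed.

Let ccos := @continuous_cos R.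
Let csin := @continuous_sin R.

Lemma Re_fourier_bound w : `|complex.Re (fourier_L1 f w)| <= 2 * B.
Proof.
rewrite (Re_fourier_L1 mf fi) mulr_natl mulr2n; apply: le_trans (ler_normD _ _) _.
by apply: lerD; [exact: (transform_bound ar rB ccos (@cos_norm_le1 _))|
                 exact: (transform_bound ai iB csin (@sin_norm_le1 _))].
Qed.

Lemma Im_fourier_bound w : `|complex.Im (fourier_L1 f w)| <= 2 * B.
Proof.
rewrite (Im_fourier_L1 mf fi) mulr_natl mulr2n; apply: le_trans (ler_normB _ _) _.
by apply: lerD; [exact: (transform_bound ai iB ccos (@cos_norm_le1 _))|
                 exact: (transform_bound ar rB csin (@sin_norm_le1 _))].
Qed.

Lemma Re_fourier_lipschitz w w' :
  `|complex.Re (fourier_L1 f w) - complex.Re (fourier_L1 f w')| <= 4 * pi * L * B * `|w - w'|.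
Proof.
rewrite !(Re_fourier_L1 mf fi) opprD addrACA.
rewrite (_ : 4 * _ * _ * _ * _ = 2 * pi * L * B * `|w - w'| + 2 * pi * L * B * `|w - w'|); last by ring.
apply: le_trans (ler_normD _ _) _; apply: lerD.
  exact: (transform_lipschitz ar rL rB ccos (@cos_norm_le1 _) cos_lipschitz).
exact: (transform_lipschitz ai iL iB csin (@sin_norm_le1 _) sin_lipschitz).
Qed.

Lemma Im_fourier_lipschitz w w' :
  `|complex.Im (fourier_L1 f w) - complex.Im (fourier_L1 f w')| <= 4 * pi * L * B * `|w - w'|.
Proof.
have swap (p q r s : R) : p - q - (r - s) = (p - r) - (q - s) by ring.
rewrite !(Im_fourier_L1 mf fi) swap.
rewrite (_ : 4 * _ * _ * _ * _ = 2 * pi * L * B * `|w - w'| + 2 * pi * L * B * `|w - w'|); last by ring.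
apply: le_trans (ler_normB _ _) _; apply: lerD.
  exact: (transform_lipschitz ai iL iB ccos (@cos_norm_le1 _) cos_lipschitz).
exact: (transform_lipschitz ar rL rB csin (@sin_norm_le1 _) sin_lipschitz).
Qed.

End complex_transform.
End fourier_of_bounded_support.

(** * Tails, and their uniform decay on precompact sets *)

Section tails.
Context {R : realType}.
Local Open Scope complex_scope.
Local Notation leb := (@lebesgue_measure R).
Local Notation RR := (measurableTypeR R).
Local Notation intgr f := (leb.-integrable setT (EFin \o f)).
Implicit Types (f g : L2 (@haar R)) (xi eta e : R).

Lemma mul2_le (x : \bar R) (a : R) : (x <= a%:E)%E -> (2%:E * x <= (2 * a)%:E)%E.
Proof. by move=> xa; rewrite EFinM; apply: lee_wpmul2l => //; rewrite lee_fin. Qed.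

Definition haar_tail xi : set RR := `]0, +oo[%classic `\` `[xi^-1, xi]%classic.
Definition leb_tail xi : set RR := ~` `[- xi, xi]%classic.

Lemma measurable_haar_tail xi : measurable (haar_tail xi).
Proof. by apply: measurableD; exact: measurable_itv. Qed.

Lemma measurable_leb_tail xi : measurable (leb_tail xi).
Proof. by apply: measurableC; exact: measurable_itv. Qed.

Definition tail f xi : \bar R :=
  (energy (@haar R) (haar_tail xi) f + energy leb (leb_tail xi) (mellin f))%E.

Lemma L2_energy_quasi d (T : measurableType d) (mu : {measure set T -> \bar R})
    (D : set T) (u v : L2 mu) : measurable D ->
  (energy mu D u <= 2%:E * energy mu D v + 2%:E * (`|u - v| ^+ 2)%:E)%E.
Proof.
move=> mD; have mcu := L2_fun_cmeasurable u; have mcv := L2_fun_cmeasurable v.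
have mcd := cmeasurable_funB mcu mcv.
rewrite {1}(_ : L2_fun u = L2_fun v + (L2_fun u - L2_fun v)); last first.
  by rewrite addrC subrK.
apply: le_trans (energyD mu mD mcv mcd) _; apply: leeD; first exact: lexx.
rewrite L2_normB_energy; apply: lee_wpmul2l; first by rewrite lee_fin.
by apply: le_energy_subset => //; exact: measurableT.
Qed.

(** Both terms of the tail are squared seminorms, bounded by the norm since
    the Mellin transform is an isometry. *)
Lemma tail_quasi f g xi :
  (tail f xi <= 2%:E * tail g xi + (4 * `|f - g| ^+ 2)%:E)%E.
Proof.
have H1 := L2_energy_quasi f g (measurable_haar_tail xi).
have H2 := L2_energy_quasi (mellin f) (mellin g) (measurable_leb_tail xi).
rewrite mellin_isometry in H2.
apply: le_trans (leeD H1 H2) _.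
rewrite addeACA -ge0_muleDr ?energy_ge0//; apply: leeD; first exact: lexx.
rewrite -!EFinM -EFinD lee_fin; move: (`|f - g| ^+ 2) => x.
by rewrite -mulrDl (_ : 2 + 2 = 4)//; ring.
Qed.

Lemma le_tail f xi xi' : 0 < xi -> xi <= xi' -> (tail f xi' <= tail f xi)%E.
Proof.
move=> x0 xx'; have x'0 := lt_le_trans x0 xx'.
apply: leeD; apply: le_energy_subset.
- exact: measurable_haar_tail.
- exact: measurable_haar_tail.
- exact: L2_fun_cmeasurable.
- move=> x [x00 nx]; split=> // xin; apply: nx; move: xin; rewrite /= !in_itv /=.
  move=> /andP[h1 h2]; rewrite (le_trans h2 xx') andbT (le_trans _ h1)//.
  by rewrite lef_pV2 ?posrE.
- exact: measurable_leb_tail.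
- exact: measurable_leb_tail.
- exact: L2_fun_cmeasurable.
- move=> x nx xin; apply: nx; move: xin; rewrite /= !in_itv /=.
  by move=> /andP[h1 h2]; rewrite (le_trans h2 xx') andbT (le_trans _ h1)// lerN2.
Qed.

Lemma tail_cvg0 f e : 0 < e -> \forall xi \near +oo, (tail f xi <= e%:E)%E.
Proof.
move=> e0; have e20 : 0 < e / 2 by rewrite divr_gt0.
have c1 : energy (@haar R) (haar_tail n.+1%:R) f @[n --> \oo] --> 0%E.
  apply: energy_tail_cvg0.
  - by move=> n; exact: measurable_haar_tail.
  - exact: L2_fun_cmeasurable.
  - exact: L2_energy_lty.
  - move=> x; exists (maxn (Num.bound `|x|) (Num.bound `|x^-1|)) => // n /= nm [].
    rewrite /= in_itv /= andbT => x0; apply; rewrite in_itv /=.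
    have b1 : x <= n.+1%:R.
      rewrite (le_trans (ler_norm _))// ltW// (lt_le_trans (archi_boundP (normr_ge0 _)))//.
      by rewrite ler_nat; exact: (leq_trans (leq_maxl _ _) (leq_trans nm (leqnSn n))).
    have b2 : x^-1 <= n.+1%:R.
      rewrite (le_trans (ler_norm _))// ltW// (lt_le_trans (archi_boundP (normr_ge0 _)))//.
      by rewrite ler_nat; exact: (leq_trans (leq_maxr _ _) (leq_trans nm (leqnSn n))).
    by rewrite b1 andbT -[x]invrK lef_pV2 ?posrE ?invr_gt0.
have c2 : energy leb (leb_tail n.+1%:R) (mellin f) @[n --> \oo] --> 0%E.
  apply: energy_tail_cvg0.
  - by move=> n; exact: measurable_leb_tail.
  - exact: L2_fun_cmeasurable.
  - exact: L2_energy_lty.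
  - move=> x; exists (Num.bound `|x|) => // n /= nm; apply; rewrite /= in_itv /= -ler_norml.
    rewrite ltW// (lt_le_trans (archi_boundP (normr_ge0 _)))// ler_nat.
    exact: (leq_trans nm (leqnSn n)).
have [N1 _ H1] := (ge0_cvge0P _ (fun n => energy_ge0 _ _ _)).1 c1 _ e20.
have [N2 _ H2] := (ge0_cvge0P _ (fun n => energy_ge0 _ _ _)).1 c2 _ e20.
pose N := maxn N1 N2.
have tN : (tail f N.+1%:R <= e%:E)%E.
  rewrite [e]splitr EFinD; apply: leeD; first by apply: H1; exact: leq_maxl.
  by apply: H2; exact: leq_maxr.
exists N.+1%:R; split; first exact: num_real.
move=> xi /ltW xiN; apply: le_trans (le_tail f _ xiN) tN.
by rewrite ltr0n.
Qed.

(** The tail of a single f tends to 0, and by [tail_quasi] a bound for f0 at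
    xi holds, with a worse constant, for all f near f0 and all larger xi.
    Compactness makes the choice of xi uniform. *)
Lemma precompact_uniform_tail (K : set (L2 (@haar R))) e : 0 < e -> precompact K ->
  \forall xi \near +oo, forall f, K f -> (tail f xi <= e%:E)%E.
Proof.
move=> e0; rewrite precompactE => /compact_near_coveringP cK.
have := cK R (pinfty_nbhs R) (fun xi f => (tail f xi <= e%:E)%E) _.
move=> /(_ _) [].
  move=> f0 _.
  have e40 : 0 < e / 4 by rewrite divr_gt0.
  have := tail_cvg0 f0 e40 => tf0.
  (* With |f - f0|^2 <= e / 8 and tail f0 <= e / 4, the bound is 2 (e / 4) +
     4 (e / 8) = e. *)
  pose r := Num.sqrt (e / 8).
  have r0 : 0 < r by rewrite sqrtr_gt0 divr_gt0.
  exists (ball f0 r, [set xi | (tail f0 xi <= (e / 4)%:E)%E]); first split => //=.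
    exact: nbhsx_ballx.
  move=> [f xi] /= [fr txi]; apply: le_trans (tail_quasi f f0 xi) _.
  apply: (@le_trans _ _ ((2 * (e / 4))%:E + (e / 2)%:E)%E); last first.
    by rewrite -EFinD lee_fin; lra.
  apply: leeD; first exact: mul2_le.
  have : `|f0 - f| <= r by move: fr; rewrite -ball_normE => /ltW.
  rewrite distrC -(@ler_pXn2r _ 2) ?nnegrE ?(normr_ge0 (f - f0)) ?(ltW r0)//.
  rewrite sqr_sqrtr ?divr_ge0 ?(ltW e0)// lee_fin.
  move: (`|f - f0| ^+ 2) => x; lra.
move=> M [Mr HM]; exists M; split => // xi /HM sub f Kf; apply: sub.
exact: subset_closure.
Qed.

End tails.

(** * Mellin transforms of windowed functions *)

Section compactness.
Context {R : realType}.
Local Open Scope complex_scope.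
Local Notation leb := (@lebesgue_measure R).
Local Notation RR := (measurableTypeR R).
Local Notation intgr f := (leb.-integrable setT (EFin \o f)).
Implicit Types (f g : L2 (@haar R)) (xi eta e : R).

Lemma closure_approx (K : set (L2 (@haar R))) f e : 0 < e -> closure K f ->
  exists2 g, K g & `|f - g| < e.
Proof.
move=> e0 Kf; have [g [Kg]] := Kf _ (nbhsx_ballx f e e0).
by rewrite -ball_normE => fg; exists g.
Qed.

Lemma closure_tail (K : set (L2 (@haar R))) eta xi : 0 < eta ->
  (forall f, K f -> (tail f xi <= (eta / 4)%:E)%E) ->
  forall f, closure K f -> (tail f xi <= eta%:E)%E.
Proof.
move=> eta0 Kt f Kf.
have r0 : 0 < Num.sqrt (eta / 8) by rewrite sqrtr_gt0 divr_gt0.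
have [g Kg /ltW fg] := closure_approx r0 Kf.
apply: le_trans (tail_quasi f g xi) _.
apply: (@le_trans _ _ ((2 * (eta / 4))%:E + (eta / 2)%:E)%E); last first.
  by rewrite -EFinD lee_fin; lra.
apply: leeD; first by apply: mul2_le; exact: Kt.
move: fg; rewrite -(@ler_pXn2r _ 2) ?nnegrE ?(normr_ge0 (f - g)) ?(ltW r0)//.
rewrite sqr_sqrtr ?divr_ge0 ?(ltW eta0)// lee_fin.
move: (`|f - g| ^+ 2) => x; lra.
Qed.

Lemma ultra_bounded_cvg (T : Type) (U : set_system T) (h : T -> R) (C : R) :
  UltraFilter U -> (\forall x \near U, `|h x| <= C) ->
  exists l : R, forall dl, 0 < dl -> \forall x \near U, `|h x - l| < dl.
Proof.
move=> UU hC; have FU : ProperFilter U by exact: ultra_proper.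
have hU : (h @ U) `[- C, C]%classic.
  by apply: filterS hC => x /=; rewrite in_itv /= ler_norml.
have [l [_ cl]] := @segment_compact R (- C) C (h @ U) (fmap_proper_filter h FU) hU.
exists l => dl dl0.
have [//|nU] := in_ultra_setVsetC [set x | `|h x - l| < dl] UU.
have nU' : (h @ U) [set y | dl <= `|y - l|].
  have sub : ~` [set x | `|h x - l| < dl] `<=` h @^-1` [set y | dl <= `|y - l|].
    by move=> x nx; rewrite /= leNgt; apply/negP; exact: nx.
  exact: (filterS sub nU).
have [y [/= ny]] := cl _ _ nU' (nbhsx_ballx l dl dl0).
by rewrite -ball_normE /= distrC => /lt_le_trans /(_ ny); rewrite ltxx.
Qed.

Section windowed_transform.
Variable L : R.
Hypothesis L0 : 0 <= L.
Let W : set RR := `[- L, L]%classic.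
Let mW : measurable W. Proof. exact: measurable_itv. Qed.

Let leb_W : leb W = (2 * L)%:E.
Proof.
have := @lebesgue_measure_itv R `[- L, L]; rewrite /= => ->.
rewrite lte_fin; case: ltP => [_|LL]; first by rewrite -EFinB; congr EFin; ring.
have {}LL : L + L <= 0 by rewrite -[leRHS](subrr L) lerD2l.
by congr EFin; apply/eqP; rewrite mulr_natl mulr2n eq_le LL addr_ge0.
Qed.

(** In logarithmic coordinates, f restricted to [exp (- L), exp L]. *)
Definition windowed f : RR -> R[i] := cutoff W (expR_pull f).

Lemma cmeasurable_windowed f : cmeasurable_fun (windowed f).
Proof.
apply: cmeasurable_cutoff mW _; apply: cmeasurable_expR_pull.
exact: L2_fun_cmeasurable.
Qed.

Lemma energy_pull f : energy leb setT (expR_pull f) = (`|f| ^+ 2)%:E.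
Proof.
rewrite L2_norm_energy energy_haar ?preimage_setT//.
exact: L2_fun_cmeasurable.
Qed.

Lemma windowed_lty f : (energy leb setT (windowed f) < +oo)%E.
Proof.
apply: (@le_lt_trans _ _ (`|f| ^+ 2)%:E); last exact: ltry.
rewrite -energy_pull; apply: (energy_cutoff_le _ mW).
by apply: cmeasurable_expR_pull; exact: L2_fun_cmeasurable.
Qed.

Lemma absolutely_integrable_windowed f : absolutely_integrable leb (windowed f).
Proof.
apply: absolutely_integrable_cutoff mW _ _ _.
- by rewrite leb_W ltry.
- by apply: cmeasurable_expR_pull; exact: L2_fun_cmeasurable.
- by rewrite energy_pull ltry.
Qed.

Lemma windowed_out f x : L < `|x| -> windowed f x = 0.
Proof.
move=> Lx; rewrite /windowed /cutoff memNset// /W /= in_itv /= -ler_norml.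
by apply/negP; rewrite -ltNge.
Qed.

(** From |z| <= 1 + |z|^2, on a window of length 2 L. *)
Lemma windowed_L1 f : \int[leb]_x modc (windowed f x) <= 2 * L + `|f| ^+ 2.
Proof.
have mp : cmeasurable_fun (expR_pull f).
  by apply: cmeasurable_expR_pull; exact: L2_fun_cmeasurable.
rewrite -lee_fin -(intgr_EFin (absolutely_integrable_windowed f)) EFinD.
have iW : (\int[leb]_x (\1_W x)%:E)%E = (2 * L)%:E.
  by rewrite integral_indic// setIT; exact: leb_W.
have mI : measurable_fun setT (fun x : RR => (\1_W x : R)%:E).
  by apply/measurable_EFinP; exact: measurable_indic.
have I0 (x : RR) : (0 <= (\1_W x : R)%:E)%E by rewrite lee_fin indicE.
have me := measurable_modc_sqr (D := setT) mp.
have e0 (x : RR) : (0 <= (modc (expR_pull f x) ^+ 2)%:E)%E by rewrite lee_fin sqr_ge0.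
rewrite -energy_pull -iW /energy.
rewrite -(ge0_integralD leb measurableT (fun x _ => I0 x) mI (fun x _ => e0 x) me).
have mm : measurable_fun setT (fun x : RR => (modc (windowed f x))%:E).
  by apply/measurable_EFinP/measurable_modc; exact: cmeasurable_windowed.
apply: ge0_le_integral => //.
- by move=> x _; rewrite lee_fin modc_ge0.
- exact: emeasurable_funD.
move=> x _; rewrite -EFinD lee_fin /windowed /cutoff indicE.
case: (x \in W); last by rewrite ComplexField.Normc.normc0 mulr0n add0r sqr_ge0.
rewrite mulr1n; have := modc_ge0 (expR_pull f x).
move: (modc _) => m m0; rewrite -subr_ge0; have := sqr_ge0 (m - 1 / 2); lra.
Qed.

Definition windowed_mellin f : RR -> R[i] := fourier_L1 (windowed f).

Let windowed_class f : L2 leb := L2_class leb (windowed f).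

Let windowed_classE f : L2_fun (windowed_class f) = windowed f %[ae leb].
Proof. exact: (L2_classE (cmeasurable_windowed f) (windowed_lty f)). Qed.

Lemma cmeasurable_windowed_mellin f : cmeasurable_fun (windowed_mellin f).
Proof.
exact: (cmeasurable_fourier_L1 (cmeasurable_windowed f) (absolutely_integrable_windowed f)).
Qed.

Let fourier_windowed f : L2_fun (fourier (windowed_class f)) = windowed_mellin f %[ae leb].
Proof.
have mw := cmeasurable_windowed f; have mc := L2_fun_cmeasurable (windowed_class f).
have cE : (windowed f : RR -> R[i]) = windowed_class f %[ae leb].
  by apply: filterS (windowed_classE f) => x /[apply].
have ci := absolutely_integrable_ae mw mc cE (absolutely_integrable_windowed f).
have := (@fourier_spec R).2 (windowed_class f) ci.
by rewrite -(eq_fourier_L1 mw mc cE (absolutely_integrable_windowed f)).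
Qed.

Lemma mellin_windowed f :
  (`|mellin f - fourier (windowed_class f)| ^+ 2)%:E = energy leb (~` W) (expR_pull f).
Proof.
have mp : cmeasurable_fun (expR_pull f).
  by apply: cmeasurable_expR_pull; exact: L2_fun_cmeasurable.
have poo : (energy leb setT (expR_pull f) < +oo)%E by rewrite energy_pull ltry.
rewrite /mellin fourier_isometry L2_normB_energy -(energy_cutoffC _ mW mp).
apply: ae_eq_energy measurableT _ _ _.
- by apply: cmeasurable_funB; exact: L2_fun_cmeasurable.
- by apply: cmeasurable_funB mp _; exact: cmeasurable_windowed.
- apply: filterS2 (L2_classE mp poo) (windowed_classE f) => x /(_ I) e1 /(_ I) e2 _.
  by rewrite !fctE /= e1 e2.
Qed.

(** The distance is that of the Mellin transforms. Off C it is controlled by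
    their tails. On C each transform is replaced by that of the windowed
    function, which costs by isometry the energy of f outside of the window. *)
Lemma L2_dist_windowed f g (C : set RR) (k : R) :
  measurable C -> (forall w, C w -> modc (windowed_mellin f w - windowed_mellin g w) ^+ 2 <= k) ->
  ((`|f - g| ^+ 2)%:E <= 2%:E * (k%:E * leb C) +
    2%:E * (2%:E * energy leb (~` W) (expR_pull f) + 2%:E * energy leb (~` W) (expR_pull g)) +
    (2%:E * energy leb (~` C) (mellin f) + 2%:E * energy leb (~` C) (mellin g)))%E.
Proof.
move=> mC Ck.
have mCC : measurable (~` C) by exact: measurableC.
set u := mellin f; set v := mellin g.
set p := fourier (windowed_class f); set q := fourier (windowed_class g).
have mu := L2_fun_cmeasurable u; have mv := L2_fun_cmeasurable v.
have mp := L2_fun_cmeasurable p; have mq := L2_fun_cmeasurable q.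
have mup := cmeasurable_funB mu mp; have mvq := cmeasurable_funB mv mq.
have mpq := cmeasurable_funB mp mq.
have muv := cmeasurable_funB mu mv.
have two0 : (0 <= 2%:E :> \bar R)%E by rewrite lee_fin.
rewrite -mellin_isometry -/u -/v L2_normB_energy (energy_setU leb mC muv).
apply: leeD; last exact: energyB.
have -> : (L2_fun u - L2_fun v)%R =
    ((L2_fun p - L2_fun q) + ((L2_fun u - L2_fun p) - (L2_fun v - L2_fun q)))%R.
  by apply/funext => w; rewrite !fctE /=; ring.
apply: le_trans (energyD leb mC mpq (cmeasurable_funB mup mvq)) _.
apply: leeD; apply: lee_wpmul2l => //.
  have -> : energy leb C (L2_fun p - L2_fun q) = energy leb C (windowed_mellin f - windowed_mellin g).
    apply: ae_eq_energy mC mpq _ _.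
      by apply: cmeasurable_funB; exact: cmeasurable_windowed_mellin.
    apply: filterS2 (fourier_windowed f) (fourier_windowed g) => x /(_ I) e1 /(_ I) e2 _.
    by rewrite !fctE /= e1 e2.
  rewrite -(integral_cst leb mC).
  apply: ge0_le_integral => //.
  - by move=> x _; rewrite lee_fin sqr_ge0.
  - apply: measurable_modc_sqr; apply: cmeasurable_funB; exact: cmeasurable_windowed_mellin.
apply: le_trans (energyB leb mC mup mvq) _.
apply: leeD; apply: lee_wpmul2l => //.
  rewrite -mellin_windowed L2_normB_energy.
  by apply: le_energy_subset mC measurableT mup _.
rewrite -mellin_windowed L2_normB_energy.
by apply: le_energy_subset mC measurableT mvq _.
Qed.

End windowed_transform.
End compactness.

(** * Uniformly small tails force compactness *)

Section converse.
Context {R : realType}.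
Local Open Scope complex_scope.
Local Notation leb := (@lebesgue_measure R).
Local Notation RR := (measurableTypeR R).
Implicit Types (f g : L2 (@haar R)) (xi eta e : R).

(** Arzela-Ascoli in the language of ultrafilters. At each point the values
    are bounded, hence converge along U; equicontinuity spreads this to a
    neighborhood of the point, and compactness of [a, b] makes it uniform, as
    a statement on pairs (f, g) near U. *)
Lemma ultra_equicontinuous_cauchy (T : Type) (U : set_system T) (h : T -> R -> R)
    (B Lam kap a b : R) : UltraFilter U -> 0 < kap -> 0 <= Lam ->
  (\forall f \near U, forall w, `|h f w| <= B) ->
  (\forall f \near U, forall w w', `|h f w - h f w'| <= Lam * `|w - w'|) ->
  \forall p \near filter_prod U U, forall w, `[a, b]%classic w -> `|h p.1 w - h p.2 w| <= kap.
Proof.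
move=> UU k0 Lam0 hB hL; have PU : ProperFilter U by exact: ultra_proper.
have FU : Filter U by exact: filter_filter.
have cov := (compact_near_coveringP `[a, b]%classic).1 (@segment_compact R a b).
apply: (cov (T * T)%type (filter_prod U U) (fun p w => `|h p.1 w - h p.2 w| <= kap)
  (filter_prod_filter FU FU)).
  move=> w0 _.
  have [l hl] : exists l : R, forall dl, 0 < dl -> \forall f \near U, `|h f w0 - l| < dl.
    by apply: (@ultra_bounded_cvg _ _ _ _ B) => //; apply: filterS hB => f; apply.
  (* Adding 1 covers the case Lam = 0. *)
  pose r := kap / (4 * (Lam + 1)).
  have Lam1 : 0 < Lam + 1 by rewrite ltr_wpDl.
  have r0 : 0 < r by rewrite divr_gt0// mulr_gt0.
  have Lr : Lam * r <= kap / 4.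
    rewrite [leLHS](_ : _ = kap / 4 * (Lam / (Lam + 1))); last by rewrite /r; field; rewrite gt_eqF.
    by rewrite ler_piMr ?divr_ge0 ?(ltW k0)// ler_pdivrMr// mul1r lerDl.
  have k80 : 0 < kap / 8 by rewrite divr_gt0.
  pose A := [set f | `|h f w0 - l| < kap / 8 /\ forall w w', `|h f w - h f w'| <= Lam * `|w - w'|].
  have UA : U A by apply: filterI hL; exact: hl.
  exists (ball w0 r, A `*` A); first split => /=.
  - exact: nbhsx_ballx.
  - by exists (A, A).
  move=> [w [f g]] /= [w0w [[fl fL] [gl gL]]].
  have wr : Lam * `|w - w0| <= kap / 4.
    apply: le_trans Lr; rewrite ler_wpM2l// distrC ltW//.
  have E1 := le_trans (fL w w0) wr; have E2 := le_trans (gL w w0) wr.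
  rewrite (_ : h f w - h g w = (h f w - h f w0) - (h g w - h g w0) +
    ((h f w0 - l) - (h g w0 - l))); last by ring.
  apply: le_trans (ler_normD _ _) _.
  have E3 := le_trans (ler_normB (h f w - h f w0) (h g w - h g w0)) (lerD E1 E2).
  have E4 := le_trans (ler_normB (h f w0 - l) (h g w0 - l)) (lerD (ltW fl) (ltW gl)).
  apply: le_trans (lerD E3 E4) _; lra.
Qed.

Lemma eighth_quarter_lt1 (y : R) : y <= 1 -> 8^-1 * y + 4^-1 < 1.
Proof. lra. Qed.

Lemma addee_le (x y : \bar R) (a b : R) :
  (x <= a%:E)%E -> (y <= b%:E)%E -> (x + y <= (a + b)%:E)%E.
Proof. by move=> xa yb; rewrite EFinD; exact: leeD. Qed.

Lemma preimage_haar_tail xi : 1 <= xi ->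
  expR @^-1` (haar_tail xi) = ~` `[- ln xi, ln xi]%classic.
Proof.
move=> x1; have x0 : 0 < xi by rewrite (lt_le_trans ltr01).
have E x : (xi^-1 <= expR x <= xi) = (- ln xi <= x <= ln xi).
  by rewrite -{1 2}(lnK x0) -expRN !ler_expR.
apply/seteqP; split => x /=.
  by move=> [_ nx] /= xin; apply: nx; move: xin; rewrite /= !in_itv /= E.
move=> nx; split; first by rewrite /= in_itv /= andbT expR_gt0.
by move=> xin; apply: nx; move: xin; rewrite /= !in_itv /= E.
Qed.

(** It suffices that U is Cauchy. Choose xi so that tails are below e^2 / 48.
    On [- xi, xi] the transforms of the windowed functions are bounded and
    equi-Lipschitz, uniformly over K, so they are uniformly close to each
    other near U, and [L2_dist_windowed] bounds the distance in norm. *)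
Lemma uniform_tail_ultra_cvg (K : set (L2 (@haar R))) (M : R) :
  (forall f, K f -> `|f| <= M) ->
  (forall eta, 0 < eta -> exists2 xi, 1 <= xi & forall f, K f -> (tail f xi <= eta%:E)%E) ->
  forall U : set_system (L2 (@haar R)), UltraFilter U -> U K ->
  exists l : L2 (@haar R), U --> l.
Proof.
move=> KM Kt U UU UK; have PU : ProperFilter U by exact: ultra_proper.
have FU : Filter U by exact: filter_filter.
apply: L2_cauchy_cvg => e e0.
have eta0 : 0 < e ^+ 2 / 48 by rewrite divr_gt0// exprn_gt0.
have [xi xi1 Kxi] := Kt _ eta0.
have xi0 : 0 < xi by rewrite (lt_le_trans ltr01).
pose L := ln xi; have L0 : 0 <= L by exact: ln_ge0.
have [f0 Kf0] := filter_ex UK.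
have M0 : 0 <= M by apply: le_trans (KM _ Kf0); exact: (normr_ge0 f0).
pose B := 2 * L + M ^+ 2.
have B0 : 0 <= B by rewrite addr_ge0 ?sqr_ge0 ?mulr_ge0.
have fB f : K f -> \int[leb]_x modc (windowed L f x) <= B.
  move=> Kf; apply: le_trans (windowed_L1 L0 f) _; rewrite lerD2l.
  by rewrite ler_pXn2r ?nnegrE ?(normr_ge0 f)//; exact: KM.
have cw f := cmeasurable_windowed L f.
have iw f := absolutely_integrable_windowed L0 f.
have ow f := @windowed_out _ L f.
have k0 : 0 < e / (8 * xi) by rewrite divr_gt0// mulr_gt0.
have Lam0 : 0 <= 4 * pi * L * B by rewrite !mulr_ge0// pi_ge0.
have near_re : \forall p \near filter_prod U U, forall w, `[- xi, xi]%classic w ->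
    `|complex.Re (windowed_mellin L p.1 w) - complex.Re (windowed_mellin L p.2 w)| <= e / (8 * xi).
  apply: (@ultra_equicontinuous_cauchy _ U (fun f w => complex.Re (windowed_mellin L f w)) (2 * B) _ _ _ _ UU k0 Lam0).
    by apply: filterS UK => f Kf w; exact: (Re_fourier_bound (cw f) (iw f) (fB f Kf)).
  by apply: filterS UK => f Kf w w'; exact: (Re_fourier_lipschitz (cw f) (iw f) (ow f) L0 (fB f Kf)).
have near_im : \forall p \near filter_prod U U, forall w, `[- xi, xi]%classic w ->
    `|complex.Im (windowed_mellin L p.1 w) - complex.Im (windowed_mellin L p.2 w)| <= e / (8 * xi).
  apply: (@ultra_equicontinuous_cauchy _ U (fun f w => complex.Im (windowed_mellin L f w)) (2 * B) _ _ _ _ UU k0 Lam0).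
    by apply: filterS UK => f Kf w; exact: (Im_fourier_bound (cw f) (iw f) (fB f Kf)).
  by apply: filterS UK => f Kf w w'; exact: (Im_fourier_lipschitz (cw f) (iw f) (ow f) L0 (fB f Kf)).
have [[A1 A2] [UA1 UA2] subr] := near_re.
have [[A3 A4] [UA3 UA4] subi] := near_im.
have [f [[Af1 Af3] Kf]] := filter_ex (filterI (filterI UA1 UA3) UK).
exists f; apply: filterS (filterI (filterI UA2 UA4) UK) => g [[Ag2 Ag4] Kg].
have Hre := subr (f, g) (conj Af1 Ag2).
have Him := subi (f, g) (conj Af3 Ag4).
pose k : R := 2 * (e / (8 * xi)) ^+ 2.
have Hk w : `[- xi, xi]%classic w -> modc (windowed_mellin L f w - windowed_mellin L g w) ^+ 2 <= k.
  move=> Cw; rewrite modc_sqrE ReB ImB /k mulr_natl mulr2n.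
  have sq (x : R) : `|x| <= e / (8 * xi) -> x ^+ 2 <= (e / (8 * xi)) ^+ 2.
    by move=> xk; rewrite -(real_normK (num_real x)) ler_pXn2r ?nnegrE ?(ltW k0).
  by apply: lerD; apply: sq; [exact: Hre|exact: Him].
(* The bound is 2 * k * 2 xi + 12 * (e^2 / 48) = e^2 / (8 xi) + e^2 / 4. *)
have dist := L2_dist_windowed L0 (measurable_itv _) Hk.
have lebC : leb (`[- xi, xi]%classic : set RR) = (2 * xi)%:E.
  have := @lebesgue_measure_itv R `[- xi, xi]; rewrite /= => ->.
  by rewrite lte_fin gtrN// -EFinB; congr EFin; ring.
have t1 h : K h -> (energy leb (~` `[(- L)%R, L]%classic) (expR_pull h) <= (e ^+ 2 / 48)%:E)%E.
  move=> Kh; rewrite -(preimage_haar_tail xi1) -energy_haar.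
  - by apply: le_trans (Kxi h Kh); rewrite leeDl// energy_ge0.
  - exact: measurable_haar_tail.
  - exact: L2_fun_cmeasurable.
have t2 h : K h -> (energy leb (~` `[(- xi)%R, xi]%classic) (mellin h) <= (e ^+ 2 / 48)%:E)%E.
  by move=> Kh; apply: le_trans (Kxi h Kh); rewrite leeDr// energy_ge0.
have : ((`|f - g| ^+ 2)%:E <= (2 * (k * (2 * xi)) +
    2 * (2 * (e ^+ 2 / 48) + 2 * (e ^+ 2 / 48)) + (2 * (e ^+ 2 / 48) + 2 * (e ^+ 2 / 48)))%:E)%E.
  apply: le_trans dist _; apply: addee_le; last first.
    by apply: addee_le; apply: mul2_le; exact: t2.
  apply: addee_le; first by rewrite lebC; apply: mul2_le; rewrite -EFinM.
  by apply: mul2_le; apply: addee_le; apply: mul2_le; exact: t1.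
rewrite lee_fin => fge.
rewrite -(@ltr_pXn2r _ 2) ?nnegrE ?(normr_ge0 (f - g)) ?(ltW e0)//.
apply: le_lt_trans fge _.
rewrite (_ : _ + _ = e ^+ 2 * (8^-1 / xi + 4^-1)); last by rewrite /k; field; rewrite gt_eqF.
rewrite gtr_pMr ?exprn_gt0//.
by apply: eighth_quarter_lt1; rewrite invf_le1.
Qed.

End converse.

Unset Implicit Arguments.
Set Strict Implicit.
Set Printing Implicit Defensive.

Theorem theorem4p1 (R : realType) (K : set (L2 (@haar R)))
    (bK : bounded_set K) :
  precompact K <->
  (fun xi : R => nnsup [set
    (\int[@haar R]_(x in (`]0, +oo[ `\` `[xi^-1, xi])%R) (modc (f x) ^+ 2)%:E +
     \int[@lebesgue_measure R]_(w in (~` `[- xi, xi])%R)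
       (modc (mellin f w) ^+ 2)%:E)%E | f in K]) @ +oo%R --> 0%E.
Proof.
pose S xi := nnsup [set tail f xi | f in K].
change (precompact K <-> S @ +oo%R --> 0%E).
have S0 xi : (0 <= S xi)%E by apply: ereal_sup_ubound; left.
have S_le xi (e : R) : 0 <= e -> (S xi <= e%:E)%E <-> forall f, K f -> (tail f xi <= e%:E)%E.
  move=> e0; split => [Se f Kf|Ke].
    by apply: le_trans Se; apply: ereal_sup_ubound; right; exists f.
  by apply: ge_ereal_sup => _ [->|[f Kf <-]]; [rewrite lee_fin|exact: Ke].
split => [cK|].
  apply/ge0_cvge0P => // e e0.
  by apply: filterS (precompact_uniform_tail e0 cK) => xi H; apply/S_le => //; exact: ltW.
move=> /(ge0_cvge0P _ S0) S_small.
rewrite precompactE compact_ultra => U UU UK.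
have [M [Mr HM]] := bK.
have KM f : closure K f -> `|f| <= M + 2.
  move=> Kf; have [g Kg fg] := closure_approx ltr01 Kf.
  rewrite -(subrK g f) (le_trans (ler_normD _ _))//.
  have : `|g| <= M + 1 by apply: (HM (M + 1)); rewrite ?ltrDl.
  by move: fg; lra.
have Kt eta : 0 < eta -> exists2 xi, 1 <= xi & forall f, closure K f -> (tail f xi <= eta%:E)%E.
  move=> eta0; have e40 : 0 < eta / 4 by rewrite divr_gt0.
  have [N [Nr HN]] := S_small _ e40.
  exists (Num.max 1 (N + 1)); first by rewrite le_max lexx.
  apply: closure_tail => //.
  apply/S_le; first exact: ltW.
  by apply: HN; rewrite lt_max ltrDl ltr01 orbT.
have [l Ul] := uniform_tail_ultra_cvg KM Kt UU UK.
exists l; split => //.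
have PU : ProperFilter U by exact: ultra_proper.
(* The closure is closed and belongs to U, so it contains the limit. *)
apply: closed_closure => B Bl.
by have [x [Kx Bx]] := filter_ex (filterI UK (Ul _ Bl)); exists x.
Qed.
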